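(* Let $(\Omega,\mathcal{F},\mathbb{P})$ be a complete probability space carrying a standard Brownian motion $(B_t)_{t\ge0}$ and an independent random variable $\theta$ with values in $\{-1,1\}$, $p=\mathbb{P}(\theta=1)$. Let $\mu>0$ and $c_0,c_1,c_2>0$ be constants, and let the observed process be $X_t=\mu\theta t+B_t$. Let $\mathbb{F}^X=(\mathcal{F}^X_t)_{t\ge0}$ be the completed right-continuous filtration generated by $X$, and let $M_t=\mathbb{E}(\theta\mid\mathcal{F}^X_t)$ be the posterior mean process (explicitly, $M_t = 1 - \frac{2(1-p)}{p e^{2\mu X_t}+1-p}$). A decision rule is a triple $\delta=(\tau_0,d,T)$, where $\tau_0$ is an $\mathbb{F}^X$-stopping time, $d$ is an $\mathcal{F}^X_{\tau_0}$-measurable random variable with values in $\{-1,1\}$, and $T=(\tau_1,\tau_2,\dots)$ is a sequence of $\mathbb{F}^X$-stopping times with $\tau_n\le\tau_{n+1}$ for all $n\ge0$ (possibly $\tau_n=+\infty$). Associate with $\delta$ the process \[ D_t^\delta=\begin{cases}0,& t<\tau_0,\\ d,& t\in[\tau_{2n},\tau_{2n+1}),\\ -d,& t\in[\tau_{2n+1},\tau_{2n+2}),\end{cases}\qquad n\ge 0, \] and the Bayesian risk \[ R(\delta)=\mathbb{E}\Bigl(c_0\tau_0+c_1\int_{\tau_0}^\infty \mathbf{1}(D^\delta_t\ne\theta)\,dt+c_2\sum_{t>\tau_0}\mathbf{1}(D^\delta_{t-}\ne D^\delta_t)\Bigr). \] Let $B\in(0,1)$ be the unique solution of $\ln\frac{1-B}{1+B}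 + \frac{2B}{1-B^2} = \frac{2\mu^2c_2}{c_1}$, and let $A\in(0,1)$ be the unique solution of $\bigl(\frac{c_1}{2c_0} -1\bigr) \ln\frac{1-A}{1+A} + \frac{2}{1+A}\bigl(\frac{c_1}{2c_0} + \frac{A}{1-A} \bigr) = \frac{c_1}{c_0(1-B^2)}$. Define $\delta^*=(\tau_0^*,d^*,T^* )$ by \[ \tau_0^*=\inf\{t\ge0: |M_t|\ge A\},\qquad d^*=\operatorname{sgn} M_{\tau_0^*}, \] and $T^*=(\tau^*_n)_{n\ge1}$ given, for $k\ge0$, on the event $\{d^*=1\}$ by \[ \tau^*_{2k+1}=\inf\{t\ge\tau^*_{2k}: M_t\le -B\},\qquad \tau^*_{2k+2}=\inf\{t\ge\tau^*_{2k+1}: M_t\ge B\}, \] and on the event $\{d^*=-1\}$ by \[ \tau^*_{2k+1}=\inf\{t\ge\tau^*_{2k}: M_t\ge B\},\qquad \tau^*_{2k+2}=\inf\{t\ge\tau^*_{2k+1}: M_t\le -B\}, \] with $\inf\emptyset=+\infty$. Then $\delta^*$ is optimal: $R(\delta^* )=\inf_\delta R(\delta)$, the infimum being over all decision rules $\delta$.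
   Context: $\operatorname{sgn}$ denotes the sign function; $\mathbf{1}(\cdot)$ is the indicator. The sum $\sum_{t>\tau_0}\mathbf{1}(D^\delta_{t-}\ne D^\delta_t)$ counts the number of changes of decision after $\tau_0$. *)

(* Defs.v *)
From HB Require Import structures.
From mathcomp Require Import all_boot all_order all_algebra.
From mathcomp Require Import all_classical all_reals all_analysis.
Set Implicit Arguments. Unset Strict Implicit. Unset Printing Implicit Defensive.
Import Order.TTheory GRing.Theory Num.Theory.
Import numFieldNormedType.Exports.
Local Open Scope classical_set_scope.
Local Open Scope ring_scope.

Section Defs.
Context {R : realType} {dO : measure_display} {Omega : measurableType dO}.
Variable (P : probability Omega R).

Definition complete_prob := forall N : set Omega, measurable N -> P N = 0%E ->
  forall E, E `<=` N -> measurable E.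

Definition BM_indep (B : R -> Omega -> R) (theta : Omega -> R) :=
  [/\ forall w, B 0 w = 0,
      forall w, {within [set t : R | 0 <= t], continuous (fun t => B t w)},
      forall t, measurable_fun setT (B t),
      measurable_fun setT theta &
      forall (n : nat) (ts : nat -> R) (As : nat -> set R) (S : set R),
        0 <= ts 0 -> (forall i, (i < n)%N -> ts i < ts i.+1) ->
        (forall i, measurable (As i)) -> measurable S ->
        P ([set w | S (theta w)] `&`
           \bigcap_(i in [set i | (i < n)%N])
              [set w | As i (B (ts i.+1) w - B (ts i) w)])
        = (P [set w | S (theta w)] *
           \prod_(i < n) normal_prob 0 (Num.sqrt (ts i.+1 - ts i)) (As i))%E].

Definition Pnull (N : set Omega) := measurable N /\ P N = 0%E.

Definition completeF (G : set (set Omega)) : set (set Omega) :=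
  [set E | exists2 H, G H & exists2 N, Pnull N &
     (E `\` H) `|` (H `\` E) `<=` N].

Definition natF (X : R -> Omega -> R) (u : R) : set (set Omega) :=
  <<s [set E | exists s, 0 <= s <= u /\
         exists2 A, measurable A & E = X s @^-1` A] >>.

Definition FX (X : R -> Omega -> R) (t : R) : set (set Omega) :=
  completeF [set E | forall u, t < u -> natF X u E].

Definition FXinf (X : R -> Omega -> R) : set (set Omega) :=
  completeF <<s [set E | exists s, 0 <= s /\
         exists2 A, measurable A & E = X s @^-1` A] >>.

Definition stopping_time (X : R -> Omega -> R) (tau : Omega -> \bar R) :=
  (forall w, (0 <= tau w)%E) /\
  forall t, 0 <= t -> FX X t [set w | (tau w <= t%:E)%E].

Definition FXstop (X : R -> Omega -> R) (tau : Omega -> \bar R) : set (set Omega) :=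
  [set E | FXinf X E /\
     forall t, 0 <= t -> FX X t (E `&` [set w | (tau w <= t%:E)%E])].

Definition decision_rule (X : R -> Omega -> R) (tau : nat -> Omega -> \bar R)
    (d : Omega -> R) :=
  [/\ forall n, stopping_time X (tau n),
      forall n w, (tau n w <= tau n.+1 w)%E,
      forall w, d w = 1 \/ d w = -1 &
      forall A : set R, measurable A -> FXstop X (tau 0%N) (d @^-1` A)].

(* the process D^delta; 0 where not covered by the definition *)
Definition Dproc (tau : nat -> Omega -> \bar R) (d : Omega -> R) (t : R)
    (w : Omega) : R :=
  if `[< exists n, (tau (2 * n)%N w <= t%:E < tau (2 * n).+1 w)%E >] then d w
  else if `[< exists n, (tau (2 * n).+1 w <= t%:E < tau (2 * n).+2 w)%E >]
  then - d w else 0.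

Definition Djump (tau : nat -> Omega -> \bar R) (d : Omega -> R) (t : R)
    (w : Omega) : Prop :=
  ~ (Dproc tau d s w @[s --> t^'-] --> Dproc tau d t w).

Definition risk (theta : Omega -> R) (c0 c1 c2 : R)
    (tau : nat -> Omega -> \bar R) (d : Omega -> R) : \bar R :=
  (\int[P]_w
     (c0%:E * tau 0%N w
      + c1%:E * \int[lebesgue_measure]_(t in [set t : R | (tau 0%N w <= t%:E)%E])
                  ((Dproc tau d t w != theta w)%:R)%:E
      + c2%:E * \esum_(t in [set t : R | (tau 0%N w < t%:E)%E /\ Djump tau d t w])
                  1))%E.

(* explicit posterior mean M_t = E(theta | F^X_t) *)
Definition postM (p mu : R) (X : R -> Omega -> R) (t : R) (w : Omega) : R :=
  1 - 2 * (1 - p) / (p * expR (2 * mu * X t w) + 1 - p).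

Definition tau0_star (M : R -> Omega -> R) (A : R) (w : Omega) : \bar R :=
  ereal_inf [set t%:E | t in [set t : R | 0 <= t /\ A <= `|M t w|]].

Definition d_star (M : R -> Omega -> R) (A : R) (w : Omega) : R :=
  if tau0_star M A w is r%:E then Num.sg (M r w) else 1.

Definition star_cond (M : R -> Omega -> R) (A B : R) (m : nat) (w : Omega)
    (t : R) : bool :=
  if d_star M A w == 1 then (if odd m then M t w <= - B else B <= M t w)
  else (if odd m then B <= M t w else M t w <= - B).

Fixpoint tau_star (M : R -> Omega -> R) (A B : R) (n : nat) (w : Omega) : \bar R :=
  match n with
  | 0 => tau0_star M A w
  | m.+1 => ereal_inf [set t%:E | t in
              [set t : R | (tau_star M A B m w <= t%:E)%E /\ star_cond M A B m.+1 w t]]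
  end.

End Defs.

(* Main.v *)
(*
Write M for the posterior mean and L for its log-odds, an affine function of the observation.
By Bayes' formula on the raw past, the processes v(M_t) + c1 int 1(theta <> 1) dt and
u(M_t) + c0 t, where v(x) and u(x) are (1 - x)(k L + a) and C - ke x L, are martingales along any
deterministic pair of times; this replaces Ito's formula. The value functions differ from v and u
by convex C^1 functions vanishing on the continuation regions.

Lower bound. Tangent lines of the convex parts and the martingale property of M give the Bellman
inequality for every time step. A decision process sampled on a grid of mesh h costs at most
(1 + h c1 / c2) times its loss plus c0 h; summing the Bellman inequality along the grid and letting
the grid reach infinity and then h go to 0 yields risk >= U(2p - 1).

Upper bound. Between two consecutive hitting times the posterior stays in a continuation region,
where v and u, truncated to be bounded, satisfy the one-step identity up to O(h^2). Summing over a
grid between the two times telescopes pathwise, and dominated convergence as h goes to 0 gives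
optional stopping. Adding up the stages and letting the horizon go to infinity yields
risk <= U(2p - 1). When p is 0 or 1 the posterior is constant and the risk is 0.
*)
Require Import Defs.
From HB Require Import structures.
From mathcomp Require Import all_boot all_order all_algebra.
From mathcomp Require Import all_classical all_reals all_analysis.
From mathcomp Require Import measurable_realfun normal_distribution.
From mathcomp Require Import ring lra.
Set Implicit Arguments. Unset Strict Implicit. Unset Printing Implicit Defensive.
Import Order.TTheory GRing.Theory Num.Theory.
Import numFieldNormedType.Exports.
Local Open Scope classical_set_scope.
Local Open Scope ring_scope.

(** * The candidate value functions *)

(** Conditional expectations are never formed: a martingale property is an equality of means over
    every event of the raw past [natF], which Dynkin's lemma and the explicit likelihood ratio
    provide. With k = c1 / (4 mu^2) and ke = c0 / (2 mu^2) the log-odds terms drift at the rates of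
    the running costs: 2 k mu^2 = c1 / 2, while 1 - e theta is 2 when the decision e is wrong, and 2
    ke mu^2 = c0. The boundaries enter through two fits: [aa] and the equation for B make Vf - vf
    vanish together with its slope at -B; [Cu] and the equation for A do the same for Uf - uf at A.
    Boundedness is the main obstacle. The slopes of the convex parts blow up at the ends of (-1, 1),
    so the martingale M is first tested against truncated slopes. vf tends to - infinity at -1, and
    uf at both ends, hence the cut-off versions [vt] and [ut]. A competing rule is adapted only to
    the completed right-continuous filtration, and measurability of its cost is not established:
    grid states settle the first point, lower integrals the second. *)

Section Deriv.
Context {R : realType}.
Implicit Types (f g : R -> R) (x y : R).

Definition isd x f (a : R) : Prop := is_derive x 1 f a.

Lemma is_deriv_eq x f a b : isd x f a -> a = b -> isd x f b.
Proof. by move=> h <-. Qed.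

Lemma is_derivD x f g a b : isd x f a -> isd x g b ->
  isd x (fun y => f y + g y) (a + b).
Proof. by move=> h1 h2; exact: is_deriveD. Qed.

Lemma is_derivM x f g a b : isd x f a -> isd x g b ->
  isd x (fun y => f y * g y) (f x * b + g x * a).
Proof. by move=> h1 h2; exact: is_deriveM. Qed.

Lemma is_derivV x f a : f x != 0 -> isd x f a ->
  isd x (fun y => (f y)^-1) (- (f x)^-2 * a).
Proof. by move=> h1 h2; exact: is_deriveV. Qed.

Lemma is_deriv_cst x (c : R) : isd x (fun _ : R => c) 0.
Proof. exact: is_derive_cst. Qed.

Lemma is_deriv_id x : isd x (fun y : R => y) 1.
Proof. exact: is_derive_id. Qed.

Lemma is_derivN x f a : isd x f a -> isd x (fun y => - f y) (- a).
Proof. by move=> h; exact: is_deriveN. Qed.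

(** No order is imposed on x and y, so that a tangent inequality can be read off on both sides of
    its base point. *)
Lemma mvt f (f' : R -> R) : (forall z : R, -1 < z < 1 -> isd z f (f' z)) ->
  forall x y : R, -1 < x < 1 -> -1 < y < 1 ->
  exists c, (x <= c <= y \/ y <= c <= x) /\ f y - f x = f' c * (y - x).
Proof.
move=> h.
have key x y : -1 < x -> x <= y -> y < 1 ->
    exists c, x <= c <= y /\ f y - f x = f' c * (y - x).
  move=> x1 xy y1.
  have [] := @MVT_segment R f f' x y xy.
  - by move=> z; rewrite in_itv/= => /andP[? ?]; apply: h; apply/andP; split; lra.
  - apply: derivable_within_continuous => z; rewrite in_itv/= => /andP[? ?].
    have : isd z f (f' z) by apply: h; apply/andP; split; lra.
    by case.
  by move=> c; rewrite in_itv/= => cxy e; exists c.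
move=> x y /andP[x1 x2] /andP[y1 y2]; have [xy|yx] := leP x y.
  by have [c [h1 h2]] := key x y x1 xy y2; exists c; split; [left|].
have [c [h1 h2]] := key y x y1 (ltW yx) x2; exists c; split; [by right|].
lra.
Qed.

Definition LL x : R := ln ((1 - x) / (1 + x)).

Lemma LL_arg_gt0 x : -1 < x < 1 -> 0 < (1 - x) / (1 + x).
Proof. by move=> /andP[? ?]; apply: divr_gt0; lra. Qed.

Lemma LLN x : -1 < x < 1 -> LL (- x) = - LL x.
Proof.
move=> hx; rewrite /LL -lnV; last by rewrite posrE; exact: LL_arg_gt0.
by rewrite invf_div opprK.
Qed.

Lemma LL0 : LL 0 = 0.
Proof. by rewrite /LL subr0 addr0 divr1 ln1. Qed.

Lemma LL_deriv x : -1 < x < 1 -> isd x LL (- 2 / (1 - x ^+ 2)).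
Proof.
move=> hx; have /andP[h1 h2] := hx.
have d1 : isd x (fun y : R => (1 - y) / (1 + y))
    ((1 - x) * (- (1 + x)^-2 * (0 + 1)) + (1 + x)^-1 * (0 + - 1)).
  apply: (is_derivM (f := fun y : R => 1 - y) (g := fun y : R => (1 + y)^-1)).
    by apply: is_derivD; [exact: is_deriv_cst|exact/is_derivN/is_deriv_id].
  apply: is_derivV; first by rewrite gt_eqF//; lra.
  by apply: is_derivD; [exact: is_deriv_cst|exact: is_deriv_id].
have d2 : isd x LL _ := @is_derive1_comp R (@ln R) (fun y : R => (1 - y) / (1 + y)) x _ _
  (is_derive1_ln (LL_arg_gt0 hx)) d1.
move: d2.
move=> /is_deriv_eq; apply.
have e : 1 - x ^+ 2 = (1 - x) * (1 + x) by ring.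
by rewrite e; field; apply/andP; split; rewrite gt_eqF; lra.
Qed.

Lemma sq_gt0 x : -1 < x < 1 -> 0 < 1 - x ^+ 2.
Proof. by move=> /andP[? ?]; rewrite (_ : 1 - _ = (1 - x) * (1 + x)); [apply: mulr_gt0; lra|ring]. Qed.

(** [LL] is convex only on (-1, 0]. Its slope -2 / (1 - c^2) depends on c^2 alone, so the tangent at
    x <= 0 stays below the graph up to the mirror point -x. *)
Lemma LL_tangent x y : -1 < x -> x <= 0 -> -1 < y -> y <= - x ->
  LL x - 2 / (1 - x ^+ 2) * (y - x) <= LL y.
Proof.
move=> x1 x0 y1 yx; have hx : -1 < x < 1 by apply/andP; split; lra.
have hy : -1 < y < 1 by apply/andP; split; lra.
have [c [hc e]] := mvt LL_deriv hx hy.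
rewrite -lerBrDl e mulNr.
case: hc => /andP[c1 c2].
  rewrite -subr_ge0 (_ : _ - _ = (2 / (1 - x ^+ 2) - 2 / (1 - c ^+ 2)) * (y - x)); last by ring.
  apply: mulr_ge0; last lra.
  rewrite subr_ge0 ler_pM2l// lef_pV2 ?posrE; [|apply: sq_gt0; apply/andP; split; lra..].
  nra.
rewrite -subr_ge0 (_ : _ - _ = (2 / (1 - c ^+ 2) - 2 / (1 - x ^+ 2)) * (x - y)); last by ring.
apply: mulr_ge0; last lra.
rewrite subr_ge0 ler_pM2l// lef_pV2 ?posrE; [|apply: sq_gt0; apply/andP; split; lra..].
nra.
Qed.

Lemma LL_decr x y : -1 < x -> x <= y -> y < 1 -> LL y <= LL x.
Proof.
move=> x1 xy y1.
rewrite /LL ler_ln ?posrE; [|apply: LL_arg_gt0; apply/andP; split; lra..].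
rewrite ler_pdivrMr; last lra.
rewrite mulrAC ler_pdivlMr; last lra.
nra.
Qed.

End Deriv.

(* With k = c1 / (4 mu^2) and ke = c0 / (2 mu^2) these are the equations of the thresholds B and A;
   LL x is minus the log-odds of a posterior mean x. *)
Record params_ok {R : realType} (k ke c2 B A : R) : Prop := ParamsOk {
  k_gt0 : 0 < k; ke_gt0 : 0 < ke; c2_gt0 : 0 < c2;
  B_gt0 : 0 < B; B_lt1 : B < 1; A_gt0 : 0 < A; A_lt1 : A < 1;
  boundaryB : 2 * k * (LL B + 2 * B / (1 - B ^+ 2)) = c2;
  boundaryA : (k - ke) * LL A + 2 / (1 + A) * (k + ke * (A / (1 - A))) =
    2 * k / (1 - B ^+ 2) }.

Section Values.
Context {R : realType}.
Variables (k ke c2 B A : R).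
Hypothesis ok : params_ok k ke c2 B A.
(** The free constant of [vf], fixed by smooth fit at -B; see [slopeB]. *)
Definition aa : R := 2 * k / (1 - B ^+ 2).
Let k0 := k_gt0 ok. Let ke0 := ke_gt0 ok. Let c20 := c2_gt0 ok.
Let B0 := B_gt0 ok. Let B1 := B_lt1 ok. Let A0 := A_gt0 ok. Let A1 := A_lt1 ok.
Ltac use_params := have := k_gt0 ok; have := ke_gt0 ok; have := c2_gt0 ok; have := B_gt0 ok;
  have := B_lt1 ok; have := A_gt0 ok; have := A_lt1 ok; move=> ? ? ? ? ? ? ?.
Ltac slra := use_params; lra.
Ltac snra := use_params; nra.
Implicit Types x y : R.

(* Uf is the optimal expected cost before the first decision, Vf the one while the decision is 1,
   at posterior mean x; vf and uf solve the free boundary problems in the continuation regions. *)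
Definition vf x : R := (1 - x) * (aa - k * LL x).
(** Makes [uf] and [vf] agree at [A]. *)
Definition Cu : R := vf A - ke * A * LL A.
Definition uf x : R := Cu + ke * x * LL x.
Definition Vf x : R := if - B <= x then vf x else vf (- x) + c2.
Definition Uf x : R := if `|x| <= A then uf x else vf `|x|.

Lemma vfE x : vf x = (1 - x) * (aa - k * LL x). Proof. by []. Qed.
Lemma CuE : Cu = vf A - ke * A * LL A. Proof. by []. Qed.
Lemma ufE x : uf x = Cu + ke * x * LL x. Proof. by []. Qed.
Lemma VfE x : Vf x = if - B <= x then vf x else vf (- x) + c2. Proof. by []. Qed.
Lemma UfE x : Uf x = if `|x| <= A then uf x else vf `|x|. Proof. by []. Qed.
(** The derivative of the convex part [Vf - vf], which is [psi] below -B and 0 elsewhere. *)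
Definition Vslope x : R := if - B <= x then 0 else aa * 2 - 4 * k / (1 - x ^+ 2).

Let sB : 0 < 1 - B ^+ 2.
Proof. by apply: sq_gt0; apply/andP; split; slra. Qed.

Let aa0 : 0 < aa.
Proof. by apply: divr_gt0 => //; slra. Qed.

(** The loss from switching at x rather than continuing with [vf]; see [psiE]. *)
Definition psi x : R := c2 + 2 * k * LL x + 2 * aa * x.

Let psiE x : -1 < x < 1 -> vf (- x) + c2 - vf x = psi x.
Proof. by move=> hx; rewrite /vf /psi LLN//; ring. Qed.

Let c2E : c2 = 2 * k * LL B + 2 * aa * B.
Proof. by rewrite -(boundaryB ok) /aa; field; rewrite gt_eqF. Qed.

Let hBB : -1 < B < 1. Proof. by apply/andP; split; slra. Qed.

(** Continuity of [Vf] at -B, which is the equation for [B]. *)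
Let psiB : psi (- B) = 0.
Proof. by rewrite /psi LLN// c2E; ring. Qed.

Let psi_tangent x y : -1 < x -> x <= 0 -> -1 < y -> y <= - x ->
  psi x + (aa * 2 - 4 * k / (1 - x ^+ 2)) * (y - x) <= psi y.
Proof.
move=> x1 x0 y1 yx; have := LL_tangent x1 x0 y1 yx => h.
have h2 : 0 <= 2 * k * (LL y - (LL x - 2 / (1 - x ^+ 2) * (y - x))).
  by apply: mulr_ge0; [slra|rewrite subr_ge0].
rewrite -subr_ge0; rewrite (_ : _ - _ = 2 * k * (LL y - (LL x - 2 / (1 - x ^+ 2) * (y - x)))) //.
by rewrite /psi; ring.
Qed.

(** Smooth fit at -B. *)
Let slopeB : aa * 2 - 4 * k / (1 - (- B) ^+ 2) = 0.
Proof. by rewrite /aa sqrrN; ring. Qed.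

(** The tangent of [psi] at -B is the zero line, and [LL_tangent] carries it up to the mirror point
    B. *)
Let psi_ge0 y : -1 < y -> y <= B -> 0 <= psi y.
Proof.
move=> y1 yB; have := @psi_tangent (- B) y.
by rewrite slopeB psiB mul0r addr0; apply; slra.
Qed.

(** Pays for a change of decision on the grid. For |x| <= B it is [psi_ge0]; otherwise one of the
    two values is itself defined by switching. *)
Lemma VfN x : -1 < x < 1 -> Vf x <= Vf (- x) + c2.
Proof.
move=> /andP[x1 x2]; rewrite /Vf opprK.
case: ifPn => [xB|]; last rewrite -ltNge => xB.
  case: ifPn => [xB'|]; last rewrite -ltNge => xB'; last first.
    by slra.
  rewrite -subr_ge0 psiE; last by apply/andP; split; slra.
  by apply: psi_ge0; slra.
by rewrite ifT//; slra.
Qed.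

Lemma Vf_tangent x y : -1 < x < 1 -> -1 < y < 1 ->
  vf y - vf x + Vslope x * (y - x) <= Vf y - Vf x.
Proof.
move=> hx hy; have /andP[x1 x2] := hx; have /andP[y1 y2] := hy.
have vfB z : -1 < z < 1 -> Vf z = vf z + (if - B <= z then 0 else psi z).
  by move=> hz; rewrite /Vf -psiE//; case: ifP => _; slra.
rewrite !vfB//.
suff : (if - B <= x then 0 else psi x) + Vslope x * (y - x) <= (if - B <= y then 0 else psi y) by slra.
rewrite /Vslope; case: (leP (- B) x) => xB.
  rewrite mul0r addr0; case: (leP (- B) y) => // yB.
  by apply: psi_ge0; slra.
case: (leP (- B) y) => yB; last first.
  by apply: psi_tangent; slra.
(* Here x < -B <= y: the tangent at x is at most 0 at -B and, its slope being nonpositive, also at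
   y. *)
have s0 : aa * 2 - 4 * k / (1 - x ^+ 2) <= 0.
  rewrite /aa subr_le0 (_ : _ * 2 = 4 * k / (1 - B ^+ 2)); last by ring.
  rewrite ler_pM2l; last by slra.
  rewrite lef_pV2 ?posrE//; last exact: sq_gt0.
  snra.
have := @psi_tangent x (- B); rewrite psiB => t.
have {}t := t x1 _ _ _.
have t1 : psi x + (aa * 2 - 4 * k / (1 - x ^+ 2)) * (- B - x) <= 0 by apply: t; slra.
have : (aa * 2 - 4 * k / (1 - x ^+ 2)) * (y - x) <= (aa * 2 - 4 * k / (1 - x ^+ 2)) * (- B - x).
  by rewrite ler_wnM2l//; slra.
slra.
Qed.

(** Since c2 > 0, the equation for [B] gives k LL B > - aa B. With LL x <= - LL B the second factor
    of [vf] then exceeds aa (1 - B). *)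
Lemma vf_gt0 x : - B <= x -> x < 1 -> 0 < vf x.
Proof.
move=> xB x1; apply: mulr_gt0; first slra.
have : LL x <= LL (- B) by apply: LL_decr; slra.
rewrite LLN// => h.
have h1 : k * LL x <= - (k * LL B) by rewrite -mulrN ler_pM2l.
have h2 : 0 < aa - aa * B by have := aa0; snra.
have := c2E; have := c20; slra.
Qed.

Lemma Vf_ge0 x : -1 < x < 1 -> 0 <= Vf x.
Proof.
move=> /andP[x1 x2]; rewrite /Vf; case: ifPn => [xB|].
  by apply/ltW/vf_gt0.
rewrite -ltNge => xB; apply: addr_ge0; last exact: ltW.
by apply/ltW/vf_gt0; slra.
Qed.

(** psi 0 = c2, and on [0, B] the slope 2 aa - 4 k / (1 - c^2) of [psi] is nonnegative. *)
Let psi_le x : 0 <= x <= B -> c2 <= psi x.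
Proof.
move=> /andP[x0 xB].
have hx : -1 < x < 1 by apply/andP; split; slra.
have h0 : -1 < (0 : R) < 1 by apply/andP; split; slra.
have [c [hc]] := mvt (@LL_deriv R) h0 hx.
rewrite LL0 !subr0 /psi => ->.
have {}hc : 0 <= c <= x.
  by case: hc => // /andP[? ?]; apply/andP; split; slra.
move: hc => /andP[c0' cx].
have e : (1 - c ^+ 2)^-1 <= (1 - B ^+ 2)^-1.
  rewrite lef_pV2 ?posrE//; first by snra.
  by apply: sq_gt0; apply/andP; split; slra.
have : 0 <= 4 * k * ((1 - B ^+ 2)^-1 - (1 - c ^+ 2)^-1) * x.
  by apply: mulr_ge0 => //; apply: mulr_ge0; [slra|rewrite subr_ge0].
by rewrite /aa; slra.
Qed.

(** Expresses that the first decision should follow the sign of the posterior mean. For -B <= x < 0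
    the gap is psi (- x) - c2; below -B it is c2. *)
Lemma Vf_abs x : -1 < x < 1 -> Vf `|x| <= Vf x.
Proof.
move=> hx; have /andP[x1 x2] := hx; have [x0|x0] := leP 0 x; first by rewrite ger0_norm.
rewrite ltr0_norm// /Vf; case: (leP (- B) x) => xB; last first.
  by rewrite ifT; [have := c20; slra|slra].
rewrite ifT; last slra.
have hx' : -1 < - x < 1 by apply/andP; split; slra.
have := psiE hx'; rewrite opprK => e.
have := @psi_le (- x) => /(_ _) h.
have : c2 <= psi (- x) by apply: h; apply/andP; split; slra.
slra.
Qed.

Definition dpsi0 x : R := (k - ke) * LL x + 2 * k / (1 + x) + 2 * ke * x / (1 - x ^+ 2) - aa.

Let psi0_deriv x : -1 < x < 1 -> isd x (fun y => vf y - uf y) (dpsi0 x).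
Proof.
move=> hx; have /andP[x1 x2] := hx; have dL := LL_deriv hx.
have d1 : isd x vf ((1 - x) * (0 + - (k * (- 2 / (1 - x ^+ 2)) + LL x * 0))
    + (aa - k * LL x) * (0 + - 1)).
  apply: (is_derivM (f := fun y : R => 1 - y) (g := fun y : R => aa - k * LL y)).
    by apply: is_derivD; [exact: is_deriv_cst|exact/is_derivN/is_deriv_id].
  apply: is_derivD; first exact: is_deriv_cst.
  by apply: is_derivN; apply: is_derivM => //; exact: is_deriv_cst.
have d2 : isd x uf (0 + (ke * x * (- 2 / (1 - x ^+ 2)) + LL x * (ke * 1 + x * 0))).
  apply: is_derivD; first exact: is_deriv_cst.
  apply: (is_derivM (f := fun y : R => ke * y)) => //.
  by apply: is_derivM; [exact: is_deriv_cst|exact: is_deriv_id].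
have := is_derivD d1 (is_derivN d2); move=> /is_deriv_eq; apply.
rewrite /dpsi0; have e : 1 - x ^+ 2 = (1 - x) * (1 + x) by ring.
by rewrite !e; field; apply/andP; split; rewrite gt_eqF; slra.
Qed.

(** The sign is that of ke - k (1 - x), which increases with x. So [dpsi0] decreases and then
    increases on [0, 1), and its values at 0 and at A decide its sign elsewhere. *)
Let dpsi0_deriv x : -1 < x < 1 ->
  isd x dpsi0 (4 * (ke - k * (1 - x)) / (1 - x ^+ 2) ^+ 2).
Proof.
move=> hx; have /andP[x1 x2] := hx; have dL := LL_deriv hx.
have d1 : isd x (fun y => (k - ke) * LL y) ((k - ke) * (- 2 / (1 - x ^+ 2)) + LL x * 0).
  by apply: is_derivM => //; exact: is_deriv_cst.
have d2 : isd x (fun y : R => 2 * k / (1 + y)) (2 * k * (- (1 + x)^-2 * (0 + 1)) + (1 + x)^-1 * 0).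
  apply: is_derivM; first exact: is_deriv_cst.
  apply: is_derivV; first by rewrite gt_eqF//; slra.
  by apply: is_derivD; [exact: is_deriv_cst|exact: is_deriv_id].
have d3 : isd x (fun y : R => 2 * ke * y / (1 - y * y))
   (2 * ke * x * (- (1 - x * x)^-2 * (0 + - (x * 1 + x * 1))) + (1 - x * x)^-1 * (2 * ke * 1 + x * 0)).
  apply: (is_derivM (f := fun y : R => 2 * ke * y) (g := fun y => (1 - y * y)^-1)).
    by apply: is_derivM; [exact: is_deriv_cst|exact: is_deriv_id].
  apply: is_derivV; first by rewrite -expr2 gt_eqF// sq_gt0.
  apply: is_derivD; [exact: is_deriv_cst|apply: is_derivN].
  by apply: is_derivM; exact: is_deriv_id.
have := is_derivD (is_derivD (is_derivD d1 d2) d3) (is_deriv_cst x (- aa)).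
move=> /is_deriv_eq; apply.
have e : 1 - x ^+ 2 = (1 - x) * (1 + x) by ring.
have e2 : 1 - x * x = (1 - x) * (1 + x) by ring.
by rewrite !e ?e2; field; apply/andP; split; rewrite gt_eqF; slra.
Qed.

Let hAA : -1 < A < 1. Proof. by apply/andP; split; slra. Qed.

(** Smooth fit at [A], which is the equation for [A]. *)
Let dpsi0A : dpsi0 A = 0.
Proof.
rewrite /dpsi0 /aa -(boundaryA ok); have e : 1 - A ^+ 2 = (1 - A) * (1 + A) by ring.
by rewrite e; field; apply/andP; split; rewrite gt_eqF; slra.
Qed.

Let dpsi00 : dpsi0 0 < 0.
Proof.
rewrite /dpsi0 LL0 expr0n/= !subr0 addr0 mulr0 add0r !mulr0 mul0r addr0 divr1 subr_lt0.
by rewrite /aa ltr_pdivlMr// gtr_pMr; [snra|slra].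
Qed.

(** The positive factor e is kept abstract: only the sign of ke - k (1 - c) matters below. *)
Let dpsi0_mvt x y : 0 <= x -> x <= y -> y < 1 -> exists c, x <= c <= y /\
  exists2 e, 0 < e & dpsi0 y - dpsi0 x = e * (ke - k * (1 - c)) * (y - x).
Proof.
move=> x0 xy y1.
have [||c [hc e]] := mvt dpsi0_deriv (x := x) (y := y).
- by apply/andP; split; slra.
- by apply/andP; split; slra.
have hc' : x <= c <= y.
  by case: hc => // /andP[? ?]; apply/andP; split; slra.
exists c; split => //; exists (4 / (1 - c ^+ 2) ^+ 2).
  apply: divr_gt0; first slra.
  rewrite exprn_gt0// sq_gt0//; move: hc' => /andP[? ?]; apply/andP; split; slra.
by rewrite e; ring.
Qed.

(** Otherwise [dpsi0] would decrease on [0, A], from a negative value to 0. It follows that [dpsi0]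
    increases from A on, so that [vf - uf] is convex there. *)
Lemma A_region : k * (1 - A) <= ke.
Proof.
rewrite leNgt; apply/negP => h.
have [//||//|c [/andP[c1' c2'] [e e0]]] := @dpsi0_mvt 0 A; first slra.
rewrite dpsi0A => E.
have h1 : 0 < k * (1 - c) - ke by snra.
have h2 : 0 < e * (k * (1 - c) - ke) * A by apply: mulr_gt0 => //; apply: mulr_gt0.
have := dpsi00; slra.
Qed.

Let dpsi0_ndecr x y : A <= x -> x <= y -> y < 1 -> dpsi0 x <= dpsi0 y.
Proof.
move=> Ax xy y1.
have [||//|c [/andP[c1' c2'] [e e0 E]]] := @dpsi0_mvt x y; [slra|slra|].
have h1 : 0 <= ke - k * (1 - c) by have := A_region; snra.
have h2 : 0 <= e * (ke - k * (1 - c)) * (y - x).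
  by apply: mulr_ge0; [apply: mulr_ge0 => //; exact: ltW|slra].
slra.
Qed.

(** If k (1 - x) <= ke, then [dpsi0] increases from x to its zero at A; if not, it has decreased
    from 0 to x, starting from a negative value. *)
Let dpsi0_le0 x : 0 <= x -> x <= A -> dpsi0 x <= 0.
Proof.
move=> x0 xA; have [h|h] := leP (k * (1 - x)) ke.
  have [//|//|//|c [/andP[c1' c2'] [e e0 E]]] := @dpsi0_mvt x A.
  have h1 : 0 <= ke - k * (1 - c) by snra.
  have h2 : 0 <= e * (ke - k * (1 - c)) * (A - x).
    by apply: mulr_ge0; [apply: mulr_ge0 => //; exact: ltW|slra].
  by have := dpsi0A; slra.
have x1 : x < 1 by slra.
have [c [/andP[c1' c2'] [e e0 E]]] := @dpsi0_mvt 0 x (lexx _) x0 x1.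
have h1 : 0 <= k * (1 - c) - ke by snra.
have h2 : 0 <= e * (k * (1 - c) - ke) * x by apply: mulr_ge0 => //; apply: mulr_ge0 => //; exact: ltW.
by have := dpsi00; slra.
Qed.

Let psi0A : vf A - uf A = 0.
Proof. by rewrite /uf /Cu; slra. Qed.

Let psi0_tangent x y : A <= x -> x < 1 -> A <= y -> y < 1 ->
  vf x - uf x + dpsi0 x * (y - x) <= vf y - uf y.
Proof.
move=> Ax x1 Ay y1.
have [||c [hc e]] := mvt psi0_deriv (x := x) (y := y).
- by apply/andP; split; slra.
- by apply/andP; split; slra.
rewrite -lerBrDl e; case: hc => /andP[c1' c2'].
  apply: ler_wpM2r; [slra|apply: dpsi0_ndecr; slra].
apply: ler_wnM2r; [slra|apply: dpsi0_ndecr; slra].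
Qed.

Let ufN x : -1 < x < 1 -> uf (- x) = uf x.
Proof. by move=> hx; rewrite /uf LLN//; ring. Qed.

Lemma uf_le_vf x : 0 <= x -> x <= A -> uf x <= vf x.
Proof.
move=> x0 xA.
have [||c [hc e]] := mvt psi0_deriv (x := x) (y := A).
- by apply/andP; split; slra.
- by [].
have {}hc : x <= c <= A by case: hc => // /andP[? ?]; apply/andP; split; slra.
move: hc => /andP[c1' c2'].
have : dpsi0 c <= 0 by apply: dpsi0_le0; slra.
have := psi0A => h1 h2.
have : dpsi0 c * (A - x) <= 0 by apply: mulr_le0_ge0; slra.
slra.
Qed.

Lemma Uf_le_Vf x : -1 < x < 1 -> Uf x <= Vf x.
Proof.
move=> hx; have /andP[x1 x2] := hx; apply: le_trans (Vf_abs hx).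
have hBx : - B <= `|x| by apply: le_trans (normr_ge0 x); slra.
rewrite /Uf /Vf hBx.
case: ifP => // xA; apply: le_trans (uf_le_vf (normr_ge0 x) xA).
by have [x0|x0] := leP 0 x; [rewrite ger0_norm|rewrite ltr0_norm// ufN].
Qed.

Lemma Uf_N x : -1 < x < 1 -> Uf (- x) = Uf x.
Proof. by move=> hx; rewrite /Uf normrN ufN. Qed.

(** The derivative of the convex part [Uf - uf], odd because that part is even. *)
Definition Uslope x : R := if `|x| <= A then 0 else Num.sg x * dpsi0 `|x|.

Lemma Uf_tangent x y : -1 < x < 1 -> -1 < y < 1 ->
  uf y - uf x + Uslope x * (y - x) <= Uf y - Uf x.
Proof.
wlog x0 : x y / 0 <= x.
  move=> H hx hy; have [x0|x0] := leP 0 x; first exact: H.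
  have hx' : -1 < - x < 1 by apply/andP; move: hx => /andP[? ?]; split; slra.
  have hy' : -1 < - y < 1 by apply/andP; move: hy => /andP[? ?]; split; slra.
  have := H (- x) (- y); rewrite !Uf_N// !ufN// => /(_ _ hx' hy') h.
  have {}h : uf y - uf x + Uslope (- x) * (- y - - x) <= Uf y - Uf x by apply: h; slra.
  suff -> : Uslope x * (y - x) = Uslope (- x) * (- y - - x) by [].
  by rewrite /Uslope normrN; case: ifP => _; rewrite ?mul0r// sgrN; ring.
move=> hx hy; have /andP[x1 x2] := hx; have /andP[y1 y2] := hy.
have ufB z : -1 < z < 1 -> Uf z = uf z + (if `|z| <= A then 0 else vf `|z| - uf `|z|).
  move=> hz; rewrite /Uf; case: ifP => _; first by rewrite addr0.
  by have [?|?] := leP 0 z; [rewrite ger0_norm|rewrite ltr0_norm// ufN]; slra.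
rewrite !ufB// /Uslope ger0_norm//.
have psi0_ge0 z : A <= z -> z < 1 -> 0 <= vf z - uf z.
  move=> Az z1; have := @psi0_tangent A z (lexx A) A1 Az z1.
  by rewrite psi0A dpsi0A mul0r addr0.
have ny : `|y| < 1 by rewrite ltr_norml.
have yy : 0 <= (if `|y| <= A then 0 else vf `|y| - uf `|y|).
  by case: (leP `|y| A) => // yA; apply: psi0_ge0 => //; exact: ltW.
case: (leP x A) => xA.
  rewrite mul0r !addr0; move: yy; move: (if _ then _ else _) => t yy; slra.
have x0' : 0 < x by slra.
rewrite gtr0_sg// mul1r.
suff : vf x - uf x + dpsi0 x * (y - x) <= (if `|y| <= A then 0 else vf `|y| - uf `|y|).
  by move: (if `|y| <= A then _ else _) => t ?; slra.
have [Ay|Ay] := leP A y.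
  have -> : (if `|y| <= A then 0 else vf `|y| - uf `|y|) = vf y - uf y.
    rewrite ger0_norm; last slra.
    by case: (leP y A) => // yA; rewrite (_ : y = A) ?psi0A//; slra.
  by apply: psi0_tangent; slra.
(* Here y < A: the tangent at x is at most 0 at A and has nonnegative slope, so it is at most 0 at y
   too. *)
apply: le_trans yy.
have : vf x - uf x + dpsi0 x * (A - x) <= 0 by rewrite -psi0A; apply: psi0_tangent; slra.
have : 0 <= dpsi0 x by rewrite -dpsi0A; apply: dpsi0_ndecr; slra.
snra.
Qed.

End Values.

(** * Measurability, bounds and truncations of the value functions *)

Section ValueBounds.
Context {R : realType}.
Variables (k ke c2 B A : R).
Hypothesis ok : params_ok k ke c2 B A.
Implicit Types x y : R.

Local Notation vf := (vf k B).
Local Notation uf := (uf k ke B A).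
Local Notation Vf := (Vf k c2 B).
Local Notation Uf := (Uf k ke B A).
Local Notation Cu := (Cu k ke B A).
Local Notation aa := (aa k B).

Ltac use_params := have := k_gt0 ok; have := ke_gt0 ok; have := c2_gt0 ok; have := B_gt0 ok;
  have := B_lt1 ok; have := A_gt0 ok; have := A_lt1 ok; move=> ? ? ? ? ? ? ?.
Ltac slra := use_params; lra.
Ltac snra := use_params; nra.

(** Total inversion is not continuous at 0, so it is pieced together from exp (- ln x) on each
    side. *)
Lemma measurable_invr : measurable_fun setT (fun x : R => x^-1).
Proof.
have -> : (fun x : R => x^-1) = (fun x : R => if 0 < x then expR (- ln x) else
    if x < 0 then - expR (- ln (- x)) else 0).
  apply/funext => x; case: ltP => [x0|x0]; first by rewrite expRN lnK.
  case: ltP => [x0'|x0']; first by rewrite expRN lnK ?invrN ?opprK// posrE oppr_gt0.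
  by rewrite (_ : x = 0) ?invr0//; apply/eqP; rewrite eq_le x0.
apply: measurable_fun_ifT; first by apply: measurable_fun_ltr.
  apply: measurableT_comp => //; apply: measurableT_comp => //; exact: measurable_ln.
apply: measurable_fun_ifT; [by apply: measurable_fun_ltr| |by []].
apply: measurableT_comp => //; apply: measurableT_comp => //; apply: measurableT_comp => //.
by apply: measurableT_comp; [exact: measurable_ln|].
Qed.

Lemma measurable_LL : measurable_fun setT (@LL R).
Proof.
apply: (measurableT_comp (@measurable_ln R)); apply: measurable_funM.
  exact: measurable_funB.
by apply: (measurableT_comp measurable_invr); exact: measurable_funD.
Qed.

Lemma measurable_vf : measurable_fun setT vf.
Proof.
apply: measurable_funM; first exact: measurable_funB.
by apply: measurable_funB => //; apply: measurable_funM => //; exact: measurable_LL.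
Qed.

Lemma measurable_uf : measurable_fun setT uf.
Proof.
apply: measurable_funD => //; apply: measurable_funM; last exact: measurable_LL.
exact: measurable_funM.
Qed.

Lemma measurable_Vf : measurable_fun setT Vf.
Proof.
apply: measurable_fun_ifT; first exact: measurable_fun_ler.
  exact: measurable_vf.
by apply: measurable_funD => //; apply: (measurableT_comp measurable_vf).
Qed.

Lemma measurable_Uf : measurable_fun setT Uf.
Proof.
apply: measurable_fun_ifT; first exact: measurable_fun_ler.
  exact: measurable_uf.
by apply: (measurableT_comp measurable_vf).
Qed.

Lemma measurable_Vslope : measurable_fun setT (Vslope k B).
Proof.
apply: measurable_fun_ifT => //; first exact: measurable_fun_ler.
apply: measurable_funB => //; apply: measurable_funM => //.
by apply: (measurableT_comp measurable_invr); apply: measurable_funB => //.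
Qed.

Lemma measurable_Uslope : measurable_fun setT (Uslope k ke B A).
Proof.
have msg : measurable_fun setT (fun x : R => Num.sg x).
  have -> : (fun x : R => Num.sg x) = (fun x => if 0 < x then 1 else if x < 0 then -1 else 0).
    apply/funext => x; case: ltP => x0; first by rewrite gtr0_sg.
    case: ltP => x0'; first by rewrite ltr0_sg.
    by rewrite (_ : x = 0) ?sgr0//; apply/eqP; rewrite eq_le x0.
  apply: measurable_fun_ifT => //; first exact: measurable_fun_ltr.
  by apply: measurable_fun_ifT => //; exact: measurable_fun_ltr.
have md : measurable_fun setT (dpsi0 k ke B).
  apply: measurable_funB => //; apply: measurable_funD; last first.
    apply: measurable_funM; first exact: measurable_funM.
    by apply: (measurableT_comp measurable_invr); apply: measurable_funB.
  apply: measurable_funD; first by apply: measurable_funM => //; exact: measurable_LL.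
  apply: measurable_funM => //; apply: (measurableT_comp measurable_invr).
  exact: measurable_funD.
apply: measurable_fun_ifT => //; first exact: measurable_fun_ler.
by apply: measurable_funM => //; apply: (measurableT_comp md).
Qed.

Let aa0 : 0 < aa.
Proof.
apply: divr_gt0; first by slra.
by apply: sq_gt0; apply/andP; split; slra.
Qed.

Let bb : R := LL (- B).

Let bb0 : 0 < bb.
Proof.
rewrite /bb /LL opprK ln_gt0// ltr_pdivlMr; first by slra.
by slra.
Qed.

Lemma LLE x : -1 < x < 1 -> expR (LL x) = (1 - x) / (1 + x).
Proof. by move=> hx; rewrite /LL lnK// posrE; exact: LL_arg_gt0. Qed.

Let onemx x : -1 < x < 1 -> 1 - x <= 2 * expR (LL x / 2) ^+ 2.
Proof.
move=> hx; rewrite -expRM_natl (_ : 2%:R * (LL x / 2) = LL x); last by field.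
rewrite LLE//.
have /andP[x1 x2] := hx.
by rewrite mulrA ler_pdivlMr; [nra|lra].
Qed.

(** 1 - x is at most 2 exp (LL x), and half of this exponential absorbs the factor - k LL x, which
    is unbounded as x tends to 1. *)
Let vf_exp x : - B <= x -> x < 1 -> vf x <= (2 * aa * expR (bb / 2) + 4 * k) * expR (LL x / 2).
Proof.
move=> xB x1; have xm1 : -1 < x by slra.
have hx : -1 < x < 1 by apply/andP.
set e := expR (LL x / 2); have e0 : 0 < e by exact: expR_gt0.
have eb : e <= expR (bb / 2).
  by rewrite ler_expR ler_pM2r// /bb; apply: LL_decr => //; slra.
have h1 : - LL x <= 2 / e.
  have := expR_ge1Dx (- (LL x / 2)); rewrite expRN -/e; lra.
have h2 : aa - k * LL x <= aa + k * (2 / e).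
  rewrite lerD2l -mulrN ler_pM2l//; by slra.
have h3 := onemx hx; rewrite -/e in h3.
have h4 : (1 - x) * (aa - k * LL x) <= (1 - x) * (aa + k * (2 / e)).
  by rewrite ler_pM2l//; lra.
apply: le_trans h4 _.
have h5 : 0 <= aa + k * (2 / e).
  apply: addr_ge0; first exact: ltW.
  by apply: mulr_ge0; [slra|rewrite divr_ge0// ltW].
apply: le_trans (_ : 2 * e ^+ 2 * (aa + k * (2 / e)) <= _); first exact: ler_wpM2r.
have -> : 2 * e ^+ 2 * (aa + k * (2 / e)) = (2 * aa * e + 4 * k) * e.
  by field; rewrite gt_eqF.
rewrite ler_pM2r// lerD2r ler_pM2l//; by have := aa0; lra.
Qed.

Let K1 : R := 2 * aa * expR (bb / 2) + 4 * k.
Let K10 : 0 < K1.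
Proof.
apply: addr_gt0; last by slra.
by rewrite mulr_gt0 ?expR_gt0// mulr_gt0.
Qed.

(** Makes the terminal term of the lower bound small. Below -B the exponential is at least 1, which
    absorbs both c2 and the value at - x. *)
Lemma Vf_exp : exists2 K, 0 <= K & forall x, -1 < x < 1 -> Vf x <= K * expR (LL x / 2).
Proof.
exists (K1 + c2); first by have := K10; slra.
move=> x hx; have /andP[x1 x2] := hx; rewrite !VfE.
have e0 := expR_gt0 (LL x / 2).
have cc := mulr_gt0 (c2_gt0 ok) e0.
case: ifPn => [xB|].
  by apply: le_trans (vf_exp xB x2) _; rewrite -/K1; lra.
rewrite -ltNge => xB.
have e1 : 1 <= expR (LL x / 2).
  rewrite -expR0 ler_expR divr_ge0//.
  apply: le_trans (ltW bb0) _; rewrite /bb; apply: LL_decr => //; slra.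
have h : vf (- x) <= K1 * expR (LL (- x) / 2) by apply: vf_exp; slra.
have h1 : expR (LL (- x) / 2) <= expR (LL x / 2).
  rewrite LLN// mulNr expRN; apply: (le_trans _ e1).
  by rewrite invf_le1; [exact: e1|exact: expR_gt0].
have h2 := ler_wpM2l (ltW K10) h1.
have h3 := ler_wpM2l (ltW (c2_gt0 ok)) e1.
lra.
Qed.

Lemma Vf_bounded : exists2 K, 0 <= K & forall x, -1 < x < 1 -> Vf x <= K.
Proof.
have eb : 1 <= expR (bb / 2) by rewrite -expR0 ler_expR divr_ge0// ltW.
exists (K1 * expR (bb / 2) + c2).
  by apply: addr_ge0; [rewrite mulr_ge0// ltW|slra].
move=> x hx; have /andP[x1 x2] := hx; rewrite !VfE.
have key y : - B <= y -> y < 1 -> vf y <= K1 * expR (bb / 2).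
  move=> yB y1; apply: le_trans (vf_exp yB y1) _; apply: ler_wpM2l; first exact: ltW.
  by rewrite ler_expR ler_pM2r// /bb; apply: LL_decr => //; slra.
case: ifPn => [xB|]; first by have := key x xB x2; slra.
rewrite -ltNge => xB; rewrite lerD2r; apply: key; slra.
Qed.

(** On [0, A] one has x LL x >= A LL A, hence uf x >= uf A = vf A > 0. *)
Lemma Uf_ge0 x : -1 < x < 1 -> 0 <= Uf x.
Proof.
wlog x0 : x / 0 <= x.
  move=> H hx; have [x0|x0] := leP 0 x; first exact: H.
  rewrite -Uf_N//; apply: H; first lra.
  by move: hx => /andP[? ?]; apply/andP; split; lra.
move=> hx; have /andP[x1 x2] := hx; rewrite !UfE ger0_norm//.
case: ifPn => [xA|_]; last by apply/ltW/(vf_gt0 ok) => //; slra.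
have vA : 0 < vf A by apply: (vf_gt0 ok); slra.
have LA : LL A <= LL x by apply: LL_decr => //; slra.
have L0 : LL A <= 0 by rewrite -(@LL0 R); apply: LL_decr; slra.
rewrite !ufE !CuE.
have h1 : x * LL A <= x * LL x by apply: ler_wpM2l.
have h2 : A * LL A <= x * LL A by apply: ler_wnM2r.
have h3 : ke * (A * LL A) <= ke * (x * LL x).
  by rewrite ler_pM2l; [apply: le_trans h1|slra].
rewrite !mulrA in h3.
lra.
Qed.

(* vf and uf cut off outside a neighbourhood of their continuation regions. The truncations are
   bounded and, starting inside the region, one step costs an error of order four in the
   log-odds increment, hence O(h^2) in mean over a time step h. *)
Definition vt x : R := if LL x < bb + 1 then vf x else 0.
Definition ut x : R := if `|LL x| < LL (- A) + 1 then uf x else 0.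

Lemma vtE x : vt x = if LL x < LL (- B) + 1 then vf x else 0. Proof. by []. Qed.
Lemma utE x : ut x = if `|LL x| < LL (- A) + 1 then uf x else 0. Proof. by []. Qed.

Lemma measurable_vt : measurable_fun setT vt.
Proof.
apply: measurable_fun_ifT => //; last exact: measurable_vf.
by apply: measurable_fun_ltr => //; exact: measurable_LL.
Qed.

Lemma measurable_ut : measurable_fun setT ut.
Proof.
apply: measurable_fun_ifT => //; last exact: measurable_uf.
apply: measurable_fun_ltr => //.
by apply: measurableT_comp => //; exact: measurable_LL.
Qed.

Lemma vt_bounded : exists K, forall x, -1 < x < 1 -> `|vt x| <= K.
Proof.
exists (K1 * expR (bb / 2) + 2 * k * (bb + 1) + K1 * expR ((bb + 1) / 2)).
have p1 : 0 < K1 * expR (bb / 2) by rewrite mulr_gt0 ?expR_gt0.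
have p2 : 0 < K1 * expR ((bb + 1) / 2) by rewrite mulr_gt0 ?expR_gt0.
have p3 : 0 < 2 * k * (bb + 1) by apply: mulr_gt0; [slra|have := bb0; lra].
move=> x hx; have /andP[x1 x2] := hx; rewrite /vt; case: ifPn => [h|_]; last by rewrite normr0; lra.
rewrite ler_norml; apply/andP; split.
  have : 0 <= (1 - x) * aa by apply: mulr_ge0; [lra|exact: ltW].
  have : (1 - x) * k * LL x <= 2 * k * (bb + 1).
    have [L0|L0] := leP (LL x) 0.
      apply: le_trans (ltW p3); apply: mulr_ge0_le0 => //; apply: mulr_ge0; [lra|slra].
    apply: ler_pM; [apply: mulr_ge0; [lra|slra]|exact: ltW| |exact: ltW].
    rewrite ler_pM2r; [lra|slra].
  rewrite !vfE; lra.
(* Upper bound: [vf_exp] applies from -B on. Below -B, LL x is positive, so vf x <= 2 aa, which the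
   first constant covers. *)
have [Lb|Lb] := leP (- B) x.
  apply: le_trans (vf_exp Lb x2) _; rewrite -/K1.
  suff : K1 * expR (LL x / 2) <= K1 * expR ((bb + 1) / 2) by lra.
  by rewrite ler_pM2l// ler_expR ler_pM2r//; exact: ltW.
have : bb <= LL x by rewrite /bb; apply: LL_decr => //; slra.
have := bb0 => b0 bx.
have : vf x <= (1 - x) * aa.
  rewrite !vfE ler_pM2l; last lra.
  have : 0 <= k * LL x by apply: mulr_ge0; [slra|lra].
  lra.
have : (1 - x) * aa <= 2 * aa by rewrite ler_pM2r; [lra|exact: aa0].
have : 2 * aa * 1 <= K1 * expR (bb / 2).
  have e1 : 1 <= expR (bb / 2) by rewrite -expR0 ler_expR divr_ge0// ltW.
  apply: ler_pM => //; first by have := aa0; lra.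
  rewrite /K1; have := ler_pM2l (mulr_gt0 (ltr0n _ 2) aa0) 1 (expR (bb / 2)).
  rewrite e1 mulr1 => H; slra.
lra.
Qed.

(** If y is truncated while x >= -B, the increment D of [LL] is at least 1. Then - vf y <= 2 k LL y
    and LL y <= bb + D <= (bb + 1) D^4, whence the constant. *)
Lemma vt_err : exists2 K, 0 <= K & forall x y, -1 < x < 1 -> -1 < y < 1 -> - B <= x ->
  vt y - vf y <= K * (LL y - LL x) ^+ 4.
Proof.
have K0 : 0 <= 2 * k * (bb + 1) by apply: mulr_ge0; [slra|have := bb0; lra].
exists (2 * k * (bb + 1)) => // x y /andP[x1 x2] /andP[y1 y2] xB; rewrite /vt; case: ifPn => [_|].
  by rewrite subrr mulr_ge0// exprn_even_ge0.
rewrite -leNgt sub0r => yb.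
have xb : LL x <= bb by rewrite /bb; apply: LL_decr => //; slra.
set D := LL y - LL x.
have D1 : 1 <= D by rewrite /D; lra.
have D4 : D <= D ^+ 4 by rewrite -[leLHS]expr1; apply: ler_weXn2l.
have D41 : 1 <= D ^+ 4 by lra.
have h1 : - vf y <= 2 * k * LL y.
  have h3 : (1 - y) * (k * LL y) <= 2 * (k * LL y).
    rewrite ler_pM2r; [lra|apply: mulr_gt0; [slra|have := bb0; lra]].
  have : 0 <= (1 - y) * aa by apply: mulr_ge0; [lra|exact: ltW].
  rewrite !vfE; lra.
apply: le_trans h1 _; rewrite -[leRHS]mulrA ler_pM2l; last by slra.
have e : LL y = D + LL x by rewrite /D; lra.
have := bb0; rewrite e => b0.
have : bb * 1 <= bb * D ^+ 4 by rewrite ler_pM2l.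
lra.
Qed.

Let lA0 : 0 < LL (- A).
Proof.
rewrite /LL opprK ln_gt0// ltr_pdivlMr; first by slra.
by slra.
Qed.

Let LL_absA x : `|x| <= A -> `|LL x| <= LL (- A).
Proof.
rewrite ler_norml => /andP[xA Ax]; rewrite ler_norml; apply/andP; split.
  rewrite LLN ?opprK; first by apply: LL_decr; slra.
  by apply/andP; split; slra.
by apply: LL_decr; slra.
Qed.

Let uf_abs x : -1 < x < 1 -> `|uf x| <= `|Cu| + ke * `|LL x|.
Proof.
move=> /andP[x1 x2]; rewrite !ufE; apply: (le_trans (ler_normD _ _)).
rewrite lerD2l !normrM (gtr0_norm (ke_gt0 ok)) ler_wpM2r// ler_piMr//; first by slra.
by rewrite ler_norml; apply/andP; split; lra.
Qed.

Lemma ut_bounded : exists K, forall x, -1 < x < 1 -> `|ut x| <= K.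
Proof.
have p : 0 < ke * (LL (- A) + 1) by apply: mulr_gt0; [slra|have := lA0; lra].
exists (`|Cu| + ke * (LL (- A) + 1)) => x hx; rewrite /ut; case: ifPn => h; last first.
  by rewrite normr0; apply: addr_ge0 => //; exact: ltW.
apply: le_trans (uf_abs hx) _; rewrite lerD2l ler_pM2l; last by slra.
exact: ltW.
Qed.

(** A truncated y has |LL y| at least 1 above the level of A, so the increment is at least 1 in
    modulus and its fourth power absorbs |uf y|, of linear growth in |LL y|. *)
Lemma ut_err : exists2 K, 0 <= K & forall x y, -1 < x < 1 -> -1 < y < 1 -> `|x| <= A ->
  ut y - uf y <= K * (LL y - LL x) ^+ 4.
Proof.
have p : 0 < ke * (LL (- A) + 1) by apply: mulr_gt0; [slra|have := lA0; lra].
have K0 : 0 <= `|Cu| + ke * (LL (- A) + 1) by apply: addr_ge0 => //; exact: ltW.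
exists (`|Cu| + ke * (LL (- A) + 1)) => // x y hx hy xA; rewrite /ut; case: ifPn => [_|].
  by rewrite subrr mulr_ge0// exprn_even_ge0.
rewrite -leNgt sub0r => yb.
have xb := LL_absA xA.
set D := LL y - LL x.
have nD : `|LL y| <= `|D| + LL (- A).
  rewrite (_ : LL y = D + LL x); last by rewrite /D; lra.
  by apply: le_trans (ler_normD _ _) _; rewrite lerD2l.
have D1 : 1 <= `|D| by lra.
have D4 : `|D| <= D ^+ 4.
  rewrite -(ger0_norm (_ : 0 <= D ^+ 4)); last by rewrite exprn_even_ge0.
  by rewrite normrX -[leLHS]expr1; apply: ler_weXn2l.
have D41 : 1 <= D ^+ 4 by lra.
apply: le_trans (_ : `|uf y| <= _); first by rewrite -normrN ler_norm.
apply: le_trans (uf_abs hy) _.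
have h1 : `|Cu| * 1 <= `|Cu| * D ^+ 4 by apply: ler_wpM2l.
have h2 : ke * `|LL y| <= ke * ((LL (- A) + 1) * D ^+ 4).
  rewrite ler_pM2l; last by slra.
  have : LL (- A) * 1 <= LL (- A) * D ^+ 4 by rewrite ler_pM2l.
  lra.
lra.
Qed.

Lemma vt_vf x : - B <= x -> x < 1 -> vt x = vf x.
Proof.
move=> xB x1; rewrite /vt ifT//; apply: le_lt_trans (_ : bb < _); last lra.
by rewrite /bb; apply: LL_decr => //; slra.
Qed.

Lemma ut_uf x : `|x| <= A -> ut x = uf x.
Proof. by move=> xA; rewrite /ut ifT//; apply: le_lt_trans (LL_absA xA) _; lra. Qed.

End ValueBounds.

(** * Expectations *)

Section Expectation.
Context {d : measure_display} {T : measurableType d} {R : realType}.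
Variable P : probability T R.
Implicit Types f g : T -> R.

Definition integ f := P.-integrable setT (EFin \o f).
Definition Ex f : R := Rintegral P setT f.

Lemma integ_meas f : integ f -> measurable_fun setT f.
Proof. by move=> /measurable_int /measurable_EFinP. Qed.

Lemma integ_le f g : measurable_fun setT f -> (forall w, `|f w| <= g w) ->
  integ g -> integ f.
Proof.
move=> mf fg ig; apply: (le_integrable _ _ _ ig) => //.
  exact/measurable_EFinP.
by move=> w _ /=; rewrite lee_fin (le_trans (fg w))// ler_norm.
Qed.

Lemma integ_cst (c : R) : integ (cst c).
Proof. exact: finite_measure_integrable_cst. Qed.

Lemma integ_bounded (C : R) f : measurable_fun setT f -> (forall w, `|f w| <= C) ->
  integ f.
Proof. by move=> mf fC; apply: (integ_le mf fC); exact: integ_cst. Qed.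

Lemma integ_indic (F : set T) : measurable F -> integ \1_F.
Proof.
move=> mF; apply: (@integ_bounded 1); first exact: measurable_indic.
by move=> w; rewrite indicE; case: (_ \in _); rewrite ?normr1 ?normr0.
Qed.

Lemma integD f g : integ f -> integ g -> integ (fun w => f w + g w).
Proof. by move=> i1 i2; have := integrableD _ i1 i2; apply. Qed.

Lemma integB f g : integ f -> integ g -> integ (fun w => f w - g w).
Proof. by move=> i1 i2; have := integrableB _ i1 i2; apply. Qed.

Lemma integZ (c : R) f : integ f -> integ (fun w => c * f w).
Proof. by move=> i1; have := integrableZl _ c i1; apply. Qed.

Lemma integ_indicM f (F : set T) : measurable F -> integ f -> integ (fun w => \1_F w * f w).
Proof.
move=> mF i1; apply: (@integ_le _ (fun w => `|f w|)).
- apply: measurable_funM; first exact: measurable_indic.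
  exact: integ_meas.
- by move=> w; rewrite normrM indicE; case: (_ \in _);
    rewrite ?normr1 ?mul1r// normr0 mul0r.
- by apply: integrable_norm.
Qed.

Lemma integ_sum (I : Type) (s : seq I) (f : I -> T -> R) : (forall i, integ (f i)) ->
  integ (fun w => \sum_(i <- s) f i w).
Proof.
move=> fi; elim: s => [|i s ih].
  under [X in integ X]eq_fun do rewrite big_nil; exact: integ_cst.
under [X in integ X]eq_fun do rewrite big_cons; exact: integD.
Qed.

Lemma ExD f g : integ f -> integ g -> Ex (fun w => f w + g w) = Ex f + Ex g.
Proof. by move=> i1 i2; rewrite /Ex RintegralD. Qed.

Lemma ExB f g : integ f -> integ g -> Ex (fun w => f w - g w) = Ex f - Ex g.
Proof. by move=> i1 i2; rewrite /Ex RintegralB. Qed.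

Lemma ExZ (c : R) f : integ f -> Ex (fun w => c * f w) = c * Ex f.
Proof. by move=> i1; rewrite /Ex RintegralZl. Qed.

Lemma Ex_le f g : integ f -> integ g -> (forall w, f w <= g w) -> Ex f <= Ex g.
Proof. by move=> i1 i2 fg; apply: le_Rintegral. Qed.

Lemma Ex_ge0 f : (forall w, 0 <= f w) -> 0 <= Ex f.
Proof. by move=> f0; apply: Rintegral_ge0. Qed.

Lemma eq_Ex f g : (forall w, f w = g w) -> Ex f = Ex g.
Proof. by move=> fg; rewrite (_ : f = g)//; apply/funext. Qed.

Lemma Ex_cst (c : R) : Ex (cst c) = c.
Proof. by rewrite /Ex Rintegral_cst//= probability_setT/= mulr1. Qed.

Lemma Ex_indic (F : set T) : measurable F -> Ex \1_F = fine (P F).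
Proof. by move=> mF; rewrite /Ex /Rintegral integral_indic// setIT. Qed.

Lemma Ex_sum (I : Type) (s : seq I) (f : I -> T -> R) : (forall i, integ (f i)) ->
  Ex (fun w => \sum_(i <- s) f i w) = \sum_(i <- s) Ex (f i).
Proof.
move=> fi; elim: s => [|i s ih].
  by under eq_Ex do rewrite big_nil; rewrite Ex_cst big_nil.
under eq_Ex do rewrite big_cons; rewrite ExD ?big_cons ?ih//; exact: integ_sum.
Qed.

Lemma EFin_Ex f : integ f -> ((Ex f)%:E = \int[P]_w (f w)%:E)%E.
Proof. by move=> fi; rewrite /Ex /Rintegral fineK//; apply: integrable_fin_num. Qed.

Lemma Ex_cvg (f_ : nat -> T -> R) f g : (forall n, measurable_fun setT (f_ n)) ->
  integ g -> (forall n w, `|f_ n w| <= g w) ->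
  (forall w, f_ n w @[n --> \oo] --> f w) ->
  integ f /\ Ex (f_ n) @[n --> \oo] --> Ex f.
Proof.
move=> mf ig fg ff.
have mF : measurable_fun setT f.
  by apply: (@measurable_fun_cvg _ _ _ setT f_ f) => // w _; exact: ff.
have [|||||i1 _ i2] := @dominated_convergence _ _ _ P setT measurableT
   (fun n w => (f_ n w)%:E) (fun w => (f w)%:E) (fun w => (g w)%:E).
- by move=> n; apply/measurable_EFinP.
- exact/measurable_EFinP.
- by apply: aeW => w _; apply/fine_cvgP; split; [exact: nearW|exact: ff].
- exact: ig.
- by apply: aeW => w n _; rewrite lee_fin.
split=> //; have := i2; rewrite -(EFin_Ex i1) => /fine_cvgP[_] //.
Qed.

Section Transfer.
Variables (x1 x2 : T -> R).
Hypotheses (i1 : integ x1) (i2 : integ x2).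
Hypotheses (p1 : forall w, 0 <= x1 w) (p2 : forall w, 0 <= x2 w).
Variable Y : T -> R.
Hypothesis mY : measurable_fun setT Y.
Hypothesis YE : forall A : set R, measurable A ->
  Ex (fun w => \1_(Y @^-1` A) w * x1 w) = Ex (fun w => \1_(Y @^-1` A) w * x2 w).

Let mYA (A : set R) : measurable A -> measurable (Y @^-1` A).
Proof. by move=> mA; rewrite -[X in measurable X]setTI; apply: mY. Qed.

Import HBNNSimple.
(** Replaces the statement that [x1] and [x2] have the same conditional expectation given [Y]:
    agreement on the events of [Y] extends to [Y] itself through simple functions and monotone
    convergence. *)
Lemma transfer_ge0 : (forall w, 0 <= Y w) ->
  (\int[P]_w (Y w * x1 w)%:E = \int[P]_w (Y w * x2 w)%:E)%E.
Proof.
move=> Y0.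
have mf : measurable_fun (`[0%R, +oo[%classic : set R) (EFin : R -> \bar R).
  by apply: measurable_funTS; exact/measurable_EFinP.
have mD : measurable (`[0%R, +oo[%classic : set R) by [].
(* The identity of [0, +oo[ is approximated, not [Y]: the level sets of h n after Y are then
   preimages under [Y], where [YE] applies. *)
pose h := nnsfun_approx mD mf.
have hY w : h n (Y w) @[n --> \oo] --> Y w.
  have := @cvg_nnsfun_approx _ _ _ _ mD _ mf _ (Y w).
  have H1 x : (`[0%R, +oo[%classic : set R) x -> (0 <= x%:E)%E.
    by rewrite /= in_itv/= andbT lee_fin.
  have H2 : (`[0%R, +oo[%classic : set R) (Y w) by rewrite /= in_itv/= andbT.
  by move=> /(_ H1 H2) /fine_cvgP[_].
have hn w n m : (n <= m)%N -> h n (Y w) <= h m (Y w).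
  by move=> nm; have /lefP := nd_nnsfun_approx mD mf nm; apply.
have key n : (\int[P]_w (h n (Y w) * x1 w)%:E = \int[P]_w (h n (Y w) * x2 w)%:E)%E.
  have mH (x : R) : measurable (h n @^-1` [set x]).
    by rewrite -[X in measurable X]setTI; apply: measurable_funPT.
  have F (x : T -> R) : (forall w, (h n (Y w) * x w)%:E =
     (\sum_(i <- finmap.enum_fset (fset_set (range (h n))))
        (i * (\1_(Y @^-1` (h n @^-1` [set i])) w * x w))%:E)%E).
    move=> w; rewrite sumEFin; congr EFin.
    rewrite {1}fimfunE fsbig_finite//= mulr_suml.
    by apply: eq_bigr => i _; rewrite mulrA.
  have G (x : T -> R) : integ x -> (\int[P]_w (h n (Y w) * x w)%:E)%E =
     (\sum_(i <- finmap.enum_fset (fset_set (range (h n))))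
        i * (Ex (fun w => \1_(Y @^-1` (h n @^-1` [set i])) w * x w)))%:E.
    move=> ix.
    under eq_integral do rewrite F.
    rewrite integral_sum//=; last first.
      move=> i; apply: integZ; apply: integ_indicM => //; exact: mYA.
    rewrite -sumEFin; apply: eq_bigr => i _; rewrite -ExZ.
    - by rewrite EFin_Ex//; apply: integZ; apply: integ_indicM => //; exact: mYA.
    - by apply: integ_indicM => //; exact: mYA.
  rewrite !G//; congr EFin; apply: eq_bigr => i _; rewrite YE//.
have mx x : integ x -> forall n,
    measurable_fun setT (fun w => (h n (Y w) * x w)%:E).
  move=> ix n; apply/measurable_EFinP; apply: measurable_funM.
    exact: measurableT_comp.
  exact: integ_meas.
have G (x : T -> R) : integ x -> (forall w, 0 <= x w) ->
  (\int[P]_w (Y w * x w)%:E)%E = limn (fun n => \int[P]_w (h n (Y w) * x w)%:E)%E.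
  move=> ix x0.
  rewrite -monotone_convergence//.
  - apply: eq_integral => w _; apply/esym/cvg_lim => //.
    apply/fine_cvgP; split; first exact: nearW.
    by apply: cvgM; [exact: hY|exact: cvg_cst].
  - by move=> n; exact: mx.
  - by move=> n w _; rewrite lee_fin mulr_ge0.
  - by move=> w _ n m nm; rewrite lee_fin ler_wpM2r// hn.
by rewrite !G//; congr (limn _); apply/funext => n.
Qed.

End Transfer.

(** Positive and negative parts reduce it to [transfer_ge0]. Integrability against [x2] comes out as
    a conclusion, because the integrals of each part agree. *)
Lemma transfer (x1 x2 Y : T -> R) : integ x1 -> integ x2 ->
  (forall w, 0 <= x1 w) -> (forall w, 0 <= x2 w) -> measurable_fun setT Y ->
  (forall A : set R, measurable A ->
  Ex (fun w => \1_(Y @^-1` A) w * x1 w) = Ex (fun w => \1_(Y @^-1` A) w * x2 w)) ->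
  integ (fun w => Y w * x1 w) ->
  integ (fun w => Y w * x2 w) /\ Ex (fun w => Y w * x1 w) = Ex (fun w => Y w * x2 w).
Proof.
move=> i1 i2 p1 p2 mY YE iY.
have gen (u : R -> R) : measurable_fun setT u -> (forall y, 0 <= u y) ->
   (\int[P]_w (u (Y w) * x1 w)%:E = \int[P]_w (u (Y w) * x2 w)%:E)%E.
  move=> mu u0; apply: (@transfer_ge0 x1 x2 i1 i2 p1 p2 (u \o Y)) => //.
    exact: measurableT_comp.
  move=> A mA; have := YE (u @^-1` A); rewrite comp_preimage; apply.
  by rewrite -[X in measurable X]setTI; apply: mu.
  by move=> w; exact: u0.
have mpos : measurable_fun setT (fun y : R => Num.max y 0).
  exact: measurable_funrpos.
have mneg : measurable_fun setT (fun y : R => Num.max (- y) 0).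
  exact: measurable_funrneg.
have ia : forall u : R -> R, measurable_fun setT u -> (forall y, `|u y| <= `|y|) ->
   integ (fun w => u (Y w) * x1 w).
  move=> u mu uy; apply: (@integ_le _ (fun w => `|Y w * x1 w|)).
  - apply: measurable_funM; [exact: measurableT_comp|exact: integ_meas].
  - by move=> w; rewrite !normrM ler_wpM2r.
  - exact: integrable_norm.
have ge0m a b : 0 <= Num.max a b -> `|Num.max a b| = Num.max a b :> R.
  by move=> ?; rewrite ger0_norm.
have pos0 (y : R) : 0 <= Num.max y 0 by rewrite le_max lexx orbT.
have bnd (y : R) : `|Num.max y 0| <= `|y|.
  by rewrite ge0m// ge_max ler_norm normr_ge0.
have bnd' (y : R) : `|Num.max (-y) 0| <= `|y|.
  by rewrite -[leRHS]normrN.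
have ib : forall u : R -> R, measurable_fun setT u -> (forall y, 0 <= u y) ->
   (forall y, `|u y| <= `|y|) ->
   integ (fun w => u (Y w) * x2 w) /\ Ex (fun w => u (Y w) * x1 w) = Ex (fun w => u (Y w) * x2 w).
  move=> u mu u0 uy; split; last by rewrite /Ex /Rintegral gen.
  apply/integrableP; split.
    apply/measurable_EFinP/measurable_funM; [exact: measurableT_comp|exact: integ_meas].
  have /integrableP[_] := ia u mu uy.
  have H (x : T -> R) : (forall w, 0 <= x w) -> (\int[P]_w `|(u (Y w) * x w)%:E| =
     \int[P]_w (u (Y w) * x w)%:E)%E.
    by move=> x0; apply: eq_integral => w _; rewrite gee0_abs// lee_fin mulr_ge0.
  by rewrite !H// gen.
have [j1 e1] := ib _ mpos pos0 bnd.
have [j2 e2] := ib _ mneg (fun y => pos0 (- y)) bnd'.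
have dec (x : T -> R) : (fun w => Y w * x w) =
   (fun w => Num.max (Y w) 0 * x w - Num.max (- Y w) 0 * x w).
  apply/funext => w; rewrite -mulrBl; congr (_ * _).
  have [y0|y0] := leP 0 (Y w).
    by rewrite max_r ?oppr_le0// subr0.
  by rewrite max_l ?oppr_ge0 ?ltW// add0r opprK.
split; first by rewrite dec; exact: integB.
rewrite !dec ExB; [|exact: (ia _ mpos bnd)|exact: (ia _ mneg (fun y => bnd' y))].
by rewrite [RHS]ExB// e1 e2.
Qed.

End Expectation.

(** * Gaussian integrals *)

Section Density.
Local Open Scope ereal_scope.
Context {d : measure_display} {T : measurableType d} {R : realType}.
Variables (m mu : {measure set T -> \bar R}) (g : T -> R).
Hypotheses (mg : measurable_fun setT g) (g0 : forall x, (0 <= g x)%R).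
Hypothesis mE : forall A, measurable A -> m A = \int[mu]_(x in A) (g x)%:E.
Import HBNNSimple.

Lemma integral_density (f : T -> R) : measurable_fun setT f -> (forall x, (0 <= f x)%R) ->
  \int[m]_x (f x)%:E = \int[mu]_x (f x * g x)%:E.
Proof.
move=> mf f0.
have mF : measurable_fun setT (EFin \o f) by exact/measurable_EFinP.
pose h := nnsfun_approx measurableT mF.
have hf x : h n x @[n --> \oo] --> f x.
  have := @cvg_nnsfun_approx _ _ _ _ measurableT _ mF.
  have H1 y : [set: T] y -> 0 <= (f y)%:E by rewrite lee_fin.
  by move=> /(_ H1 x I) /fine_cvgP[_].
have hn x n k : (n <= k)%N -> (h n x <= h k x)%R.
  by move=> nk; have /lefP := nd_nnsfun_approx measurableT mF nk; apply.
have lim (mu' : {measure set T -> \bar R}) (x : T -> R) : measurable_fun setT x ->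
  (forall w, (0 <= x w)%R) ->
  \int[mu']_w (f w * x w)%:E = limn (fun n => \int[mu']_w (h n w * x w)%:E).
  move=> mx x0; rewrite -monotone_convergence//.
  - apply: eq_integral => w _; apply/esym/cvg_lim => //.
    apply/fine_cvgP; split; first exact: nearW.
    by apply: cvgM; [exact: hf|exact: cvg_cst].
  - by move=> n; apply/measurable_EFinP/measurable_funM.
  - by move=> n w _; rewrite lee_fin mulr_ge0.
  - by move=> w _ n k nk; rewrite lee_fin ler_wpM2r// hn.
have -> : \int[m]_x (f x)%:E = \int[m]_x (f x * 1)%:E.
  by apply: eq_integral => x _; rewrite mulr1.
rewrite (lim m (cst 1%R))// (lim mu g)//; congr (limn _); apply/funext => n.
have mH (x : R) : measurable (h n @^-1` [set x]).
  by rewrite -[X in measurable X]setTI; apply: measurable_funPT.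
have F (y : T -> R) x : (h n x * y x)%:E =
   \sum_(i <- finmap.enum_fset (fset_set (range (h n)))) (i * \1_(h n @^-1` [set i]) x * y x)%:E.
  rewrite sumEFin; congr EFin.
  by rewrite {1}fimfunE fsbig_finite//= mulr_suml.
have G (m' : {measure set T -> \bar R}) (y : T -> R) : measurable_fun setT y -> (forall x, (0 <= y x)%R) ->
  \int[m']_x (h n x * y x)%:E = \sum_(i <- finmap.enum_fset (fset_set (range (h n))))
     \int[m']_x (i * \1_(h n @^-1` [set i]) x * y x)%:E.
  move=> my y0; under eq_integral do rewrite F.
  rewrite ge0_integral_sum//.
  - move=> z; apply/measurable_EFinP/measurable_funM => //.
    by apply: measurable_funM => //; exact: measurable_indic.
  - move=> z x _; rewrite lee_fin mulr_ge0//.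
    by have := nnfun_muleindic_ge0 (h n) z x; rewrite -EFinM lee_fin.
rewrite (G m (cst 1%R))// (G mu g)//.
apply: eq_bigr => r _.
(* A negative level r is never attained, so both terms vanish; pulling r out of the integral
   requires r >= 0. *)
have [r0|r0] := ltP r 0%R.
  have -> : h n @^-1` [set r] = set0 by exact: preimage_nnfun0.
  under eq_integral do rewrite indic0 mulr0 mul0r.
  under [RHS]eq_integral do rewrite indic0 mulr0 mul0r.
  by rewrite !integral0.
under eq_integral do rewrite mulr1 EFinM.
rewrite ge0_integralZl//; last by apply/measurable_EFinP; exact: measurable_indic.
under [RHS]eq_integral do rewrite -mulrA EFinM.
rewrite [RHS]ge0_integralZl//; last 2 first.
- by apply/measurable_EFinP/measurable_funM => //; exact: measurable_indic.
- by move=> x _; rewrite lee_fin mulr_ge0.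
congr (_ * _); rewrite integral_indic// setIT mE// integral_mkcond.
by apply: eq_integral => x _; rewrite patchE indicE; case: ifP; rewrite ?mul1r ?mul0r.
Qed.
End Density.

Section Gauss.
Context {R : realType}.
Notation leb := (@lebesgue_measure R).

Lemma lebesgue_measure_shift (c : R) (A : set R) : measurable A ->
  leb A = pushforward leb ((fun x => x + c) : _ -> measurableTypeR R) A.
Proof.
have mc : measurable_fun setT ((fun x : R => x + c) : measurableTypeR R -> measurableTypeR R).
  by apply: measurable_funD => //.
pose Sh : measurableTypeR R -> measurableTypeR R := fun x => x + c.
move=> mA; apply: (@lebesgue_measure_unique R (pushforward leb Sh)) => //= _ [[a b]] _ <-.
rewrite /pushforward (_ : Sh @^-1` `]a, b] = `]a - c, b - c]%classic); last first.
  by apply/seteqP; split => x /=; rewrite !in_itv/= /Sh => /andP[? ?]; apply/andP; split; lra.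
rewrite /= !lebesgue_measure_itv/= !lte_fin ltrD2r.
by case: ifP => // _; rewrite -!EFinD; congr EFin; lra.
Qed.

Lemma integral_shift (c : R) (f : R -> R) : measurable_fun setT f -> (forall x, 0 <= f x) ->
  (\int[leb]_x (f x)%:E = \int[leb]_x (f (x + c))%:E)%E.
Proof.
move=> mf f0; pose Sh : measurableTypeR R -> measurableTypeR R := fun x => x + c.
have mc : measurable_fun setT Sh by apply: measurable_funD => //.
rewrite (@eq_measure_integral _ _ _ _ (pushforward leb Sh)); last first.
  by move=> A mA _; exact: lebesgue_measure_shift.
rewrite (ge0_integral_pushforward mc)//.
- exact/measurable_EFinP.
- by move=> y _; rewrite lee_fin.
Qed.

(** Completing the square in the exponent. *)
Lemma normal_pdf_tilt (s c x : R) : s != 0 ->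
  expR (c * x) * normal_pdf 0 s x = expR (c ^+ 2 * s ^+ 2 / 2) * normal_pdf 0 s (x - c * s ^+ 2).
Proof.
move=> s0; rewrite !normal_pdfE// mulrCA [RHS]mulrCA; congr (_ * _).
rewrite /normal_fun -!expRD; congr expR.
field.
by rewrite s0.
Qed.

End Gauss.

(** * Exponential and polynomial moments of a Gaussian increment *)

Section GaussRV.
Context {d : measure_display} {T : measurableType d} {R : realType}.
Variable P : probability T R.
Variables (D : T -> R) (h : R).
Hypotheses (h0 : 0 < h) (mD : measurable_fun setT D).
Hypothesis law : forall A : set R, measurable A ->
  P (D @^-1` A) = normal_prob 0 (Num.sqrt h) A.
Notation leb := (@lebesgue_measure R).

Let s0 : Num.sqrt h != 0. Proof. by rewrite gt_eqF// sqrtr_gt0. Qed.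

Lemma gauss_integral (f : R -> R) : measurable_fun setT f -> (forall x, 0 <= f x) ->
  (\int[P]_w (f (D w))%:E = \int[leb]_x (f x * normal_pdf 0 (Num.sqrt h) x)%:E)%E.
Proof.
move=> mf f0.
have H A : measurable A -> (pushforward P D A =
    \int[leb]_(x in A) (normal_pdf 0 (Num.sqrt h) x)%:E)%E.
  by move=> mA; rewrite /pushforward/= law.
have := @integral_density _ (measurableTypeR R) R
  (@measure_function_pushforward__canonical__measure_function_Measure _ _ _ (measurableTypeR R) R P D mD) leb
  _ (@measurable_normal_pdf R 0 (Num.sqrt h)) _ H f mf f0.
move=> <-; last first.
  by move=> x; exact: normal_pdf_ge0.
rewrite (@ge0_integral_pushforward _ _ _ (measurableTypeR R) R D mD)//.
  exact/measurable_EFinP.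
by move=> y _; rewrite lee_fin.
Qed.

(** Girsanov's theorem for one increment: the weight exp (c D) shifts the mean of [D] by c h. *)
Lemma gauss_tilt (c : R) (f : R -> R) : measurable_fun setT f -> (forall x, 0 <= f x) ->
  (\int[P]_w (expR (c * D w) * f (D w))%:E =
   (expR (c ^+ 2 * h / 2))%:E * \int[P]_w (f (D w + c * h))%:E)%E.
Proof.
move=> mf f0.
have mc : measurable_fun setT (fun x : R => expR (c * x)).
  by apply: measurableT_comp => //; exact: measurable_funM.
have mn := @measurable_normal_pdf R 0 (Num.sqrt h).
have hs : Num.sqrt h ^+ 2 = h by rewrite sqr_sqrtr// ltW.
have n0 x : 0 <= normal_pdf 0 (Num.sqrt h) x by exact: normal_pdf_ge0.
rewrite (gauss_integral (f := fun x => expR (c * x) * f x)); [|exact: measurable_funM|]; last first.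
  by move=> x; rewrite mulr_ge0// expR_ge0.
have msh : measurable_fun setT (fun x : R => f (x + c * h)).
  by apply: (measurableT_comp mf); exact: measurable_funD.
rewrite (gauss_integral (f := fun x => f (x + c * h)))//.
rewrite -ge0_integralZl//; last 2 first.
- by apply/measurable_EFinP/measurable_funM.
- by move=> x _; rewrite lee_fin mulr_ge0.
rewrite [LHS](_ : _ = \int[leb]_x (expR (c ^+ 2 * h / 2) * (f x * normal_pdf 0 (Num.sqrt h) (x - c * h)))%:E)%E.
  rewrite [LHS](@integral_shift R (c * h)); first last.
  - by move=> x; rewrite mulr_ge0 ?expR_ge0// mulr_ge0.
  - apply: measurable_funM => //; apply: measurable_funM => //.
    apply: measurableT_comp => //; exact: measurable_funB.
  by apply: eq_integral => x _; rewrite addrK EFinM.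
apply: eq_integral => x _; congr EFin.
by rewrite mulrAC normal_pdf_tilt// hs; ring.
Qed.

Lemma gauss_mgf (c : R) : integ P (fun w => expR (c * D w)) /\
  Ex P (fun w => expR (c * D w)) = expR (c ^+ 2 * h / 2).
Proof.
have e : (\int[P]_w (expR (c * D w))%:E = (expR (c ^+ 2 * h / 2))%:E)%E.
  have := @gauss_tilt c (cst 1) (measurable_cst _) (fun _ => ler01).
  under eq_integral do rewrite mulr1.
  move=> ->; rewrite (_ : (\int[P]_w _)%E = (\int[P]_w (cst 1%:E w))%E)//.
  rewrite integral_cst// mul1e -[RHS]mule1; congr (_ * _)%E; exact: probability_setT.
split; last by rewrite /Ex /Rintegral e.
apply/integrableP; split.
  apply/measurable_EFinP; apply: measurableT_comp => //; exact: measurable_funM.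
under eq_integral do rewrite /= ger0_norm ?expR_ge0//.
by rewrite e ltry.
Qed.

Lemma expR_ge_quartic (x : R) : x ^+ 4 <= 24 * (expR x + expR (- x)).
Proof.
wlog x0 : x / 0 <= x.
  move=> H; have [?|?] := leP 0 x; first exact: H.
  have := H (- x); rewrite opprK (addrC (expR _)) (_ : (- x) ^+ 4 = x ^+ 4); last by ring.
  by apply; lra.
have : 1 + x ^+ 4 / 4`!%:R <= expR x by exact: (expR_ge1Dxn 3 x0).
have := expR_ge0 (- x).
rewrite (_ : (4`!)%:R = 24 :> R); last by rewrite (_ : 4`! = 24)%N.
lra.
Qed.

(** Only the order h^2 matters. With c = +-1 / sqrt h both exponential moments equal exp (1/2), and
    D^4 = h^2 (c D)^4 is bounded through [expR_ge_quartic]. *)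
Lemma gauss_quartic : integ P (fun w => D w ^+ 4) /\
  Ex P (fun w => D w ^+ 4) <= 48 * expR (2^-1) * h ^+ 2.
Proof.
set r := Num.sqrt h; have r0 : 0 < r by rewrite sqrtr_gt0.
have r2 : r ^+ 2 = h by rewrite sqr_sqrtr// ltW.
have [i1 e1] := gauss_mgf r^-1; have [i2 e2] := gauss_mgf (- r^-1).
have e : r^-1 ^+ 2 * h / 2 = 2^-1.
  by rewrite -r2; field; rewrite gt_eqF.
have eN : (- r^-1) ^+ 2 * h / 2 = 2^-1 by rewrite sqrrN e.
have b w : `|D w ^+ 4| <= 24 * h ^+ 2 * (expR (r^-1 * D w) + expR (- r^-1 * D w)).
  rewrite ger0_norm; last by rewrite exprn_even_ge0.
  have := expR_ge_quartic (r^-1 * D w); rewrite mulNr.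
  set a := expR _ + _ => q.
  have -> : D w ^+ 4 = h ^+ 2 * (r^-1 * D w) ^+ 4.
    by rewrite -r2; field; rewrite gt_eqF.
  rewrite [leRHS](_ : _ = h ^+ 2 * (24 * a)); last by ring.
  by apply: ler_wpM2l => //; exact: sqr_ge0.
have ib : integ P (fun w => 24 * h ^+ 2 * (expR (r^-1 * D w) + expR (- r^-1 * D w))).
  by apply: integZ; exact: integD.
have i4 : integ P (fun w => D w ^+ 4).
  by apply: integ_le b ib; exact: measurable_funX.
split => //; apply: (@le_trans _ _ (Ex P (fun w => 24 * h ^+ 2 * (expR (r^-1 * D w) + expR (- r^-1 * D w))))).
  by apply: Ex_le => // w; exact: le_trans (ler_norm _) (b w).
by rewrite ExZ ?ExD//; [rewrite e1 e2 e eN; lra|exact: integD].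
Qed.

(** From 1 + c D <= exp (c D) and [gauss_mgf], the mean m satisfies c m <= exp (c^2 h / 2) - 1 <=
    c^2 h for all small c of either sign. This forces m = 0. *)
Lemma gauss_mean : integ P D /\ Ex P D = 0.
Proof.
have [i1 e1] := gauss_mgf 1; have [i2 e2] := gauss_mgf (-1).
have iD : integ P D.
  apply: (@integ_le _ _ _ _ _ (fun w => expR (1 * D w) + expR (-1 * D w))) => //.
    move=> w; rewrite mul1r mulN1r ler_norml.
    have := expR_ge1Dx (D w); have := expR_ge1Dx (- D w).
    have := expR_gt0 (D w); have := expR_gt0 (- D w).
    by move=> *; apply/andP; split; lra.
  exact: integD.
split => //.
have key c : c ^+ 2 * h <= 1 -> c * Ex P D <= c ^+ 2 * h.
  move=> ch; have [i e] := gauss_mgf c.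
  have ic : integ P (fun w => c * D w) by exact: integZ.
  have : Ex P (fun w => 1 + c * D w) <= expR (c ^+ 2 * h / 2).
    rewrite -e; apply: Ex_le => //; first by apply: integD => //; exact: integ_cst.
    by move=> w; exact: expR_ge1Dx.
  rewrite ExD//; last exact: integ_cst.
  rewrite Ex_cst ExZ//.
  have := expR_ge1Dx (- (c ^+ 2 * h / 2)); rewrite expRN.
  set E := expR _ => h1 h2.
  have E0 : 0 < E by exact: expR_gt0.
  set x := c ^+ 2 * h in ch h1 h2 *.
  have x0 : 0 <= x by rewrite mulr_ge0 ?sqr_ge0// ltW.
  have h3 : (1 - x / 2) * E <= 1.
    by rewrite -ler_pdivlMr// div1r.
  have : E <= 1 + x by nra.
  lra.
apply/eqP; apply: contraT => m0.
(* With c = m / e the inequality [key] reads m^2 / e <= (m^2 / e) (h / e), so e <= h, while e was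
   chosen larger than h and large enough for c^2 h <= 1. *)
set m := Ex P D in key m0 *; pose e := 2 * h + m ^+ 2.
have m2 : 0 < m ^+ 2 by rewrite exprn_even_gt0.
have d0 : 0 < e by apply: addr_gt0 => //; apply: mulr_gt0.
have c1 : (m / e) ^+ 2 * h <= 1.
  rewrite expr_div_n mulrAC ler_pdivrMr ?exprn_gt0// mul1r /e.
  move: (m ^+ 2) m2 (h0) => q q0 hh; rewrite expr2.
  have : 0 < h * h by apply: mulr_gt0.
  have : 0 < q * h by apply: mulr_gt0.
  have : 0 < q * q by apply: mulr_gt0.
  by nra.
have := key _ c1.
rewrite (_ : (m / e) ^+ 2 * h = m / e * m * (h / e)); last by ring.
have me : 0 < m / e * m by rewrite mulrAC -expr2 divr_gt0.
rewrite -[leLHS]mulr1 ler_pM2l// ler_pdivlMr// mul1r /e.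
by move: (m ^+ 2) m2 (h0) => q q0 hh; lra.
Qed.

End GaussRV.

(** * Independence of Brownian increments from the past *)

Section PastSigma.
Context {R : realType} {d : measure_display} {T : measurableType d}.
Variables (Z : R -> T -> R) (th : T -> R).

(** [th] is theta for the past of the Brownian motion, and a constant when the observation alone
    generates. *)
Definition past_gen (l : set R) : set (set T) :=
  [set E | (exists2 S, measurable S & E = th @^-1` S) \/
    exists2 s, l s & exists2 A, measurable A & E = Z s @^-1` A].

(** The events for which [BM_indep] gives a product formula, on a fixed grid; they form a
    pi-system. *)
Definition incr_rect (n : nat) (ts : nat -> R) : set (set T) :=
  [set E | exists As : nat -> set R, exists S : set R,
     [/\ forall i, measurable (As i), measurable S &
     E = (th @^-1` S) `&` \bigcap_(i in [set i | (i < n)%N])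
              [set w | As i (Z (ts i.+1) w - Z (ts i) w)]]].

Lemma incr_rectI n ts : setI_closed (incr_rect n ts).
Proof.
move=> _ _ [As [S [mA mS ->]]] [As' [S' [mA' mS' ->]]].
exists (fun i => As i `&` As' i), (S `&` S'); split.
- by move=> i; exact: measurableI.
- exact: measurableI.
- rewrite setIACA -preimage_setI -bigcapI; congr (_ `&` _).
Qed.

Lemma g_sigma_measurable_preimage (G : set (set T)) (f : T -> R) :
  (forall A, measurable A -> <<s G >> (f @^-1` A)) <->
  measurable_fun (setT : set (g_sigma_algebraType G)) (f : g_sigma_algebraType G -> R).
Proof.
split=> [h _ A mA|h A mA]; first by rewrite setTI; exact: h.
by have := h measurableT A mA; rewrite setTI.
Qed.

(** As [Z] vanishes at the first grid point, its value at any other one is a sum of increments. *)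
Lemma incr_rect_past n (ts : nat -> R) : (forall w, Z (ts 0) w = 0) ->
  past_gen [set s | exists2 j, (j <= n)%N & s = ts j] `<=` <<s incr_rect n ts >>.
Proof.
move=> Z0 E [[S mS ->]|[s [j jn ->] [A mA ->]]].
  apply: sub_gen_smallest; exists (fun=> setT), S; split=> //.
  by rewrite (_ : \bigcap_(i in _) _ = setT) ?setIT//; apply/seteqP; split.
move: A mA; apply/g_sigma_measurable_preimage.
elim: j jn => [|j ih] jn.
  rewrite (_ : Z (ts 0) = cst 0)//; last by apply/funext => w; exact: Z0.
rewrite (_ : Z (ts j.+1) = (fun w => Z (ts j) w + (Z (ts j.+1) w - Z (ts j) w))); last first.
  by apply/funext => w; ring.
apply: measurable_funD; first exact: (ih (ltnW jn)).
apply/g_sigma_measurable_preimage => A mA.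
apply: sub_gen_smallest; exists (fun i => if i == j then A else setT), setT; split=> //.
  by move=> i; case: ifP.
rewrite preimage_setT setTI; apply/seteqP; split => [w /= h i _|w h].
  by case: ifPn => // /eqP ->.
by have := h j jn; rewrite eqxx.
Qed.

Lemma dynkin_sub (G K : set (set T)) : setI_closed G -> dynkin K -> G `<=` K -> <<s G >> `<=` K.
Proof.
move=> GI dK GK; rewrite -setI_closed_g_dynkin_g_sigma_algebra//.
exact: smallest_sub.
Qed.

Lemma sub_sigma (G H : set (set T)) : G `<=` <<s H >> -> <<s G >> `<=` <<s H >>.
Proof. by move=> GH; apply: smallest_sub => //; exact: smallest_sigma_algebra. Qed.

Lemma past_gen_mono (l l' : set R) : l `<=` l' -> past_gen l `<=` past_gen l'.
Proof.
move=> ll E [h|[s ls h]]; first by left.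
by right; exists s => //; exact: ll.
Qed.

(** Rectangles live on strictly increasing grids from 0 to t, so a finite list of times is completed
    by 0 and t, freed of duplicates and sorted. *)
Lemma grid_of_seq (t : R) (l : seq R) : 0 <= t -> (forall s, s \in l -> 0 <= s <= t) ->
  exists n, exists ts : nat -> R, [/\ ts 0 = 0, ts n = t,
    forall i, (i < n)%N -> ts i < ts i.+1 &
    forall s, s \in l -> exists2 j, (j <= n)%N & s = ts j].
Proof.
move=> t0 lt; pose L := sort <=%R (undup (0 :: t :: l)).
have memL s : (s \in L) = (s \in 0 :: t :: l) by rewrite mem_sort mem_undup.
have srt : sorted <%R L.
  by rewrite lt_sorted_uniq_le sort_uniq undup_uniq/= sort_sorted//; exact: le_total.
have Lr s : s \in L -> 0 <= s <= t.
  rewrite memL !inE => /or3P[/eqP->|/eqP->|]; rewrite ?lexx ?t0//; exact: lt.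
have s0 : (0 < size L)%N.
  by apply/(@leq_ltn_trans (index 0 L)) => //; rewrite index_mem memL inE eqxx.
have szL : (size L).-1.+1 = size L by rewrite prednK.
have nthE s : s \in L -> exists2 j, (j <= (size L).-1)%N & s = nth t L j.
  by move=> sL; exists (index s L); rewrite ?nth_index// -ltnS szL index_mem.
have mono i j : (i <= j)%N -> (j < size L)%N -> nth t L i <= nth t L j.
  move=> ij jL; have := @le_sorted_leq_nth _ _ t L (sub_sorted (fun x y => @ltW _ R x y) srt).
  by apply; rewrite ?inE//; exact: leq_ltn_trans jL.
exists (size L).-1, (fun i => nth t L i); split.
- have [j jn e] : exists2 j, (j <= (size L).-1)%N & (0 : R) = nth t L j.
    by apply: nthE; rewrite memL inE eqxx.
  apply/eqP; rewrite eq_le {1}e mono//=; last by rewrite -szL ltnS.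
  by have /andP[] := Lr _ (mem_nth t s0).
- have [j jn e] : exists2 j, (j <= (size L).-1)%N & t = nth t L j.
    by apply: nthE; rewrite memL !inE eqxx orbT.
  have h : ((size L).-1 < size L)%N by rewrite -[X in (_ < X)%N]szL.
  apply/eqP; rewrite eq_le {3}e mono// andbT.
  by have /andP[] := Lr _ (mem_nth t h).
- move=> i isz; rewrite (lt_sorted_ltn_nth t srt)// inE -szL ltnS//.
  exact: ltnW.
- by move=> s sl; apply: nthE; rewrite memL !inE sl !orbT.
Qed.

(* Dynkin's lemma twice: along a fixed grid, and along the directed union of all grids. *)
Lemma past_dynkin (t : R) (K : set (set T)) : 0 <= t -> (forall w, Z 0 w = 0) -> dynkin K ->
  (forall n ts, ts 0 = 0 -> (forall i, (i < n)%N -> ts i < ts i.+1) -> ts n = t ->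
     incr_rect n ts `<=` K) ->
  <<s past_gen [set s | 0 <= s <= t] >> `<=` K.
Proof.
move=> t0 Z0 dK HK.
(* Events depending on finitely many times: concatenating two lists shows stability under
   intersection. *)
pose Q : set (set T) := [set E | exists2 l : seq R, (forall s, s \in l -> 0 <= s <= t) &
  <<s past_gen [set` l] >> E].
have QI : setI_closed Q.
  move=> E F [l lt lE] [l' lt' lF]; exists (l ++ l').
    by move=> s; rewrite mem_cat => /orP[/lt|/lt'].
  have sg := @smallest_sigma_algebra T setT (past_gen [set` l ++ l']).
  have H1 : <<s past_gen [set` l ++ l'] >> E.
    move: lE; apply: sub_sigma; apply: subset_trans (@sub_gen_smallest _ _ _).
    by apply: past_gen_mono => s /= sl; rewrite mem_cat sl.
  have H2 : <<s past_gen [set` l ++ l'] >> F.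
    move: lF; apply: sub_sigma; apply: subset_trans (@sub_gen_smallest _ _ _).
    by apply: past_gen_mono => s /= sl; rewrite mem_cat sl orbT.
  by have := @measurableI _ (g_sigma_algebraType (past_gen [set` l ++ l'])) E F H1 H2.
have QK : Q `<=` K.
  move=> E [l lt lE].
  have [n [ts [ts0 tsn tsi tsl]]] := grid_of_seq t0 lt.
  have : <<s incr_rect n ts >> `<=` K.
    by apply: dynkin_sub => //; [exact: incr_rectI|exact: HK].
  apply; move: lE; apply: sub_sigma.
  apply: subset_trans (@incr_rect_past n ts _); last by rewrite ts0.
  by apply: past_gen_mono => s /= /tsl.
apply: subset_trans (dynkin_sub QI dK QK).
apply: sub_sigma; apply: subset_trans (@sub_gen_smallest _ _ _).
move=> E [h|[s /= st h]].
  exists [::] => //; apply: sub_gen_smallest; by left.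
exists [:: s]; first by move=> s'; rewrite inE => /eqP ->.
by apply: sub_gen_smallest; right; exists s => //=; rewrite inE.
Qed.

End PastSigma.

Section DynkinEx.
Context {d : measure_display} {T : measurableType d} {R : realType}.
Variable P : probability T R.
Variables (x1 x2 : T -> R).
Hypotheses (i1 : integ P x1) (i2 : integ P x2) (e12 : Ex P x1 = Ex P x2).

Lemma Ex_indicC (x : T -> R) (F : set T) : measurable F -> integ P x ->
  Ex P (fun w => \1_(~` F) w * x w) = Ex P x - Ex P (fun w => \1_F w * x w).
Proof.
move=> mF ix; rewrite -ExB//; last exact: integ_indicM.
apply: eq_Ex => w; rewrite !indicE in_setC.
by case: (w \in F); rewrite /= ?mul1r ?mul0r ?subrr ?subr0.
Qed.

Lemma Ex_indicU (x : T -> R) (F G : set T) : measurable F -> measurable G -> integ P x ->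
  F `&` G = set0 ->
  Ex P (fun w => \1_(F `|` G) w * x w) =
  Ex P (fun w => \1_F w * x w) + Ex P (fun w => \1_G w * x w).
Proof.
move=> mF mG ix FG; rewrite -ExD//; [|exact: integ_indicM..].
apply: eq_Ex => w; rewrite !indicE in_setU -mulrDl; congr (_ * _).
have [wF|wF] := boolP (w \in F); have [wG|wG] := boolP (w \in G); rewrite ?addr0 ?add0r//=.
exfalso; have : (F `&` G) w by split; exact: set_mem.
by rewrite FG.
Qed.

(** [e12] settles the whole space and complements; disjoint unions are limits of partial unions, by
    dominated convergence. *)
Lemma dynkin_Ex : dynkin [set F | measurable F /\
  Ex P (fun w => \1_F w * x1 w) = Ex P (fun w => \1_F w * x2 w)].
Proof.
split.
- split; first exact: measurableT.
  by under eq_Ex do rewrite indicT mul1r; under [RHS]eq_Ex do rewrite indicT mul1r.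
- move=> F [mF e]; split; first exact: measurableC.
  by rewrite !Ex_indicC// e12 e.
- move=> F tF HF.
  have mF i : measurable (F i) by case: (HF i).
  split; first exact: bigcup_measurable.
  pose G n := \big[setU/set0]_(i < n) F i.
  have mG n : measurable (G n) by exact: bigsetU_measurable.
  have eG n : Ex P (fun w => \1_(G n) w * x1 w) = Ex P (fun w => \1_(G n) w * x2 w).
    elim: n => [|n ih].
      have -> : G 0 = set0 by rewrite /G big_ord0.
      by under eq_Ex do rewrite indic0 mul0r; under [RHS]eq_Ex do rewrite indic0 mul0r.
    have GF : G n `&` F n = set0.
      rewrite /G -bigcup_mkord; apply/seteqP; split => // w [[i /= iN Fi] Fn].
      have /trivIsetP/(_ i n I I (negbT (ltn_eqF iN))) e := tF.
      by suff : set0 w by []; rewrite -e.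
    have -> : G n.+1 = G n `|` F n by rewrite /G big_ord_recr.
    by rewrite !Ex_indicU// ih (HF n).2.
  have lim x : integ P x ->
     Ex P (fun w => \1_(G n) w * x w) @[n --> \oo] --> Ex P (fun w => \1_(\bigcup_k F k) w * x w).
    move=> ix; have [||||_ //] := @Ex_cvg _ _ _ P (fun n w => \1_(G n) w * x w)
      (fun w => \1_(\bigcup_k F k) w * x w) (fun w => `|x w|).
    - by move=> n; apply: integ_meas; exact: (integ_indicM (mG n) ix).
    - exact: integrable_norm.
    - by move=> n w; rewrite normrM indicE; case: (_ \in _); rewrite ?normr1 ?mul1r// normr0 mul0r.
    - move=> w; apply: cvgM; last exact: cvg_cst.
      have [[k _ Fk]|wF] := pselect ((\bigcup_k F k) w).
        rewrite indicE mem_set; last by exists k.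
        apply: cvg_near_cst; exists k.+1 => // n /= kn.
        by rewrite indicE mem_set// /G -bigcup_mkord; exists k.
      rewrite indicE memNset//; apply: cvg_near_cst; apply: nearW => n.
      rewrite indicE memNset// /G -bigcup_mkord => -[k _ Fk]; apply: wF; exists k => //.
  have l1 := lim _ i1; have l2 := lim _ i2.
  have e : (fun n => Ex P (fun w => \1_(G n) w * x1 w)) = (fun n => Ex P (fun w => \1_(G n) w * x2 w)).
    by apply/funext => n; exact: eG.
  by rewrite e in l1; rewrite -(cvg_lim (@Rhausdorff R) l1) (cvg_lim (@Rhausdorff R) l2).
Qed.

End DynkinEx.

Section TransferSigma.
Context {d : measure_display} {T : measurableType d} {R : realType}.
Variable P : probability T R.

(** In terms of conditional expectations: when [x1] and [x2] have the same projection on the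
    sigma-algebra of [G], a measurable factor [Y] does not tell them apart. *)
Lemma transfer_sigma (G : set (set T)) (x1 x2 Y : T -> R) :
  <<s G >> `<=` measurable ->
  integ P x1 -> integ P x2 -> (forall w, 0 <= x1 w) -> (forall w, 0 <= x2 w) ->
  (forall F, <<s G >> F -> Ex P (fun w => \1_F w * x1 w) = Ex P (fun w => \1_F w * x2 w)) ->
  measurable_fun (setT : set (g_sigma_algebraType G)) (Y : g_sigma_algebraType G -> R) ->
  integ P (fun w => Y w * x1 w) ->
  integ P (fun w => Y w * x2 w) /\ Ex P (fun w => Y w * x1 w) = Ex P (fun w => Y w * x2 w).
Proof.
move=> GM i1 i2 p1 p2 H mY.
have mYA A : measurable A -> <<s G >> (Y @^-1` A) by move=> mA; exact: ((g_sigma_measurable_preimage G Y).2 mY A mA).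
apply: transfer => //; last by move=> A mA; apply: H; exact: mYA.
by move=> _ A mA; rewrite setTI; apply: GM; exact: mYA.
Qed.

Lemma g_sigma_indic (G : set (set T)) (F : set T) : <<s G >> F ->
  measurable_fun (setT : set (g_sigma_algebraType G)) (\1_F : g_sigma_algebraType G -> R).
Proof. by move=> GF; exact: measurable_indic. Qed.

End TransferSigma.

Section Brownian.
Context {R : realType} {d : measure_display} {T : measurableType d}.
Variables (P : probability T R) (Bm : R -> T -> R) (theta : T -> R).
Hypothesis HB : BM_indep P Bm theta.

Let B0 w : Bm 0 w = 0. Proof. by case: HB. Qed.
Let mB t : measurable_fun setT (Bm t). Proof. by case: HB. Qed.
Let mth : measurable_fun setT theta. Proof. by case: HB. Qed.

Definition pastB t := <<s past_gen Bm theta [set s | 0 <= s <= t] >>.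

Lemma pastB_measurable t : pastB t `<=` measurable.
Proof.
apply: smallest_sub; first exact: sigma_algebra_measurable.
move=> E [[S mS ->]|[s _ [A mA ->]]]; rewrite -[X in measurable X]setTI.
  exact: mth.
exact: mB.
Qed.

Let mD t u : measurable_fun setT (fun w => Bm u w - Bm t w).
Proof. exact: measurable_funB. Qed.

Lemma bm_law t u : 0 <= t -> t < u -> forall A : set R, measurable A ->
  P ((fun w => Bm u w - Bm t w) @^-1` A) = normal_prob 0 (Num.sqrt (u - t)) A.
Proof.
move=> t0 tu A mA; have [_ _ _ _ H] := HB.
have tsi i : (i < 1)%N -> (if i == 0%N then t else u) < (if i.+1 == 0%N then t else u).
  by rewrite ltnS leqn0 => /eqP ->.
have := H 1%N (fun i => if i == 0%N then t else u) (fun=> A) setT t0 tsi (fun=> mA) measurableT.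
rewrite big_ord_recl big_ord0 mule1 /= => h.
rewrite (_ : [set w | setT (theta w)] = setT) in h; last by apply/seteqP; split.
rewrite setTI probability_setT mul1e in h; rewrite -h.
congr (P _); apply/seteqP; split => [w Aw i|w h'].
  by rewrite /= ltnS leqn0 => /eqP ->.
by exact: (h' 0%N).
Qed.

Let mDA t u A : measurable A -> measurable ((fun w => Bm u w - Bm t w) @^-1` A).
Proof. by move=> mA; rewrite -[X in measurable X]setTI; exact: mD. Qed.

Local Notation inc t u := (fun w => (Bm u w - Bm t w)%R).

Lemma pastB_indep t u F A : 0 <= t -> t < u -> pastB t F -> measurable A ->
  P (F `&` (inc t u @^-1` A)) =
  (P F * P (inc t u @^-1` A))%E.
Proof.
move=> t0 tu pF mA; set D := _ @^-1` A.
have mDD : measurable D by exact: mDA.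
have mF := pastB_measurable pF.
have fin E : measurable E -> P E = (fine (P E))%:E by move=> mE; rewrite fineK//; exact: fin_num_measure.
have ID : integ P \1_D by exact: integ_indic.
have IC : integ P (cst (fine (P D))) by exact: integ_cst.
have e12 : Ex P \1_D = Ex P (cst (fine (P D))) by rewrite Ex_indic// Ex_cst.
have dK := dynkin_Ex ID IC e12.
(* Independence from [D] is rewritten as the equality of the means of 1_E 1_D and 1_E P(D), a form
   covered by [dynkin_Ex]. *)
have conv E : measurable E -> (Ex P (fun w => \1_E w * \1_D w) = Ex P (fun w => \1_E w * fine (P D)))
   <-> P (E `&` D) = (P E * P D)%E.
  move=> mE; have mED : measurable (E `&` D) by exact: measurableI.
  have ea : Ex P (fun w => \1_E w * \1_D w) = fine (P (E `&` D)).
    by rewrite -Ex_indic//; apply: eq_Ex => w; rewrite indicI.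
  have eb : Ex P (fun w => \1_E w * fine (P D)) = fine (P D) * fine (P E).
    rewrite -(Ex_indic _ mE) -ExZ; last exact: integ_indic.
    by apply: eq_Ex => w; rewrite mulrC.
  rewrite ea eb; split => [h|->].
    by rewrite (fin _ mED) h (fin _ mE) (fin _ mDD) -EFinM mulrC.
  by rewrite (fin _ mE) (fin _ mDD) -EFinM/= mulrC.
apply/conv => //.
suff : pastB t `<=` [set F | measurable F /\
  Ex P (fun w => \1_F w * \1_D w) = Ex P (fun w => \1_F w * cst (fine (P D)) w)].
  by move=> /(_ F pF)[].
apply: past_dynkin => // n ts ts0 tsi tsn E [As [S [mAs mS ->]]].
have mE : measurable (theta @^-1` S `&` \bigcap_(i in [set i | (i < n)%N])
      [set w | As i (Bm (ts i.+1) w - Bm (ts i) w)]).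
  apply: measurableI; first by rewrite -[X in measurable X]setTI; exact: mth.
  by apply: bigcap_measurableType => i _; exact: mDA.
split => //; apply/conv => //.
have [_ _ _ _ H] := HB.
(* The grid extended by u, with [A] as the event of the last increment: [BM_indep] for n and for n +
   1 increments then differ by exactly one factor. *)
pose ts' i := if (i <= n)%N then ts i else u.
pose As' i := if (i < n)%N then As i else A.
have mAs' i : measurable (As' i) by rewrite /As'; case: ifP.
have ts'0 : 0 <= ts' 0%N by rewrite /ts'/= ts0.
have ts'i m : (m <= n.+1)%N -> forall i, (i < m)%N -> ts' i < ts' i.+1.
  move=> mn i im; have iN : (i <= n)%N by rewrite -ltnS (leq_trans im).
  rewrite /ts' iN; case: ifP => [/tsi//|/negbT]; rewrite -ltnNge ltnS => ni.
  by rewrite (_ : i = n) ?tsn//; apply/eqP; rewrite eqn_leq iN.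
have H1 := H n ts' As' S ts'0 (ts'i n (leqnSn n)) mAs' mS.
have H2 := H n.+1 ts' As' S ts'0 (ts'i n.+1 (leqnn _)) mAs' mS.
rewrite big_ord_recr/= muleA -H1 in H2.
have E1 : [set w | S (theta w)] `&` \bigcap_(i in [set i | (i < n)%N])
   [set w | As' i (Bm (ts' i.+1) w - Bm (ts' i) w)] =
   theta @^-1` S `&` \bigcap_(i in [set i | (i < n)%N])
      [set w | As i (Bm (ts i.+1) w - Bm (ts i) w)].
  by congr (_ `&` _); apply: eq_bigcapr => i /= iN; rewrite /As' /ts' iN (ltnW iN).
have E2 : [set w | S (theta w)] `&` \bigcap_(i in [set i | (i < n.+1)%N])
   [set w | As' i (Bm (ts' i.+1) w - Bm (ts' i) w)] =
   theta @^-1` S `&` \bigcap_(i in [set i | (i < n)%N])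
      [set w | As i (Bm (ts i.+1) w - Bm (ts i) w)] `&` D.
  rewrite -E1 -setIA; congr (_ `&` _); apply/seteqP; split => [w h|w [h1 h2] i /=].
    split; first by move=> i /= iN; apply: h => /=; rewrite ltnS ltnW.
    have := h n (ltnSn n); by rewrite /= /As' /ts' !ltnn leqnn tsn.
  rewrite ltnS leq_eqVlt => /orP[/eqP ->|]; last exact: h1.
  by rewrite /= /As' /ts' !ltnn leqnn tsn.
rewrite E1 E2 in H2; rewrite H2 /As' /ts' !ltnn leqnn tsn; congr (_ * _)%E.
by rewrite bm_law.
Qed.

Lemma pastB_incr_Ex t u F (f : R -> R) : 0 <= t -> t < u -> pastB t F ->
  measurable_fun setT f -> integ P (fun w => f (Bm u w - Bm t w)) ->
  Ex P (fun w => \1_F w * f (Bm u w - Bm t w)) =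
  fine (P F) * Ex P (fun w => f (Bm u w - Bm t w)).
Proof.
move=> t0 tu pF mf ifD; have mF := pastB_measurable pF.
set Y := fun w => f (Bm u w - Bm t w) in ifD *.
have mY : measurable_fun setT Y by exact: measurableT_comp.
have p0 : 0 <= fine (P F) by rewrite fine_ge0.
have [|||||||_ e] := @transfer _ _ _ P \1_F (cst (fine (P F))) Y.
- exact: integ_indic.
- exact: integ_cst.
- by move=> w; rewrite indicE.
- by [].
- exact: mY.
- move=> A mA.
  have := pastB_indep t0 tu pF (A := f @^-1` A).
  rewrite (_ : _ @^-1` (f @^-1` A) = Y @^-1` A)// => /(_ _) h.
  have {}h : P (F `&` Y @^-1` A) = (P F * P (Y @^-1` A))%E.
    by apply: h; rewrite -[X in measurable X]setTI; exact: mf.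
  have mYA : measurable (Y @^-1` A) by rewrite -[X in measurable X]setTI; exact: mY.
  rewrite (_ : (fun w => _ * \1_F w) = \1_(F `&` Y @^-1` A)); last first.
    by apply/funext => w; rewrite indicI mulrC.
  rewrite (_ : (fun w => _ * cst _ w) = (fun w => fine (P F) * \1_(Y @^-1` A) w)); last first.
    by apply/funext => w; rewrite mulrC.
  rewrite ExZ; last exact: integ_indic.
  rewrite !Ex_indic//; last exact: measurableI.
  by rewrite h fineM// fin_num_measure.
- by under [X in integ _ X]eq_fun do rewrite mulrC; exact: integ_indicM.
rewrite (_ : (fun w => \1_F w * _) = (fun w => Y w * \1_F w)); last first.
  by apply/funext => w; rewrite mulrC.
rewrite e (_ : (fun w => Y w * cst _ w) = (fun w => fine (P F) * Y w)); last first.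
  by apply/funext => w; rewrite mulrC.
by rewrite ExZ.
Qed.

(** Against the past, f of the increment has the same weight as its mean. Here f >= 0, because it
    acts as one of the densities of [transfer_sigma]. *)
Lemma pastB_incr_prod t u (xi : T -> R) (f : R -> R) : 0 <= t -> t < u ->
  measurable_fun (setT : set (g_sigma_algebraType (past_gen Bm theta [set s | 0 <= s <= t])))
     (xi : g_sigma_algebraType (past_gen Bm theta [set s | 0 <= s <= t]) -> R) ->
  integ P xi -> measurable_fun setT f -> (forall x, 0 <= f x) ->
  integ P (fun w => f (Bm u w - Bm t w)) ->
  integ P (fun w => xi w * f (Bm u w - Bm t w)) /\
  Ex P (fun w => xi w * f (Bm u w - Bm t w)) =
  Ex P xi * Ex P (fun w => f (Bm u w - Bm t w)).
Proof.
move=> t0 tu mxi ixi mf f0 ifD.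
set Y := fun w => f (Bm u w - Bm t w) in ifD *.
have E0 : 0 <= Ex P Y by apply: Ex_ge0 => w; exact: f0.
have [|||||||i e] := @transfer_sigma _ _ _ P _ (cst (Ex P Y)) Y xi (@pastB_measurable t).
- exact: integ_cst.
- exact: ifD.
- by [].
- by move=> w; exact: f0.
- move=> F pF; rewrite pastB_incr_Ex//.
  rewrite (_ : (fun w => \1_F w * cst _ w) = (fun w => Ex P Y * \1_F w)); last first.
    by apply/funext => w; rewrite mulrC.
  have mF := pastB_measurable pF.
  by rewrite ExZ ?Ex_indic//; [rewrite mulrC|exact: integ_indic].
- exact: mxi.
- by under [X in integ _ X]eq_fun do rewrite mulrC; exact: integZ.
split => //; rewrite -e (_ : (fun w => xi w * cst _ w) = (fun w => Ex P Y * xi w)); last first.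
  by apply/funext => w; rewrite mulrC.
by rewrite ExZ// mulrC.
Qed.

End Brownian.

(** * The posterior process *)

Section Observation.
Context {R : realType} {d : measure_display} {T : measurableType d}.
Variables (P : probability T R) (Bm : R -> T -> R) (theta : T -> R) (mu : R).
Hypothesis HB : BM_indep P Bm theta.
Hypothesis Hth : forall w, theta w = 1 \/ theta w = -1.

Definition obs (t : R) (w : T) : R := mu * theta w * t + Bm t w.
Definition prior : R := fine (P [set w | theta w = 1]).
Local Notation X := obs.
Local Notation p := prior.
Local Notation Tp := [set w | theta w = 1].
Local Notation Tm := [set w | theta w = -1].
Local Notation pastB := (pastB Bm theta).
Local Notation inc t u := (fun w => (Bm u w - Bm t w)%R).

Let B0 w : Bm 0 w = 0. Proof. by case: HB. Qed.
Let mB t : measurable_fun setT (Bm t). Proof. by case: HB. Qed.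
Let mth : measurable_fun setT theta. Proof. by case: HB. Qed.

Lemma obs0 w : X 0 w = 0.
Proof. by rewrite /X mulr0 B0 addr0. Qed.

Lemma measurable_obs t : measurable_fun setT (X t).
Proof.
apply: measurable_funD => //.
by apply: measurable_funM => //; exact: measurable_funM.
Qed.

Lemma theta_pm w : theta w = \1_Tp w - \1_Tm w.
Proof.
rewrite !indicE; case: (Hth w) => h.
  rewrite mem_set// memNset ?subr0//= h => e; have : (1 : R) = -1 := e; lra.
rewrite (memNset (A := Tp)) ?mem_set// ?sub0r//= h => e; have : (-1 : R) = 1 := e; lra.
Qed.

Lemma measurable_Tp : measurable Tp.
Proof. by have := mth measurableT (measurable_set1 (1 : R)); rewrite setTI. Qed.

Lemma measurable_Tm : measurable Tm.
Proof. by have := mth measurableT (measurable_set1 (-1 : R)); rewrite setTI. Qed.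

Lemma pastB_Tp t : pastB t Tp.
Proof. by apply: sub_gen_smallest; left; exists [set 1] => //; exact: measurable_set1. Qed.

Lemma pastB_Tm t : pastB t Tm.
Proof. by apply: sub_gen_smallest; left; exists [set -1] => //; exact: measurable_set1. Qed.

Lemma prior_ge0 : 0 <= p. Proof. exact: fine_ge0. Qed.

Lemma TmE : Tm = ~` Tp.
Proof.
apply/seteqP; split => w /=; first by move=> -> e; have : (-1 : R) = 1 := e; lra.
by case: (Hth w).
Qed.

Lemma prior_Tm : fine (P Tm) = 1 - p.
Proof.
rewrite TmE probability_setC; last exact: measurable_Tp.
by rewrite fineB// fin_num_measure//; exact: measurable_Tp.
Qed.

Lemma prior_le1 : p <= 1.
Proof. by rewrite -subr_ge0 -prior_Tm; exact: fine_ge0. Qed.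

Lemma pastBI t E F : pastB t E -> pastB t F -> pastB t (E `&` F).
Proof. exact: (@measurableI _ (g_sigma_algebraType (past_gen Bm theta [set s | 0 <= s <= t]))). Qed.

Notation pastT t := (g_sigma_algebraType (past_gen Bm theta [set s | 0 <= s <= t])).

Lemma pastB_obs_fun s t : 0 <= s <= t ->
  measurable_fun (setT : set (pastT t)) (X s : pastT t -> R).
Proof.
move=> st; apply: measurable_funD.
  apply: measurable_funM => //; apply: measurable_funM => //.
  apply/g_sigma_measurable_preimage => A mA; apply: sub_gen_smallest; left.
  by exists A.
apply/g_sigma_measurable_preimage => A mA; apply: sub_gen_smallest; right.
by exists s => //; exists A.
Qed.

Lemma natF_pastB t : natF X t `<=` pastB t.
Proof.
apply: sub_sigma => E [s [st [A mA ->]]].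
have := @pastB_obs_fun s t st measurableT A mA; by rewrite setTI.
Qed.

Lemma natF_measurable t : natF X t `<=` measurable.
Proof. by move=> E /natF_pastB; exact: (pastB_measurable HB). Qed.

Lemma bm_exp_integ c t : 0 <= t -> integ P (fun w => expR (c * Bm t w)).
Proof.
rewrite le_eqVlt => /orP[/eqP <-|t0].
  under [X in integ _ X]eq_fun do rewrite B0; exact: integ_cst.
have t0' : 0 < t - 0 by rewrite subr0.
have [i _] := gauss_mgf t0' (measurable_funB (mB t) (mB 0)) (bm_law HB (lexx _) t0) c.
have -> : Bm t = (fun w => Bm t w - Bm 0 w) by apply/funext => w; rewrite B0 subr0.
exact: i.
Qed.

Lemma bm_integ t : 0 <= t -> integ P (Bm t).
Proof.
rewrite le_eqVlt => /orP[/eqP <-|t0].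
  by rewrite (_ : Bm 0 = cst 0); [exact: integ_cst|apply/funext].
have t0' : 0 < t - 0 by rewrite subr0.
have [i _] := gauss_mean t0' (measurable_funB (mB t) (mB 0)) (bm_law HB (lexx _) t0).
have -> : Bm t = (fun w => Bm t w - Bm 0 w) by apply/funext => w; rewrite B0 subr0.
exact: i.
Qed.

Lemma obs_integ t : 0 <= t -> integ P (X t).
Proof.
move=> t0; apply: integD; last exact: bm_integ.
apply: (@integ_bounded _ _ _ _ (`|mu * t|)).
  by apply: measurable_funM => //; exact: measurable_funM.
by move=> w; case: (Hth w) => ->; rewrite ?mulr1// mulrN1 mulNr normrN.
Qed.

Lemma lr_integ c t : 0 <= t -> integ P (fun w => expR (c * X t w)).
Proof.
move=> t0.
apply: (@integ_le _ _ _ _ _ (fun w => expR (`|c * mu * t|) * expR (c * Bm t w))).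
- apply: measurableT_comp => //; apply: measurable_funM => //; exact: measurable_obs.
- move=> w; rewrite ger0_norm ?expR_ge0// -expRD ler_expR /X.
  have -> : c * (mu * theta w * t + Bm t w) = c * mu * t * theta w + c * Bm t w by ring.
  rewrite lerD2r; case: (Hth w) => ->; rewrite ?mulr1 ?ler_norm//.
  by rewrite mulrN1 -normrN ler_norm.
- by apply: integZ; exact: bm_exp_integ.
Qed.

Lemma indic_in (A : set T) w : A w -> \1_A w = 1 :> R.
Proof. by move=> Aw; rewrite indicE mem_set. Qed.

Lemma indic_out (A : set T) w : ~ A w -> \1_A w = 0 :> R.
Proof. by move=> Aw; rewrite indicE memNset. Qed.

Lemma indic_preim (f : T -> R) (A : set R) w : \1_[set w | A (f w)] w = \1_A (f w) :> R.
Proof.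
by rewrite !indicE; congr (nat_of_bool _)%:R; apply/idP/idP => /set_mem h; apply: mem_set.
Qed.

(** * The likelihood ratio of the two drifts *)

Section LikelihoodRatio.

Let rect n (As : nat -> set R) (ts : nat -> R) : set T :=
  \bigcap_(i in [set i | (i < n)%N]) [set w | As i (X (ts i.+1) w - X (ts i) w)].

Let rectS n As ts : rect n.+1 As ts =
  rect n As ts `&` [set w | As n (X (ts n.+1) w - X (ts n) w)].
Proof.
apply/seteqP; split => [w h|w [h1 h2] i /=].
  split; last exact: (h n (ltnSn n)).
  by move=> i /= iN; apply: h => /=; rewrite ltnS ltnW.
by rewrite ltnS leq_eqVlt => /orP[/eqP ->//|]; exact: h1.
Qed.

(** Induction along the grid: exp (2 mu x) is the likelihood ratio of drift mu to drift - mu for an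
    increment x of the observation, so it turns the law given theta = -1 into the law given theta =
    1. The factors 1 - p and p balance the prior weights. *)
Let lr_rect n As ts : ts 0%N = 0 -> (forall i, measurable (As i)) ->
  (forall i, (i < n)%N -> ts i < ts i.+1) ->
  [/\ 0 <= ts n, pastB (ts n) (rect n As ts) &
  (1 - p) * Ex P (\1_(rect n As ts `&` Tp)) =
  p * Ex P (fun w => \1_(rect n As ts `&` Tm) w * expR (2 * mu * X (ts n) w))].
Proof.
move=> ts0 mA; elim: n => [|n ih] tsi.
  rewrite ts0 (_ : rect 0 As ts = setT); last by apply/seteqP; split.
  split => //; first exact: (@measurableT _ (pastT 0)).
  rewrite !setTI Ex_indic; last exact: measurable_Tp.
  under eq_Ex do rewrite obs0 mulr0 expR0 mulr1.
  by rewrite Ex_indic ?prior_Tm; [rewrite mulrC|exact: measurable_Tm].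
have [t0 pR e] := ih (fun i iN => tsi i (ltnW iN)).
set t := ts n in t0 pR e *; set u := ts n.+1.
have tu : t < u by exact: tsi.
have u0 : 0 <= u by rewrite (le_trans t0)// ltW.
set A := As n; set de := u - t.
have de0 : 0 < de by rewrite subr_gt0.
have pmono : pastB t `<=` pastB u.
  apply: sub_sigma; apply: subset_trans (@sub_gen_smallest _ _ _).
  by apply: past_gen_mono => s /= /andP[-> st]; rewrite (le_trans st)// ltW.
rewrite rectS; split => //.
  apply: pastBI; first exact: pmono.
  have := @measurable_funB _ (pastT u) R setT (X u) (X t) _ _ measurableT A (mA n).
  rewrite setTI; apply; apply: pastB_obs_fun; rewrite ?lexx ?u0 ?t0 ?ltW//.
set Rn := rect n As ts in pR e *.
(* For a Brownian increment y, [g] is the new event under drift mu, and [f] the same event under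
   drift - mu times its likelihood ratio. *)
pose g (y : R) : R := \1_A (y + mu * de).
pose f (y : R) : R := \1_A (y - mu * de) * expR (2 * mu * (y - mu * de)).
have mg : measurable_fun setT g.
  apply: (measurableT_comp (measurable_indic (mA n))); exact: measurable_funD.
have mfs : measurable_fun setT (fun y : R => y - mu * de) by exact: measurable_funB.
have mf : measurable_fun setT f.
  apply: measurable_funM; first exact: (measurableT_comp (measurable_indic (mA n)) mfs).
  by apply: measurableT_comp => //; apply: measurable_funM.
have f0 y : 0 <= f y by rewrite mulr_ge0 ?expR_ge0// indicE.
have mD : measurable_fun setT (inc t u) by exact: measurable_funB.
have law := bm_law HB t0 tu.
have efg : (\int[P]_w (f (inc t u w))%:E = \int[P]_w (g (inc t u w))%:E)%E.
  (* f y is exp (2 mu y) times f1 y; tilting by 2 mu shifts by 2 mu de and produces the factor exp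
     (2 mu^2 de), which cancels the constant in [f1]. *)
  pose f1 (y : R) : R := \1_A (y - mu * de) * expR (- (2 * mu ^+ 2 * de)).
  have mf1 : measurable_fun setT f1.
    by apply: measurable_funM => //; exact: (measurableT_comp (measurable_indic (mA n)) mfs).
  have f10 y : 0 <= f1 y by rewrite mulr_ge0 ?expR_ge0// indicE.
  have H := gauss_tilt de0 mD law (2 * mu) mf1 f10.
  transitivity (\int[P]_w (expR (2 * mu * (inc t u w)) * f1 (inc t u w))%:E)%E.
    apply: eq_integral => w _; congr EFin; rewrite /f /f1 mulrCA; congr (_ * _).
    by rewrite -expRD; congr expR; ring.
  have m1 : measurable_fun setT (fun w => inc t u w + 2 * mu * de) by exact: measurable_funD.
  rewrite H -ge0_integralZl_EFin ?expR_ge0//.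
  - apply: eq_integral => w _; rewrite -EFinM; congr EFin.
    rewrite /g /f1 mulrCA -expRD (_ : (2 * mu) ^+ 2 * de / 2 + - (2 * mu ^+ 2 * de) = 0); last by field.
    by rewrite expR0 mulr1; congr (\1_A _); ring.
  - by move=> w _; rewrite lee_fin.
  - by apply/measurable_EFinP; exact: (measurableT_comp mf1 m1).
have ig : integ P (fun w => g (inc t u w)).
  apply: (@integ_bounded _ _ _ _ 1); first exact: measurableT_comp.
  by move=> w; rewrite /g indicE; case: (_ \in _); rewrite ?normr1 ?normr0.
have ifD : integ P (fun w => f (inc t u w)).
  apply/integrableP; split; first by apply/measurable_EFinP; exact: measurableT_comp.
  have -> : (\int[P]_w `|(EFin \o (fun w => f (inc t u w))) w|)%E =
     (\int[P]_w (f (inc t u w))%:E)%E.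
    by apply: eq_integral => w _; rewrite gee0_abs// lee_fin.
  rewrite efg.
  have /integrableP[_] := ig.
  rewrite (_ : (\int[P]_w `|_|)%E = (\int[P]_w (g (inc t u w))%:E)%E)//.
  by apply: eq_integral => w _; rewrite gee0_abs// lee_fin /g indicE.
have EE : Ex P (fun w => f (inc t u w)) = Ex P (fun w => g (inc t u w)).
  by rewrite /Ex /Rintegral efg.
pose xi w := \1_(Rn `&` Tm) w * expR (2 * mu * X t w).
have pRp : pastB t (Rn `&` Tp) by apply: pastBI => //; exact: pastB_Tp.
have pRm : pastB t (Rn `&` Tm) by apply: pastBI => //; exact: pastB_Tm.
have ixi : integ P xi.
  apply: integ_indicM; last exact: lr_integ.
  exact: (pastB_measurable HB pRm).
have mxi : measurable_fun (setT : set (pastT t)) (xi : pastT t -> R).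
  apply: measurable_funM; first exact: g_sigma_indic.
  apply: measurableT_comp => //; apply: measurable_funM => //.
  by apply: pastB_obs_fun; rewrite t0 lexx.
have [_ e2] := pastB_incr_prod HB t0 tu mxi ixi mf f0 ifD.
have eXp w : Tp w -> X u w - X t w = inc t u w + mu * de.
  by rewrite /X /de => /= ->; ring.
have eXm w : Tm w -> X u w - X t w = inc t u w - mu * de.
  by rewrite /X /de => /= ->; ring.
transitivity ((1 - p) * (Ex P \1_(Rn `&` Tp) * Ex P (fun w => g (inc t u w)))).
  congr (_ * _); rewrite [X in _ = X * _]Ex_indic; last exact: (pastB_measurable HB pRp).
  rewrite -(pastB_incr_Ex HB t0 tu pRp mg ig); apply: eq_Ex => w.
  rewrite setIAC indicI /g; have [wp|wp] := pselect (Tp w).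
    by rewrite -eXp// -indic_preim.
  by rewrite /= (@indic_out (Rn `&` Tp)) ?mul0r// => -[].
rewrite mulrA e -mulrA -EE -e2; congr (_ * _); apply: eq_Ex => w.
rewrite setIAC indicI /xi; have [wp|wp] := pselect (Tm w); last first.
  by rewrite /= (@indic_out (Rn `&` Tm)) ?mul0r// => -[].
rewrite -!mulrA; congr (_ * _).
rewrite (indic_preim (fun w => X u w - X t w)) /f -eXm// mulrCA; congr (_ * _).
by rewrite -expRD; congr expR; ring.
Qed.

Lemma lr_natF t F : 0 <= t -> natF X t F ->
  (1 - p) * Ex P (fun w => \1_F w * \1_Tp w) =
  p * Ex P (fun w => \1_F w * (\1_Tm w * expR (2 * mu * X t w))).
Proof.
move=> t0 nF.
pose x1 w := (1 - p) * \1_Tp w.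
pose x2 w := p * (\1_Tm w * expR (2 * mu * X t w)).
have j1 : integ P (\1_Tp : T -> R) by apply: integ_indic; exact: measurable_Tp.
have j2 : integ P (fun w => \1_Tm w * expR (2 * mu * X t w)).
  by apply: integ_indicM; [exact: measurable_Tm|exact: lr_integ].
have i1 : integ P x1 by exact: integZ.
have i2 : integ P x2 by exact: integZ.
have mF := natF_measurable nF.
have cv1 E : measurable E -> Ex P (fun w => \1_E w * x1 w) = (1 - p) * Ex P \1_(E `&` Tp).
  move=> mE; rewrite -ExZ; last by apply: integ_indic; apply: measurableI => //; exact: measurable_Tp.
  by apply: eq_Ex => w; rewrite indicI /x1/=; ring.
have cv2 E : measurable E -> Ex P (fun w => \1_E w * x2 w) =
     p * Ex P (fun w => \1_(E `&` Tm) w * expR (2 * mu * X t w)).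
  move=> mE; rewrite -ExZ; last first.
    apply: integ_indicM; last exact: lr_integ.
    by apply: measurableI => //; exact: measurable_Tm.
  by apply: eq_Ex => w; rewrite indicI /x2/=; ring.
suff : natF X t `<=` [set F | measurable F /\
    Ex P (fun w => \1_F w * x1 w) = Ex P (fun w => \1_F w * x2 w)].
  move=> /(_ F nF)[_]; rewrite cv1// cv2// => h.
  rewrite (_ : (fun w => _ * \1_Tp w) = \1_(F `&` Tp)); last by apply/funext => w; rewrite indicI.
  rewrite h; congr (_ * _); apply: eq_Ex => w; by rewrite indicI/= mulrA.
have rct n ts As : ts 0%N = 0 -> (forall i, (i < n)%N -> ts i < ts i.+1) -> ts n = t ->
   (forall i, measurable (As i)) ->
   measurable (rect n As ts) /\
   Ex P (fun w => \1_(rect n As ts) w * x1 w) = Ex P (fun w => \1_(rect n As ts) w * x2 w).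
  move=> ts0 tsi tsn mA; have [_ pR e] := lr_rect ts0 mA tsi.
  have mR := pastB_measurable HB pR.
  by split => //; rewrite cv1// cv2// e tsn.
have E12 : Ex P x1 = Ex P x2.
  have [n [ts [ts0 tsn tsi _]]] := @grid_of_seq R t [::] t0 (fun s h => False_ind _ (notF h)).
  have [_] := rct n ts (fun=> setT) ts0 tsi tsn (fun=> measurableT).
  rewrite (_ : rect _ _ _ = setT); last by apply/seteqP; split.
  by under eq_Ex do rewrite indicT mul1r; under [X in _ = X -> _]eq_Ex do rewrite indicT mul1r.
(* With the constant 0 in place of theta, [past_dynkin] describes the past of the observation
   alone. *)
have := @past_dynkin R _ T X (cst 0) t _ t0 obs0 (dynkin_Ex i1 i2 E12).
move=> /(_ _) H; apply: subset_trans (H _).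
  apply: sub_sigma; apply: subset_trans (@sub_gen_smallest _ _ _).
  by move=> E [s [st [A mA ->]]]; right; exists s => //; exists A.
move=> n ts ts0 tsi tsn E [As [S [mAs mS ->]]].
have [S0|S0] := pselect (S 0).
  rewrite (_ : cst 0 @^-1` S = setT); last by apply/seteqP; split.
  by rewrite setTI; exact: rct.
rewrite (_ : cst 0 @^-1` S = set0); last by apply/seteqP; split.
rewrite set0I; split; first exact: measurable0.
by under eq_Ex do rewrite indic0 mul0r; under [RHS]eq_Ex do rewrite indic0 mul0r.
Qed.

End LikelihoodRatio.
End Observation.

(** * Bayes' formula and the martingale property of the posterior *)

Section Posterior.
Context {R : realType} {d : measure_display} {T : measurableType d}.
Variables (P : probability T R) (Bm : R -> T -> R) (theta : T -> R) (mu : R).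
Hypothesis HB : BM_indep P Bm theta.
Hypothesis Hth : forall w, theta w = 1 \/ theta w = -1.
Local Notation X := (obs Bm theta mu).
Local Notation p := (prior P theta).
Hypotheses (p0 : 0 < p) (p1 : p < 1).
Local Notation Tp := [set w | theta w = 1].
Local Notation Tm := [set w | theta w = -1].
Local Notation natG t := [set E | exists s, 0 <= s <= t /\
         exists2 A, measurable A & E = X s @^-1` A].
Local Notation natT t := (g_sigma_algebraType (natG t)).
Local Notation inc t u := (fun w => (Bm u w - Bm t w)%R).

Definition Mt : R -> T -> R := postM p mu X.
Definition den (t : R) (w : T) : R := p * expR (2 * mu * X t w) + 1 - p.
Definition Lam0 : R := ln (p / (1 - p)).
Definition Lam (t : R) (w : T) : R := Lam0 + 2 * mu * X t w.

Lemma LamE t w : Lam t w = Lam0 + 2 * mu * X t w. Proof. by []. Qed.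

Local Notation M := Mt.

Let mB t : measurable_fun setT (Bm t). Proof. by case: HB. Qed.
Let mth : measurable_fun setT theta. Proof. by case: HB. Qed.

Lemma den_gt t w : 1 - p < den t w.
Proof. by rewrite /den -addrA ltrDr mulr_gt0// expR_gt0. Qed.

Lemma den_gt0 t w : 0 < den t w.
Proof. by apply: lt_trans (den_gt t w); have := p1; lra. Qed.

Lemma MtE t w : M t w = 1 - 2 * ((1 - p) / den t w).
Proof. by rewrite /M /postM -mulrA. Qed.

Lemma Mt_start w : M 0 w = 2 * p - 1.
Proof.
rewrite MtE /den (obs0 _ HB) mulr0 expR0 mulr1 (_ : p + 1 - p = 1); last by ring.
by rewrite divr1; ring.
Qed.

Lemma Mt_bnd t w : -1 < M t w < 1.
Proof.
have h0 : 0 < (1 - p) / den t w by rewrite divr_gt0 ?den_gt0//; have := p1; lra.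
have h1 : (1 - p) / den t w < 1 by rewrite ltr_pdivrMr ?den_gt0// mul1r den_gt.
by rewrite MtE; apply/andP; split; lra.
Qed.

Lemma LL_Mt t w : LL (M t w) = - Lam t w.
Proof.
have d0 := den_gt0 t w; have dd := den_gt t w.
have e0 : 0 < p / (1 - p) by rewrite divr_gt0//; have := p1; lra.
have hE : 0 < expR (2 * mu * X t w) by exact: expR_gt0.
rewrite /Lam /Lam0 -[2 * mu * X t w]expRK -lnM; [|by rewrite posrE|by rewrite posrE].
rewrite -lnV; last by rewrite posrE mulr_gt0.
rewrite /LL; congr ln; rewrite MtE /den.
have h := p0; have h' := p1.
move: (expR _) hE => e he; move: (p) h h' => q q0 q1.
have qe : 0 < q * e by exact: mulr_gt0.
by field; apply/and4P; split; rewrite gt_eqF; lra.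
Qed.

Lemma measurable_obs_nat s t : 0 <= s <= t ->
  measurable_fun (setT : set (natT t)) (X s : natT t -> R).
Proof.
move=> st; apply/g_sigma_measurable_preimage => A mA.
by apply: sub_gen_smallest; exists s; split => //; exists A.
Qed.

Lemma measurable_den_nat t : 0 <= t -> measurable_fun (setT : set (natT t)) (den t : natT t -> R).
Proof.
move=> t0; apply: measurable_funB => //; apply: measurable_funD => //; apply: measurable_funM => //.
apply: measurableT_comp => //; apply: measurable_funM => //.
by apply: measurable_obs_nat; rewrite t0 lexx.
Qed.

Lemma measurable_Mt_nat s t : 0 <= s <= t -> measurable_fun (setT : set (natT t)) (M s : natT t -> R).
Proof.
move=> st; have -> : (M s : natT t -> R) = (fun w => 1 - 2 * ((1 - p) / den s w)).
  by apply/funext => w; rewrite MtE.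
apply: measurable_funB => //; apply: measurable_funM => //; apply: measurable_funM => //.
apply: (measurableT_comp (@measurable_invr R)); apply: measurable_funB => //.
apply: measurable_funD => //; apply: measurable_funM => //.
apply: measurableT_comp => //; apply: measurable_funM => //.
exact: measurable_obs_nat.
Qed.

Lemma nat_sub t : <<s natG t >> `<=` measurable.
Proof. exact: (natF_measurable HB (mu := mu) (t := t)). Qed.

Lemma nat_measurable t (f : T -> R) : measurable_fun (setT : set (natT t)) (f : natT t -> R) ->
  measurable_fun setT f.
Proof.
move=> mf _ A mA; rewrite setTI; apply: (natF_measurable HB (mu := mu) (t := t)).
exact: ((g_sigma_measurable_preimage _ f).2 mf A mA).
Qed.

Lemma measurable_Mt t : 0 <= t -> measurable_fun setT (M t).
Proof.
move=> t0; apply: (@nat_measurable t).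
by apply: measurable_Mt_nat; rewrite t0 lexx.
Qed.

(** Dividing by [den], write 1_F 1_Tm = Y (p exp (2 mu X) 1_Tm + (1 - p) 1_Tm) with Y = 1_F / den.
    The likelihood ratio turns the first term into (1 - p) 1_Tp in mean, and the sum becomes (1 - p)
    Y = 1_F (1 - M) / 2. *)
Let bayes_Tm t F : 0 <= t -> natF X t F ->
  Ex P (fun w => \1_F w * (1 - theta w)) = Ex P (fun w => \1_F w * (1 - M t w)).
Proof.
move=> t0 nF; have mF := natF_measurable HB nF.
have mp := measurable_Tp HB; have mm := measurable_Tm HB.
pose x1 w := (1 - p) * \1_Tp w.
pose x2 w := p * (\1_Tm w * expR (2 * mu * X t w)).
have x10 w : 0 <= x1 w.
  by apply: mulr_ge0; [have := p1; lra|rewrite indicE].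
have x20 w : 0 <= x2 w.
  by apply: mulr_ge0; [exact: ltW|apply: mulr_ge0; [rewrite indicE|exact: expR_ge0]].
have j1 : integ P (\1_Tp : T -> R) by exact: integ_indic.
have j2 : integ P (fun w => \1_Tm w * expR (2 * mu * X t w)).
  by apply: integ_indicM => //; exact: (lr_integ mu HB Hth (2 * mu) t0).
have i1 : integ P x1 by exact: integZ.
have i2 : integ P x2 by exact: integZ.
pose Y w := \1_F w / den t w.
have mYn : measurable_fun (setT : set (natT t)) (Y : natT t -> R).
  apply: measurable_funM; first exact: g_sigma_indic.
  by apply: (measurableT_comp (@measurable_invr R)); exact: measurable_den_nat.
have mY := nat_measurable mYn.
have Y0 w : 0 <= Y w by rewrite divr_ge0 ?(ltW (den_gt0 _ _))// indicE.
have Yb w : `|Y w| <= (1 - p)^-1.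
  rewrite ger0_norm// /Y; apply: le_trans (_ : (den t w)^-1 <= _).
    apply: ler_piMl; first by rewrite invr_ge0 ltW// den_gt0.
    by rewrite indicE; case: (w \in F).
  by rewrite lef_pV2 ?posrE ?den_gt0 ?subr_gt0// ltW// den_gt.
have iY : integ P Y by exact: integ_bounded mY Yb.
have iYx1 : integ P (fun w => Y w * x1 w).
  apply: (@integ_le _ _ _ _ _ (fun w => (1 - p)^-1 * x1 w)).
  - by apply: measurable_funM => //; exact: integ_meas i1.
  - by move=> w; rewrite normrM (ger0_norm (x10 w)); exact: ler_wpM2r.
  - exact: integZ.
have LR G : <<s natG t >> G -> Ex P (fun w => \1_G w * x1 w) = Ex P (fun w => \1_G w * x2 w).
  move=> nG; have mG := nat_sub nG.
  have := lr_natF HB Hth t0 nG; rewrite -!ExZ; [|exact: integ_indicM..].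
  move=> h; transitivity (Ex P (fun w => (1 - p) * (\1_G w * \1_Tp w))).
    by apply: eq_Ex => w; rewrite /x1; ring.
  by rewrite h; apply: eq_Ex => w; rewrite /x2; ring.
have [i3 e3] := transfer_sigma (@nat_sub t) i1 i2 x10 x20 LR mYn iYx1.
have sumI w : \1_Tp w + \1_Tm w = 1 :> R.
  by case: (Hth w) => h; [rewrite indic_in// indic_out ?addr0//|rewrite addrC indic_in// indic_out ?addr0//];
    rewrite /= h => e; [have : (1 : R) = -1 := e|have : (-1 : R) = 1 := e]; lra.
have eL : Ex P (fun w => \1_F w * (1 - theta w)) = 2 * Ex P (fun w => \1_F w * \1_Tm w).
  rewrite -ExZ; last exact/integ_indicM/integ_indic.
  apply: eq_Ex => w; rewrite (theta_pm Hth).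
  by have -> : \1_Tp w = 1 - \1_Tm w :> R; [have := sumI w; lra|ring].
rewrite eL.
have -> : Ex P (fun w => \1_F w * (1 - M t w)) = 2 * Ex P (fun w => (1 - p) * Y w).
  rewrite -ExZ; last exact: integZ.
  by apply: eq_Ex => w; rewrite MtE /Y; ring.
congr (2 * _).
have iYm : integ P (fun w => Y w * ((1 - p) * \1_Tm w)).
  rewrite (_ : (fun w => _) = (fun w => \1_Tm w * ((1 - p) * Y w))).
    by apply: integ_indicM => //; exact: integZ.
  by apply/funext => w; ring.
transitivity (Ex P (fun w => Y w * x2 w + Y w * ((1 - p) * \1_Tm w))).
  apply: eq_Ex => w; rewrite /Y /x2 -(mulrA (\1_F w)) -(mulrA (\1_F w)) -mulrDr; congr (_ * _).
  have e : den t w = p * expR (2 * mu * X t w) + 1 - p by [].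
  rewrite -mulrDr (_ : p * _ + _ = \1_Tm w * den t w); last by rewrite e; ring.
  by rewrite mulrCA mulVf ?mulr1// gt_eqF// den_gt0.
rewrite ExD// -e3 -ExD//; apply: eq_Ex => w.
by rewrite -mulrDr /x1 -mulrDr sumI mulr1 mulrC.
Qed.

Lemma bayes t (Y : T -> R) : 0 <= t ->
  measurable_fun (setT : set (natT t)) (Y : natT t -> R) -> integ P Y ->
  [/\ integ P (fun w => Y w * theta w), integ P (fun w => Y w * M t w) &
   Ex P (fun w => Y w * theta w) = Ex P (fun w => Y w * M t w)].
Proof.
move=> t0 mY iY.
have mM := measurable_Mt t0.
have mYT := integ_meas iY.
have i1 : integ P (fun w => Y w * theta w).
  apply: (@integ_le _ _ _ _ _ (fun w => `|Y w|)).
  - exact: measurable_funM.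
  - by move=> w; rewrite normrM; case: (Hth w) => ->; rewrite ?normrN normr1 mulr1.
  - exact: integrable_norm.
have i2 : integ P (fun w => Y w * M t w).
  apply: (@integ_le _ _ _ _ _ (fun w => `|Y w|)).
  - exact: measurable_funM.
  - move=> w; rewrite normrM ler_piMr// ler_norml.
    by have /andP[? ?] := Mt_bnd t w; apply/andP; split; exact: ltW.
  - exact: integrable_norm.
split => //.
(* [transfer_sigma] handles nonnegative densities, hence 1 - theta and 1 - M instead of theta and
   M. *)
have ith : integ P (fun w => 1 - theta w).
  apply: integB; first exact: integ_cst.
  apply: (@integ_bounded _ _ _ _ 1) => // w.
  by case: (Hth w) => ->; rewrite ?normrN normr1.
have iM : integ P (fun w => 1 - M t w).
  apply: integB; first exact: integ_cst.
  apply: (@integ_bounded _ _ _ _ 1) => // w; rewrite ler_norml.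
  by have /andP[? ?] := Mt_bnd t w; apply/andP; split; exact: ltW.
have [|||||_ e] := @transfer_sigma _ _ _ P (natG t) _ _ Y (@nat_sub t) ith iM.
- by move=> w; rewrite subr_ge0; case: (Hth w) => ->; lra.
- by move=> w; rewrite subr_ge0; have /andP[? ?] := Mt_bnd t w; exact: ltW.
- by move=> F nF; exact: bayes_Tm.
- exact: mY.
- by under [X in integ _ X]eq_fun do rewrite mulrBr mulr1; exact: integB.
move: e; under eq_Ex do rewrite mulrBr mulr1.
under [X in _ = X -> _]eq_Ex do rewrite mulrBr mulr1.
by rewrite !ExB// => h; lra.
Qed.

(** [Y] belongs to the past at both times, so its products with M s and M t both have the mean of Y
    theta. *)
Lemma Mt_martingale t s (Y : T -> R) : 0 <= t -> t <= s ->
  measurable_fun (setT : set (natT t)) (Y : natT t -> R) -> integ P Y ->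
  integ P (fun w => Y w * (M s w - M t w)) /\ Ex P (fun w => Y w * (M s w - M t w)) = 0.
Proof.
move=> t0 ts mY iY; have s0 : 0 <= s by exact: le_trans ts.
have mYs : measurable_fun (setT : set (natT s)) (Y : natT s -> R).
  apply/g_sigma_measurable_preimage => A mA.
  have := (g_sigma_measurable_preimage _ Y).2 mY A mA.
  apply: sub_sigma; apply: subset_trans (@sub_gen_smallest _ _ _).
  by move=> E [r [/andP[r0 rt] h]]; exists r; rewrite r0 (le_trans rt).
have [_ i1 e1] := bayes t0 mY iY; have [_ i2 e2] := bayes s0 mYs iY.
under [X in integ _ X]eq_fun do rewrite mulrBr.
under [X in Ex _ X]eq_fun do rewrite mulrBr.
by split; [exact: integB|rewrite ExB// -e1 -e2 subrr].
Qed.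

Let incr0 t s F : 0 <= t -> t < s -> pastB Bm theta t F -> Ex P (fun w => \1_F w * inc t s w) = 0.
Proof.
move=> t0 ts pF; have ts0 : 0 < s - t by rewrite subr_gt0.
have [i e] := gauss_mean ts0 (measurable_funB (mB s) (mB t)) (bm_law HB t0 ts).
rewrite (pastB_incr_Ex HB t0 ts pF (f := id))//.
by rewrite [X in _ * X]e mulr0.
Qed.

Lemma inc_integ t s : 0 <= t -> t < s -> integ P (inc t s).
Proof.
move=> t0 ts; have ts0 : 0 < s - t by rewrite subr_gt0.
by have [] := gauss_mean ts0 (measurable_funB (mB s) (mB t)) (bm_law HB t0 ts).
Qed.

Lemma incr_natF t s F : 0 <= t -> t < s -> natF X t F ->
  [/\ Ex P (fun w => \1_F w * inc t s w) = 0,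
   integ P (fun w => \1_F w * (theta w * inc t s w)) &
   Ex P (fun w => \1_F w * (theta w * inc t s w)) = 0].
Proof.
move=> t0 ts nF; have pF := natF_pastB nF; have ii := inc_integ t0 ts.
have mF := natF_measurable HB nF.
have mp := measurable_Tp HB; have mm := measurable_Tm HB.
have E : (fun w => \1_F w * (theta w * inc t s w)) =
  (fun w => \1_(F `&` Tp) w * inc t s w - \1_(F `&` Tm) w * inc t s w).
  by apply/funext => w; rewrite (theta_pm Hth) !indicI/=; ring.
have ip : integ P (fun w => \1_(F `&` Tp) w * inc t s w).
  by apply: integ_indicM => //; exact: measurableI.
have im : integ P (fun w => \1_(F `&` Tm) w * inc t s w).
  by apply: integ_indicM => //; exact: measurableI.
split.
- exact: incr0.
- by rewrite E; exact: integB.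
- rewrite E ExB// !incr0//; first lra.
    by apply: pastBI => //; exact: pastB_Tm.
  by apply: pastBI => //; exact: pastB_Tp.
Qed.

Lemma Lam_integ t : 0 <= t -> integ P (Lam t).
Proof.
move=> t0; apply: integD; first exact: integ_cst.
by apply: integZ; exact: (obs_integ mu HB Hth t0).
Qed.

End Posterior.

(** * One-step inequalities *)

Section Steps.
Context {R : realType} {d : measure_display} {T : measurableType d}.
Variables (P : probability T R) (Bm : R -> T -> R) (theta : T -> R) (mu : R).
Variables (k ke c2 B A : R).
Hypothesis HB : BM_indep P Bm theta.
Hypothesis Hth : forall w, theta w = 1 \/ theta w = -1.
Local Notation X := (obs Bm theta mu).
Local Notation p := (prior P theta).
Hypotheses (p0 : 0 < p) (p1 : p < 1).
Hypothesis ok : params_ok k ke c2 B A.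
Local Notation natG t := [set E | exists s, 0 <= s <= t /\
         exists2 A, measurable A & E = X s @^-1` A].
Local Notation natT t := (g_sigma_algebraType (natG t)).
Local Notation inc t u := (fun w => (Bm u w - Bm t w)%R).
Local Notation M := (Mt P Bm theta mu).
Local Notation Lam := (Lam P Bm theta mu).
Local Notation vf := (vf k B).
Local Notation uf := (uf k ke B A).
Local Notation Vf := (Vf k c2 B).
Local Notation Uf := (Uf k ke B A).
Local Notation aa := (aa k B).
Local Notation vt := (vt k B).
Local Notation ut := (ut k ke B A).

Let mB t : measurable_fun setT (Bm t). Proof. by case: HB. Qed.
Let mth : measurable_fun setT theta. Proof. by case: HB. Qed.
Let bnd t w := Mt_bnd Bm mu p0 p1 t w.

Lemma natF_mono t s : t <= s -> natF X t `<=` natF X s.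
Proof.
move=> ts; apply: sub_sigma; apply: subset_trans (@sub_gen_smallest _ _ _).
by move=> E [r [/andP[r0 rt] h]]; exists r; rewrite r0 (le_trans rt).
Qed.

Lemma natF_meas t : natF X t `<=` measurable.
Proof. exact: (natF_measurable HB (mu := mu) (t := t)). Qed.

Let nat_fun_integ t F (f : T -> R) : natF X t F ->
  measurable_fun (setT : set (natT t)) (f : natT t -> R) -> integ P f ->
  measurable_fun (setT : set (natT t)) ((fun w => \1_F w * f w) : natT t -> R) /\
  integ P (fun w => \1_F w * f w).
Proof.
move=> nF mf iF; split; first by apply: measurable_funM => //; exact: g_sigma_indic.
by apply: integ_indicM => //; exact: natF_meas nF.
Qed.

Let Lam_nat t : 0 <= t -> measurable_fun (setT : set (natT t)) (Lam t : natT t -> R).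
Proof.
move=> t0; apply: measurable_funD => //; apply: measurable_funM => //.
by apply: measurable_obs_nat; rewrite t0 lexx.
Qed.

Let sgn2 (e : R) : e = 1 \/ e = -1 -> e * e = 1.
Proof. by case=> ->; lra. Qed.

Lemma Lam_incr t s w : Lam s w - Lam t w = 2 * mu * (mu * theta w * (s - t) + inc t s w).
Proof. by rewrite !LamE /obs; ring. Qed.

Lemma vf_Mt e t w : e = 1 \/ e = -1 -> vf (e * M t w) = (1 - e * M t w) * (aa + k * e * Lam t w).
Proof.
have := bnd t w => b [->|->]; rewrite !vfE ?mul1r ?mulN1r ?LLN// (LL_Mt Bm mu p0 p1)//; ring.
Qed.

(** [vf] at the posterior is a factor affine in M times an affine function of the log-odds. [bayes]
    replaces M by theta, after which only the explicit process [Lam] moves with time. *)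
Let vf_Ex e t F : e = 1 \/ e = -1 -> 0 <= t -> natF X t F ->
  [/\ integ P (fun w => \1_F w * vf (e * M t w)),
  integ P (fun w => \1_F w * (aa + k * e * Lam t w) * (1 - e * theta w)) &
  Ex P (fun w => \1_F w * vf (e * M t w)) =
  Ex P (fun w => \1_F w * (aa + k * e * Lam t w) * (1 - e * theta w))].
Proof.
move=> he t0 nF; pose Y w := \1_F w * (aa + k * e * Lam t w).
have iL : integ P (Lam t) by exact: (Lam_integ mu HB Hth).
have [mY iY] : measurable_fun (setT : set (natT t)) (Y : natT t -> R) /\ integ P Y.
  apply: nat_fun_integ => //.
    by apply: measurable_funD => //; apply: measurable_funM => //; exact: Lam_nat.
  by apply: integD; [exact: integ_cst|exact: integZ].
have [i1 i2 E] := bayes HB Hth p0 p1 t0 mY iY.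
have E1 : (fun w => \1_F w * vf (e * M t w)) = (fun w => Y w - e * (Y w * M t w)).
  by apply/funext => w; rewrite vf_Mt// /Y; ring.
have E2 : (fun w => \1_F w * (aa + k * e * Lam t w) * (1 - e * theta w)) =
   (fun w => Y w - e * (Y w * theta w)).
  by apply/funext => w; rewrite /Y; ring.
rewrite E1 E2; split; [by apply: integB => //; exact: integZ..|].
by rewrite !ExB ?ExZ ?E//; exact: integZ.
Qed.

Lemma theta_integ (e : R) F : measurable F -> integ P (fun w => \1_F w * (1 - e * theta w)).
Proof.
move=> mF; apply: integ_indicM => //; apply: (@integ_bounded _ _ _ _ (1 + `|e|)).
  by apply: measurable_funB => //; exact: measurable_funM.
move=> w; apply: le_trans (ler_normB _ _) _; rewrite normr1 lerD2l normrM.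
by case: (Hth w) => ->; rewrite ?normrN normr1 mulr1.
Qed.

(** The weight 1 - e theta charges only a wrong decision e, for which e Lam has drift - 2 mu^2; the
    Brownian part has mean 0 by [incr_natF]. *)
Lemma vf_step e t s F : e = 1 \/ e = -1 -> 0 <= t -> t < s -> natF X t F ->
  [/\ integ P (fun w => \1_F w * vf (e * M t w)), integ P (fun w => \1_F w * vf (e * M s w)) &
  Ex P (fun w => \1_F w * vf (e * M s w)) =
  Ex P (fun w => \1_F w * vf (e * M t w))
   - 2 * k * mu ^+ 2 * (s - t) * Ex P (fun w => \1_F w * (1 - e * theta w))].
Proof.
move=> he t0 ts nF; have s0 : 0 <= s by rewrite (le_trans t0)// ltW.
have mF := natF_meas nF.
have [i1 j1 e1] := vf_Ex he t0 nF; have [i2 j2 e2] := vf_Ex he s0 (natF_mono (ltW ts) nF).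
split => //; rewrite e1 e2.
have [z1 i3 z2] := incr_natF HB Hth t0 ts nF.
have i4 : integ P (fun w => \1_F w * inc t s w).
  by apply: integ_indicM => //; exact: (inc_integ HB).
have i5 := theta_integ e mF.
set a := Ex P (fun w => \1_F w * (1 - e * theta w)).
have -> : (fun w => \1_F w * (aa + k * e * Lam s w) * (1 - e * theta w)) =
  (fun w => \1_F w * (aa + k * e * Lam t w) * (1 - e * theta w)
     - 2 * k * mu ^+ 2 * (s - t) * (\1_F w * (1 - e * theta w))
     + (2 * k * mu * e * (\1_F w * inc t s w) - 2 * k * mu * (\1_F w * (theta w * inc t s w)))).
  apply/funext => w; rewrite -[Lam s w](subrKC (Lam t w)).
  rewrite Lam_incr; have h1 := sgn2 he; have h2 := sgn2 (Hth w).
  move: (\1_F w) (Lam t w) (theta w) (Bm s w - Bm t w) h2 => f l th D h2.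
  have h3 : e * e * th = th by rewrite h1 mul1r.
  have h4 : e * e * (th * th) = 1 by rewrite h1 h2 mulr1.
  transitivity (f * (aa + k * e * l) * (1 - e * th) +
     f * k * 2 * mu ^+ 2 * (s - t) * (e * th - e * e * (th * th)) +
     f * k * 2 * mu * D * (e - e * e * th)); first by ring.
  by rewrite h3 h4; ring.
rewrite ExD; [|by apply: integB => //; exact: integZ|by apply: integB; exact: integZ].
rewrite [X in _ + X]ExB; [|exact: integZ..].
rewrite ExB//; last exact: integZ.
by rewrite !ExZ// z1 z2 !mulr0 subrr addr0.
Qed.

Let uf_Mt t w : uf (M t w) = Cu k ke B A - ke * (M t w * Lam t w).
Proof. by rewrite !ufE (LL_Mt Bm mu p0 p1)//; ring. Qed.

Let uf_Ex t F : 0 <= t -> natF X t F ->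
  [/\ integ P (fun w => \1_F w * uf (M t w)),
  integ P (fun w => \1_F w * Lam t w * theta w) &
  Ex P (fun w => \1_F w * uf (M t w)) =
  Cu k ke B A * Ex P \1_F - ke * Ex P (fun w => \1_F w * Lam t w * theta w)].
Proof.
move=> t0 nF; pose Y w := \1_F w * Lam t w.
have iL : integ P (Lam t) by exact: (Lam_integ mu HB Hth).
have [mY iY] : measurable_fun (setT : set (natT t)) (Y : natT t -> R) /\ integ P Y.
  by apply: nat_fun_integ => //; exact: Lam_nat.
have [i1 i2 E] := bayes HB Hth p0 p1 t0 mY iY.
have iF : integ P \1_F by apply: integ_indic; exact: natF_meas nF.
have E1 : (fun w => \1_F w * uf (M t w)) = (fun w => Cu k ke B A * \1_F w - ke * (Y w * M t w)).
  by apply/funext => w; rewrite uf_Mt// /Y; ring.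
rewrite E1; split => //; first by apply: integB; exact: integZ.
by rewrite !ExB ?ExZ -?E//; exact: integZ.
Qed.

(** theta Lam has drift 2 mu^2 for either value of theta. *)
Lemma uf_step t s F : 0 <= t -> t < s -> natF X t F ->
  [/\ integ P (fun w => \1_F w * uf (M t w)), integ P (fun w => \1_F w * uf (M s w)) &
  Ex P (fun w => \1_F w * uf (M s w)) =
  Ex P (fun w => \1_F w * uf (M t w)) - 2 * ke * mu ^+ 2 * (s - t) * Ex P \1_F].
Proof.
move=> t0 ts nF; have s0 : 0 <= s by rewrite (le_trans t0)// ltW.
have mF := natF_meas nF.
have [i1 j1 e1] := uf_Ex t0 nF; have [i2 j2 e2] := uf_Ex s0 (natF_mono (ltW ts) nF).
split => //; rewrite e1 e2.
have [z1 i3 z2] := incr_natF HB Hth t0 ts nF.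
have iF : integ P \1_F by exact: integ_indic.
have -> : (fun w => \1_F w * Lam s w * theta w) =
  (fun w => \1_F w * Lam t w * theta w + (2 * mu ^+ 2 * (s - t) * \1_F w +
     2 * mu * (\1_F w * (theta w * inc t s w)))).
  apply/funext => w; rewrite -[Lam s w](subrKC (Lam t w)).
  rewrite Lam_incr; have h2 := sgn2 (Hth w).
  move: (\1_F w) (Lam t w) (theta w) (Bm s w - Bm t w) h2 => f l th D h2.
  transitivity (f * l * th + 2 * mu ^+ 2 * (s - t) * f * (th * th) + 2 * mu * f * (th * D)); first by ring.
  by rewrite h2; ring.
rewrite ExD//; last by apply: integD; exact: integZ.
rewrite ExD; [|exact: integZ..].
rewrite !ExZ// z2; ring.
Qed.

Let trunc_cvg F (Z h : T -> R) : measurable F -> measurable_fun setT Z -> integ P h ->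
  Ex P (fun w => \1_(F `&` [set w | `|Z w| <= m%:R]) w * h w) @[m --> \oo] -->
  Ex P (fun w => \1_F w * h w).
Proof.
move=> mF mZ ih.
have mG m : measurable (F `&` [set w | `|Z w| <= m%:R]).
  apply: measurableI => //.
  have mnZ : measurable_fun setT (fun w => `|Z w|) by exact: measurableT_comp.
  have := mnZ measurableT `]-oo, m%:R]%classic.
  rewrite setTI (_ : _ @^-1` _ = [set w | `|Z w| <= m%:R]); last first.
    by apply/seteqP; split => w /=; rewrite in_itv.
  by apply.
have [||||_ //] := @Ex_cvg _ _ _ P (fun m w => \1_(F `&` [set w | `|Z w| <= m%:R]) w * h w)
  (fun w => \1_F w * h w) (fun w => `|h w|).
- by move=> m; apply: integ_meas; exact: (integ_indicM (mG m) ih).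
- exact: integrable_norm.
- by move=> n w; rewrite normrM indicE; case: (_ \in _); rewrite ?normr1 ?mul1r// normr0 mul0r.
- move=> w; apply: cvgM; last exact: cvg_cst.
  apply: cvg_near_cst; near=> m; rewrite indicI/=.
  rewrite [X in _ * X]indic_in ?mulr1//=.
  near: m; exact: nbhs_infty_ger.
Unshelve. all: by end_near. Qed.

Let comp_integ (f : R -> R) (K e t : R) : measurable_fun setT f -> e = 1 \/ e = -1 -> 0 <= t ->
  (forall x, -1 < x < 1 -> `|f x| <= K) -> integ P (fun w => f (e * M t w)).
Proof.
move=> mf he t0 fK; apply: (@integ_bounded _ _ _ _ K).
  apply: (measurableT_comp mf); apply: measurable_funM => //.
  exact: (measurable_Mt mu HB).
move=> w; apply: fK; have /andP[? ?] := bnd t w.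
by case: he => ->; rewrite ?mul1r ?mulN1r; apply/andP; split; lra.
Qed.

Lemma sgn_bnd e t w : e = 1 \/ e = -1 -> -1 < e * M t w < 1.
Proof.
by have /andP[? ?] := bnd t w; case=> ->; rewrite ?mul1r ?mulN1r; apply/andP; split; lra.
Qed.

(** [g] is the explicit part of [f], with known drift, and [sl] a slope of the convex remainder. As
    [sl] is unbounded, the martingale property of M is used on the events where it is at most m in
    modulus, and m then tends to infinity. *)
Let tangent_step (f g sl : R -> R) (K C e t s : R) (ka : T -> R) :
  e = 1 \/ e = -1 -> 0 <= t -> t < s ->
  measurable_fun setT f -> (forall x, -1 < x < 1 -> `|f x| <= K) -> measurable_fun setT sl ->
  (forall x y, -1 < x < 1 -> -1 < y < 1 -> g y - g x + sl x * (y - x) <= f y - f x) ->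
  integ P ka ->
  (forall F, natF X t F -> [/\ integ P (fun w => \1_F w * g (e * M t w)),
    integ P (fun w => \1_F w * g (e * M s w)) &
    Ex P (fun w => \1_F w * g (e * M s w)) = Ex P (fun w => \1_F w * g (e * M t w))
     - C * Ex P (fun w => \1_F w * ka w)]) ->
  forall F, natF X t F ->
  - C * Ex P (fun w => \1_F w * ka w) <= Ex P (fun w => \1_F w * (f (e * M s w) - f (e * M t w))).
Proof.
move=> he t0 ts mf fK msl tg ika gE F nF.
have s0 : 0 <= s by rewrite (le_trans t0)// ltW.
have mF := natF_meas nF.
pose h w := f (e * M s w) - f (e * M t w).
have ih : integ P h by apply: integB; exact: comp_integ fK.
pose Z w := sl (e * M t w).
have mZn : measurable_fun (setT : set (natT t)) (Z : natT t -> R).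
  apply: (measurableT_comp msl); apply: measurable_funM => //.
  by apply: measurable_Mt_nat => //; rewrite t0 lexx.
have mZ := nat_measurable HB mZn.
pose G m := F `&` [set w | `|Z w| <= m%:R].
have nG m : natF X t (G m).
  have m1 : measurable_fun (setT : set (natT t)) ((fun w => `|Z w|) : natT t -> R).
    exact: measurableT_comp.
  have := m1 measurableT `]-oo, m%:R]%classic.
  rewrite setTI (_ : _ @^-1` _ = [set w | `|Z w| <= m%:R]); last first.
    by apply/seteqP; split => w /=; rewrite in_itv.
  by move=> /(_ _) H; apply: (@measurableI _ (natT t)) => //; exact: H.
have ineq m : - C * Ex P (fun w => \1_(G m) w * ka w) <= Ex P (fun w => \1_(G m) w * h w).
  have mG := natF_meas (nG m).
  have [i1 i2 E] := gE _ (nG m).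
  have mY : measurable_fun (setT : set (natT t)) ((fun w => \1_(G m) w * Z w * e) : natT t -> R).
    by apply: measurable_funM => //; apply: measurable_funM => //; exact: (g_sigma_indic (nG m)).
  have iY : integ P (fun w => \1_(G m) w * Z w * e).
    apply: (@integ_bounded _ _ _ _ (m%:R * `|e|)); first exact: (nat_measurable HB mY).
    move=> w; rewrite normrM ler_wpM2r// normrM; have [Gw|Gw] := pselect (G m w).
      by rewrite indic_in// normr1 mul1r; case: Gw.
    by rewrite indic_out// normr0 mul0r.
  have [i3 E3] := Mt_martingale HB Hth p0 p1 t0 (ltW ts) mY iY.
  apply: (@le_trans _ _ (Ex P (fun w => \1_(G m) w * g (e * M s w) - \1_(G m) w * g (e * M t w)
      + \1_(G m) w * Z w * e * (M s w - M t w)))).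
    rewrite ExD ?E3 ?ExB ?E//; last exact: integB.
    by rewrite addr0 addrAC subrr sub0r mulNr.
  apply: Ex_le; first by apply: integD => //; exact: integB.
    exact: integ_indicM.
  move=> w; rewrite -mulrBr -!mulrA -mulrDr; apply: ler_wpM2l; first by rewrite indicE.
  by rewrite (_ : Z w * _ = Z w * (e * M s w - e * M t w)); [apply: tg; exact: sgn_bnd|ring].
have l1 := trunc_cvg mF mZ ih; have l2 := trunc_cvg mF mZ ika.
apply: (ler_cvg_to (cvgM (cvg_cst (- C)) l2) l1); exact: nearW.
Qed.

Lemma V_step e t s F : e = 1 \/ e = -1 -> 0 <= t -> t < s -> natF X t F ->
  - (2 * k * mu ^+ 2 * (s - t)) * Ex P (fun w => \1_F w * (1 - e * theta w)) <=
  Ex P (fun w => \1_F w * (Vf (e * M s w) - Vf (e * M t w))).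
Proof.
move=> he t0 ts nF; have [K K0 HK] := Vf_bounded ok.
apply: (@tangent_step Vf vf (Vslope k B) K) => //.
- exact: (measurable_Vf k c2 B).
- by move=> x hx; rewrite ger0_norm ?HK//; exact: (Vf_ge0 ok).
- exact: (measurable_Vslope k B).
- by move=> x y hx hy; exact: (Vf_tangent ok).
- have := theta_integ e measurableT; congr (integ P _).
  by apply/funext => w; rewrite indicT mul1r.
- by move=> G nG; exact: vf_step.
Qed.

Lemma U_step t s F : 0 <= t -> t < s -> natF X t F ->
  - (2 * ke * mu ^+ 2 * (s - t)) * Ex P \1_F <=
  Ex P (fun w => \1_F w * (Uf (M s w) - Uf (M t w))).
Proof.
move=> t0 ts nF; have [K K0 HK] := Vf_bounded ok.
have := @tangent_step Uf uf (Uslope k ke B A) K (2 * ke * mu ^+ 2 * (s - t)) 1 t s (cst 1) (or_introl erefl) t0 ts.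
move=> H; have {}H : - (2 * ke * mu ^+ 2 * (s - t)) * Ex P (fun w => \1_F w * cst 1 w) <=
  Ex P (fun w => \1_F w * (Uf (1 * M s w) - Uf (1 * M t w))).
  apply: H => //.
  - exact: (measurable_Uf k ke B A).
  - move=> x hx; rewrite ger0_norm; last exact: (Uf_ge0 ok).
    by apply: le_trans (HK x hx); exact: (Uf_le_Vf ok).
  - exact: (measurable_Uslope k ke B A).
  - by move=> x y hx hy; exact: (Uf_tangent ok).
  - exact: integ_cst.
  - move=> G nG; have [i1 i2 E] := uf_step t0 ts nG.
    have E1 r : (fun w => \1_G w * uf (1 * M r w)) = (fun w => \1_G w * uf (M r w)).
      by apply/funext => w; rewrite mul1r.
    rewrite !E1; split => //; rewrite E; congr (_ - _ * _); apply: eq_Ex => w.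
    by rewrite mulr1.
move: H; rewrite (_ : (fun w => \1_F w * cst 1 w) = \1_F); last by apply/funext => w; rewrite mulr1.
by under [X in _ <= X -> _]eq_Ex do rewrite !mul1r.
Qed.

(** (x + y)^4 <= 8 (x^4 + y^4) separates drift and noise; the drift contributes h^4, at most h^2
    because h <= 1. *)
Lemma Lam_quartic : exists2 K, 0 <= K & forall t s F, 0 <= t -> t < s -> s <= t + 1 -> measurable F ->
  integ P (fun w => \1_F w * (Lam s w - Lam t w) ^+ 4) /\
  Ex P (fun w => \1_F w * (Lam s w - Lam t w) ^+ 4) <= K * (s - t) ^+ 2.
Proof.
pose K0 := 48 * expR (2^-1) : R.
have K00 : 0 <= K0 by rewrite mulr_ge0 ?expR_ge0.
exists (128 * mu ^+ 4 * (mu ^+ 4 + K0)).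
  have m4 : 0 <= mu ^+ 4 by rewrite exprn_even_ge0.
  by apply: mulr_ge0; [exact: mulr_ge0|exact: addr_ge0].
move=> t s F t0 ts st mF; have ts0 : 0 < s - t by rewrite subr_gt0.
have [i4 e4] := gauss_quartic ts0 (measurable_funB (mB s) (mB t)) (bm_law HB t0 ts).
have b w : `|\1_F w * (Lam s w - Lam t w) ^+ 4| <=
   128 * mu ^+ 4 * (mu ^+ 4 * (s - t) ^+ 2 + (Bm s w - Bm t w) ^+ 4).
  rewrite normrM (ger0_norm (_ : 0 <= \1_F w)); last by rewrite indicE.
  rewrite ger0_norm; last by rewrite exprn_even_ge0.
  apply: le_trans (_ : (Lam s w - Lam t w) ^+ 4 <= _).
    by apply: ler_piMl; [rewrite exprn_even_ge0|rewrite indicE; case: (w \in F)].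
  rewrite Lam_incr exprMn; set D := Bm s w - Bm t w; set h := s - t in ts0 *.
  have h1 : h <= 1 by rewrite /h; lra.
  have hq : h ^+ 4 <= h ^+ 2 by apply: ler_wiXn2l => //; exact: ltW.
  have q4 (x y : R) : (x + y) ^+ 4 <= 8 * (x ^+ 4 + y ^+ 4).
    have -> : 8 * (x ^+ 4 + y ^+ 4) = (x + y) ^+ 4 + ((x - y) ^+ 2 * ((x + y) ^+ 2 * 5 + (x ^+ 2 + y ^+ 2) * 2)
       ) by ring.
    by rewrite lerDl mulr_ge0 ?sqr_ge0// addr_ge0// mulr_ge0 ?addr_ge0 ?sqr_ge0.
  have : (mu * theta w * h + D) ^+ 4 <= 8 * (mu ^+ 4 * h ^+ 2 + D ^+ 4).
    apply: le_trans (q4 _ _) _; rewrite ler_pM2l// lerD2r !exprMn.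
    rewrite (_ : theta w ^+ 4 = 1); last by case: (Hth w) => ->; ring.
    by rewrite mulr1 ler_wpM2l// exprn_even_ge0.
  move=> hh; have m4 : 0 <= (2 * mu) ^+ 4 by rewrite exprn_even_ge0.
  have := ler_wpM2l m4 hh; move/le_trans; apply.
  by rewrite le_eqVlt; apply/orP; left; apply/eqP; ring.
have ib : integ P (fun w => 128 * mu ^+ 4 * (mu ^+ 4 * (s - t) ^+ 2 + (Bm s w - Bm t w) ^+ 4)).
  by apply: integZ; apply: integD => //; exact: integ_cst.
have mL r : 0 <= r -> measurable_fun setT (Lam r).
  by move=> r0; apply: integ_meas; exact: (Lam_integ mu HB Hth).
have s0 : 0 <= s by rewrite (le_trans t0)// ltW.
have iF : integ P (fun w => \1_F w * (Lam s w - Lam t w) ^+ 4).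
  apply: integ_le b ib; apply: measurable_funM; first exact: measurable_indic.
  by apply: measurable_funX; apply: measurable_funB; exact: mL.
split => //.
apply: le_trans (_ : Ex P (fun w => 128 * mu ^+ 4 * (mu ^+ 4 * (s - t) ^+ 2 + (Bm s w - Bm t w) ^+ 4)) <= _).
  by apply: Ex_le => // w; apply: le_trans (b w); exact: ler_norm.
rewrite ExZ; last by apply: integD => //; exact: integ_cst.
rewrite ExD//; last exact: integ_cst.
rewrite Ex_cst -[leRHS]mulrA; apply: ler_wpM2l.
  by rewrite mulr_ge0// exprn_even_ge0.
by rewrite mulrDl lerD2l.
Qed.

Let sub_shift (a b c q : R) : a - b <= q -> a - c <= b - c + q.
Proof. by move=> ?; lra. Qed.

(** At time t the truncation is inactive and [vf_step] is exact; at time s it costs [vt_err], whose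
    mean [Lam_quartic] controls. *)
Lemma vt_step : exists2 K, 0 <= K & forall e t s F, e = 1 \/ e = -1 -> 0 <= t -> t < s ->
  s <= t + 1 -> natF X t F -> (forall w, F w -> - B <= e * M t w) ->
  Ex P (fun w => \1_F w * (vt (e * M s w) - vt (e * M t w))) <=
  - (2 * k * mu ^+ 2 * (s - t)) * Ex P (fun w => \1_F w * (1 - e * theta w)) + K * (s - t) ^+ 2.
Proof.
have [K1 K10 H1] := Lam_quartic; have [K2 K20 H2] := vt_err ok; have [K3 H3] := vt_bounded ok.
exists (K2 * K1); first exact: mulr_ge0.
move=> e t s F he t0 ts st nF FB; have mF := natF_meas nF.
have s0 : 0 <= s by rewrite (le_trans t0)// ltW.
have [i4 e4] := H1 t s F t0 ts st mF.
have [i1 i2 E] := vf_step he t0 ts nF.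
have iv r : 0 <= r -> integ P (fun w => vt (e * M r w)).
  by move=> r0; apply: comp_integ H3 => //; exact: (measurable_vt k B).
apply: le_trans (_ : Ex P (fun w => (\1_F w * vf (e * M s w) - \1_F w * vf (e * M t w)) +
    K2 * (\1_F w * (Lam s w - Lam t w) ^+ 4)) <= _).
  apply: Ex_le.
  - by apply: integ_indicM => //; apply: integB; exact: iv.
  - by apply: integD; [exact: integB|exact: integZ].
  move=> w; have [Fw|Fw] := pselect (F w); last by rewrite indic_out// !mul0r mulr0 subrr addr0.
  rewrite indic_in// !mul1r.
  have b1 := sgn_bnd t w he; have b2 := sgn_bnd s w he.
  have Bw := FB w Fw.
  have := H2 _ _ b1 b2 Bw.
  have LLe r : LL (e * M r w) = - (e * Lam r w).
    have b := bnd r w; case: he => ->; first by rewrite !mul1r (LL_Mt Bm mu p0 p1).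
    by rewrite !mulN1r (LLN b) (LL_Mt Bm mu p0 p1).
  rewrite !LLe (_ : (_ - _) ^+ 4 = (Lam s w - Lam t w) ^+ 4); last first.
    by case: he => ->; ring.
  have := vt_vf ok Bw _; have /andP[_ b12] := b1 => /(_ b12) ->.
  exact: sub_shift.
rewrite ExD; [|exact: integB|exact: integZ].
rewrite ExB// E ExZ//.
have : K2 * Ex P (fun w => \1_F w * (Lam s w - Lam t w) ^+ 4) <= K2 * (K1 * (s - t) ^+ 2).
  exact: ler_wpM2l.
rewrite mulrA => hh; rewrite [X in X + _]addrAC subrr sub0r -mulNr lerD2l//.
Qed.

Lemma ut_step : exists2 K, 0 <= K & forall t s F, 0 <= t -> t < s ->
  s <= t + 1 -> natF X t F -> (forall w, F w -> `|M t w| <= A) ->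
  Ex P (fun w => \1_F w * (ut (M s w) - ut (M t w))) <=
  - (2 * ke * mu ^+ 2 * (s - t)) * Ex P \1_F + K * (s - t) ^+ 2.
Proof.
have [K1 K10 H1] := Lam_quartic; have [K2 K20 H2] := ut_err ok; have [K3 H3] := ut_bounded ok.
exists (K2 * K1); first exact: mulr_ge0.
move=> t s F t0 ts st nF FB; have mF := natF_meas nF.
have s0 : 0 <= s by rewrite (le_trans t0)// ltW.
have [i4 e4] := H1 t s F t0 ts st mF.
have [i1 i2 E] := uf_step t0 ts nF.
have iv r : 0 <= r -> integ P (fun w => ut (M r w)).
  move=> r0; have := @comp_integ ut K3 1 r (measurable_ut k ke B A) (or_introl erefl) r0 H3.
  by under [X in integ _ X -> _]eq_fun do rewrite mul1r.
apply: le_trans (_ : Ex P (fun w => (\1_F w * uf (M s w) - \1_F w * uf (M t w)) +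
    K2 * (\1_F w * (Lam s w - Lam t w) ^+ 4)) <= _).
  apply: Ex_le.
  - by apply: integ_indicM => //; apply: integB; exact: iv.
  - by apply: integD; [exact: integB|exact: integZ].
  move=> w; have [Fw|Fw] := pselect (F w); last by rewrite indic_out// !mul0r mulr0 subrr addr0.
  rewrite indic_in// !mul1r.
  have := H2 _ _ (bnd t w) (bnd s w) (FB w Fw).
  rewrite !(LL_Mt Bm mu p0 p1) (_ : (_ - _) ^+ 4 = (Lam s w - Lam t w) ^+ 4); last by ring.
  rewrite (ut_uf ok (FB w Fw)).
  exact: sub_shift.
rewrite ExD; [|exact: integB|exact: integZ].
rewrite ExB// E ExZ//.
have : K2 * Ex P (fun w => \1_F w * (Lam s w - Lam t w) ^+ 4) <= K2 * (K1 * (s - t) ^+ 2).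
  exact: ler_wpM2l.
rewrite mulrA => hh; rewrite [X in X + _]addrAC subrr sub0r -mulNr lerD2l//.
Qed.

End Steps.

(** * The lower bound on a time grid *)

Section Complete.
Context {R : realType} {d : measure_display} {T : measurableType d}.
Variable P : probability T R.
Hypothesis cP : complete_prob P.

Lemma Pnull_measurable N E : Pnull P N -> E `<=` N -> measurable E.
Proof. by move=> [mN N0]; exact: (cP mN N0). Qed.

Lemma completeF_measurable (G : set (set T)) F : G `<=` measurable -> completeF P G F -> measurable F.
Proof.
move=> GM [H GH [N nN FN]].
have m1 : measurable (F `\` H) by apply: (Pnull_measurable nN) => w h; apply: FN; left.
have m2 : measurable (H `\` F) by apply: (Pnull_measurable nN) => w h; apply: FN; right.
rewrite (_ : F = (H `\` (H `\` F)) `|` (F `\` H)).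
  by apply: measurableU => //; apply: measurableD => //; exact: GM.
apply/seteqP; split => w.
  by move=> Fw; have [Hw|Hw] := pselect (H w); [left; split => // -[]|right].
by move=> [[Hw h]|[]//]; apply: contrapT => Fw; apply: h.
Qed.

(** The completed event and a raw one differ by a null set, which no mean notices; this is how the
    one-step inequalities reach the states of a decision rule. *)
Lemma completeF_Ex (G : set (set T)) F : G `<=` measurable -> completeF P G F ->
  exists2 H, G H & forall f, integ P f -> Ex P (fun w => \1_F w * f w) = Ex P (fun w => \1_H w * f w).
Proof.
move=> GM cF; have mF := completeF_measurable GM cF.
have [H GH [N nN FN]] := cF; exists H => // f fi.
have mH := GM _ GH; rewrite /Ex /Rintegral; congr fine.
apply: ae_eq_integral => //.
- by have /integrableP[] := integ_indicM mF fi.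
- by have /integrableP[] := integ_indicM mH fi.
- exists N; split; [by case: nN|by case: nN|].
  move=> w /= hw; apply: FN; apply: contrapT => h; apply: hw => _.
  have FH : F w <-> H w.
    by split => h'; apply: contrapT => h''; apply: h; [left|right].
  congr EFin; congr (_ * _); have [Fw|Fw] := pselect (F w).
    by rewrite !indic_in//; apply/FH.
  by rewrite !indic_out// => /FH.
Qed.

Section Algebra.
Variable G : set (set T).
Hypothesis sG : sigma_algebra setT G.

Lemma sub_completeF : G `<=` completeF P G.
Proof.
move=> E GE; exists E => //; exists set0.
  by split; [exact: measurable0|rewrite measure0].
by rewrite setDv setU0.
Qed.

Lemma completeF_C E : completeF P G E -> completeF P G (~` E).
Proof.
move=> [H GH [N nN EN]]; exists (~` H).
  by have [_ h _] := sG; have := h _ GH; rewrite setTD.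
exists N => //; apply: subset_trans EN.
rewrite !setDE !setCK setUC => w [[h1 h2]|[h1 h2]]; [left|right]; split => //.
Qed.

Lemma completeF_bigcup (E : nat -> set T) : (forall i, completeF P G (E i)) ->
  completeF P G (\bigcup_i E i).
Proof.
move=> cE; have [H hH] : {H : nat -> set T & forall i, G (H i) /\
    exists2 N, Pnull P N & (E i `\` H i) `|` (H i `\` E i) `<=` N}.
  apply: (@choice _ _ (fun i H => G H /\ exists2 N, Pnull P N & (E i `\` H) `|` (H `\` E i) `<=` N)).
  by move=> i; have [H GH h] := cE i; exists H.
have [N hN] : {N : nat -> set T & forall i, Pnull P (N i) /\ (E i `\` H i) `|` (H i `\` E i) `<=` N i}.
  apply: (@choice _ _ (fun i N => Pnull P N /\ (E i `\` H i) `|` (H i `\` E i) `<=` N)).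
  by move=> i; have [_ [N nN h]] := hH i; exists N.
exists (\bigcup_i H i); first by have [_ _ h] := sG; apply: h => i; case: (hH i).
exists (\bigcup_i N i).
  split; first by apply: bigcup_measurable => i _; case: (hN i) => -[].
  apply/eqP; rewrite eq_le measure_ge0 andbT.
  apply: le_trans (_ : (\sum_(i <oo) P (N i) <= _)%E).
    apply: measure_sigma_subadditive => //.
      by move=> i; case: (hN i) => -[].
    by apply: bigcup_measurable => i _; case: (hN i) => -[].
  by rewrite eseries0// => i _ _; case: (hN i) => -[].
move=> w [[[i _ Ei] hw]|[[i _ Hi] hw]]; exists i => //; apply: (hN i).2.
  by left; split => // Hi; apply: hw; exists i.
by right; split => // Ei; apply: hw; exists i.
Qed.

Lemma completeF_U E F : completeF P G E -> completeF P G F -> completeF P G (E `|` F).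
Proof.
move=> cE cF; rewrite (_ : E `|` F = \bigcup_(i : nat) (if i == 0%N then E else F)).
  by apply: completeF_bigcup => i; case: ifP.
apply/seteqP; split => [w [h|h]|w [i _]]; [by exists 0%N|by exists 1%N|].
by case: ifP; [left|right].
Qed.

Lemma completeF_I E F : completeF P G E -> completeF P G F -> completeF P G (E `&` F).
Proof.
move=> cE cF; rewrite -(setCK (E `&` F)) setCI.
by apply: completeF_C; apply: completeF_U; exact: completeF_C.
Qed.

End Algebra.
End Complete.

(** * The Bellman inequality along the grid *)

Section GridBound.
Context {R : realType} {d : measure_display} {T : measurableType d}.
Variables (P : probability T R) (Bm : R -> T -> R) (theta : T -> R) (mu : R).
Variables (c0 c1 c2 B A : R).
Hypothesis cP : complete_prob P.
Hypothesis HB : BM_indep P Bm theta.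
Hypothesis Hth : forall w, theta w = 1 \/ theta w = -1.
Local Notation X := (obs Bm theta mu).
Local Notation p := (prior P theta).
Hypotheses (p0 : 0 < p) (p1 : p < 1).
Hypotheses (mu0 : 0 < mu) (c00 : 0 < c0) (c10 : 0 < c1).
Local Notation k := (c1 / (4 * mu ^+ 2)).
Local Notation ke := (c0 / (2 * mu ^+ 2)).
Hypothesis ok : params_ok k ke c2 B A.
Local Notation M := (Mt P Bm theta mu).
Local Notation Lam := (Lam P Bm theta mu).
Local Notation Vf := (Vf k c2 B).
Local Notation Uf := (Uf k ke B A).

Variables (h : R) (st : nat -> T -> R).
Hypothesis h0 : 0 < h.
(* The state of step n is sampled at time n h but the posterior at time (n+1) h: the completed
   right-continuous sigma-algebra at n h is contained, up to null sets, in the raw one at (n+1) h. *)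
Let t (n : nat) : R := n.+1%:R * h.
Hypothesis st_val : forall n w, [\/ st n w = 0, st n w = 1 | st n w = -1].
Hypothesis st_adapted : forall n (e : R), completeF P (natF X (t n)) [set w | st n w = e].
Hypothesis st_stop : forall n w, st n w != 0 -> st n.+1 w != 0.

Definition Ws (e x : R) : R := if e == 0 then Uf x else Vf (e * x).
Definition run_cost (e th : R) : R := if e == 0 then c0 else c1 * (e != th)%:R.
Definition jump_cost (e e' : R) : R := c2 * ((e != 0) && (e != e'))%:R.
Definition step_cost n w := h * run_cost (st n w) (theta w) + jump_cost (st n w) (st n.+1 w).

Let c20 : 0 < c2 := c2_gt0 ok.
Let bnd s w := Mt_bnd Bm mu p0 p1 s w.
Let t0 n : 0 <= t n. Proof. by rewrite mulr_ge0// ltW. Qed.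
Let tS n : t n < t n.+1. Proof. by rewrite ltr_pM2r// ltr_nat. Qed.
Let tD n : t n.+1 - t n = h. Proof. by rewrite /t -mulrBl -natrB// subSnn mul1r. Qed.
Let N10 : (-1 : R) == 0 = false. Proof. by apply/negbTE; rewrite oppr_eq0 oner_eq0. Qed.
Let N11 : (-1 : R) == 1 = false. Proof. by apply/negbTE/eqP => e; have : (-1 : R) = 1 := e; lra. Qed.
Let P1N : (1 : R) == -1 = false. Proof. by rewrite eq_sym N11. Qed.

Let S n e := [set w | st n w = e].
Let mS n e : measurable (S n e).
Proof. exact: (completeF_measurable cP (natF_meas HB (t := t n)) (st_adapted n e)). Qed.

Let st_dec n (g : R -> R) w : g (st n w) =
  \1_(S n 0) w * g 0 + \1_(S n 1) w * g 1 + \1_(S n (-1)) w * g (-1).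
Proof.
have ind e : \1_(S n e) w = (st n w == e)%:R :> R.
  have [e1|/eqP ne] := eqVneq (st n w) e; first by rewrite indic_in.
  by rewrite indic_out.
rewrite !ind; case: (st_val n w) => ->;
  by rewrite ?eqxx ?oner_eq0 ?(eq_sym 0) ?oner_eq0 ?N10 ?N11 ?P1N/= ?(mul0r, mul1r, addr0, add0r).
Qed.

(** Leaving the undecided state is [Uf_le_Vf], with the evenness of [Uf] when the decision is -1; a
    change of decision is [VfN]; a return to 0 is excluded. *)
Let Ws_le e e' x : -1 < x < 1 -> [\/ e = 0, e = 1 | e = -1] -> [\/ e' = 0, e' = 1 | e' = -1] ->
  (e != 0 -> e' != 0) -> Ws e x <= Ws e' x + jump_cost e e'.
Proof.
move=> hx he he' hee; have hxN : -1 < - x < 1 by move: hx => /andP[? ?]; apply/andP; split; lra.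
rewrite /Ws /jump_cost; case: he he' hee => -> [] ->;
  rewrite ?eqxx ?oner_eq0 ?(eq_sym 0) ?oner_eq0 ?N10 ?N11 ?P1N/= ?mulr0 ?addr0 ?mul1r ?mulN1r ?mulr1 => hee //.
- exact: (Uf_le_Vf ok).
- by rewrite -(Uf_N _ _ _ _ hx); exact: (Uf_le_Vf ok).
- by have := hee isT.
- exact: (VfN ok).
- by have := hee isT.
- by have := VfN ok hxN; rewrite opprK.
Qed.

Lemma Ws_bnd : exists2 K, 0 <= K & forall e x, [\/ e = 0, e = 1 | e = -1] -> -1 < x < 1 ->
  0 <= Ws e x <= K.
Proof.
have [K K0 HK] := Vf_bounded ok; exists K => // e x he hx.
have hxN : -1 < - x < 1 by move: hx => /andP[? ?]; apply/andP; split; lra.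
rewrite /Ws; case: he => ->; rewrite ?eqxx ?oner_eq0 ?N10 ?mul1r ?mulN1r; apply/andP; split.
- exact: (Uf_ge0 ok).
- by apply: le_trans (HK x hx); exact: (Uf_le_Vf ok).
- exact: (Vf_ge0 ok).
- exact: HK.
- exact: (Vf_ge0 ok).
- exact: HK.
Qed.

Let mWs e : measurable_fun setT (Ws e).
Proof.
case: (boolP (e == 0)) => he.
  rewrite (_ : Ws e = Uf); last by apply/funext => x; rewrite /Ws he.
  exact: (measurable_Uf k ke B A).
rewrite (_ : Ws e = (fun x => Vf (e * x))); last by apply/funext => x; rewrite /Ws (negbTE he).
by apply: (measurableT_comp (measurable_Vf k c2 B)); exact: measurable_funM.
Qed.

Let Ws_integ n m : integ P (fun w => Ws (st n w) (M (t m) w)).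
Proof.
have [K K0 HK] := Ws_bnd.
apply: (@integ_bounded _ _ _ _ K); last first.
  by move=> w; have /andP[a b] := HK _ _ (st_val n w) (bnd (t m) w); rewrite ger0_norm.
have mM := measurable_Mt mu HB (t0 m).
have mI e : measurable_fun setT (\1_(S n e) : T -> R) by exact: measurable_indic.
have mW e : measurable_fun setT (fun w => Ws e (M (t m) w)).
  exact: (measurableT_comp (mWs e) mM).
have -> : (fun w => Ws (st n w) (M (t m) w)) = (fun w =>
   \1_(S n 0) w * Ws 0 (M (t m) w) + \1_(S n 1) w * Ws 1 (M (t m) w) + \1_(S n (-1)) w * Ws (-1) (M (t m) w)).
  by apply/funext => w; rewrite (st_dec n (fun e => Ws e (M (t m) w))).
by do 2 ?apply: measurable_funD; exact: measurable_funM.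
Qed.

Let run_integ n : integ P (fun w => run_cost (st n w) (theta w)).
Proof.
have -> : (fun w => run_cost (st n w) (theta w)) = (fun w =>
   c0 * \1_(S n 0) w + c1 / 2 * (\1_(S n 1) w * (1 - 1 * theta w)) + c1 / 2 * (\1_(S n (-1)) w * (1 - -1 * theta w))).
  apply/funext => w; rewrite (st_dec n (fun e => run_cost e (theta w))) /run_cost eqxx oner_eq0 N10.
  by case: (Hth w) => ->; rewrite ?eqxx ?N11 ?P1N/=; field.
apply: integD; first (apply: integD; first by apply: integZ; exact: integ_indic).
  by apply: integZ; exact: (theta_integ HB Hth).
by apply: integZ; exact: (theta_integ HB Hth).
Qed.

Let jump_integ n : integ P (fun w => jump_cost (st n w) (st n.+1 w)).
Proof.
apply: (@integ_bounded _ _ _ _ c2); last first.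
  by move=> w; rewrite /jump_cost normrM (gtr0_norm c20) ler_piMr ?(ltW c20)//;
    case: (_ && _); rewrite ?normr1 ?normr0.
have mI m e : measurable_fun setT (\1_(S m e) : T -> R) by exact: measurable_indic.
have -> : (fun w => jump_cost (st n w) (st n.+1 w)) = (fun w =>
   \1_(S n 0) w * 0 + \1_(S n 1) w * (c2 * (\1_(S n.+1 0) w + \1_(S n.+1 (-1)) w))
   + \1_(S n (-1)) w * (c2 * (\1_(S n.+1 0) w + \1_(S n.+1 1) w))).
  apply/funext => w; rewrite (st_dec n (fun e => jump_cost e (st n.+1 w))).
  rewrite (st_dec n.+1 (jump_cost 1)) (st_dec n.+1 (jump_cost (-1))) /jump_cost.
  by rewrite !eqxx !oner_eq0 !N10 !N11 !P1N/=; ring.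
by apply: measurable_funD; [apply: measurable_funD|]; apply: measurable_funM => //;
  apply: measurable_funM => //; apply: measurable_funD.
Qed.

Lemma step_integ n : integ P (step_cost n).
Proof. by apply: integD => //; exact: integZ. Qed.

Let kE : 2 * k * mu ^+ 2 = c1 / 2. Proof. by field; rewrite gt_eqF. Qed.
Let keE : 2 * ke * mu ^+ 2 = c0. Proof. by field; rewrite gt_eqF. Qed.

Let Wse_integ m e : [\/ e = 0, e = 1 | e = -1] -> integ P (fun w => Ws e (M (t m) w)).
Proof.
move=> he; have [K K0 HK] := Ws_bnd.
apply: (@integ_bounded _ _ _ _ K).
  exact: (measurableT_comp (mWs e) (measurable_Mt mu HB (t0 m))).
by move=> w; have /andP[a b] := HK _ _ he (bnd (t m) w); rewrite ger0_norm.
Qed.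

Let runE_integ e : integ P (fun w => run_cost e (theta w)).
Proof.
rewrite /run_cost; case: (boolP (e == 0)) => he; first exact: integ_cst.
have -> : (fun w => c1 * (e != theta w)%:R) = (fun w => c1 * \1_[set w | e <> theta w] w).
  apply/funext => w; congr (_ * _); have [->|/eqP ne] := eqVneq e (theta w).
    by rewrite indic_out.
  by rewrite indic_in.
apply: integZ; apply: integ_indic.
have mth : measurable_fun setT theta by case: HB.
have := mth measurableT (~` [set e]); rewrite setTI => hm.
rewrite (_ : [set w | _] = theta @^-1` (~` [set e])).
  by apply: hm; apply: measurableC; exact: measurable_set1.
by apply/seteqP; split => w /= h1 h2; apply: h1.
Qed.

Let Ws_step n e : [\/ e = 0, e = 1 | e = -1] ->
  - (h * Ex P (fun w => \1_(S n e) w * run_cost e (theta w))) <=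
  Ex P (fun w => \1_(S n e) w * (Ws e (M (t n.+1) w) - Ws e (M (t n) w))).
Proof.
move=> he; have [K K0 HK] := Ws_bnd.
have iW m := Wse_integ m he.
have [H nH HE] := completeF_Ex cP (natF_meas HB (t := t n)) (st_adapted n e).
have ir := runE_integ e.
rewrite (HE _ ir) (HE (fun w => Ws e (M (t n.+1) w) - Ws e (M (t n) w))); last exact: integB.
case: he => ee; rewrite ee /Ws /run_cost.
- rewrite eqxx; have := U_step HB Hth p0 p1 ok (t0 n) (tS n) nH.
  rewrite tD keE; move/(le_trans _); apply.
  rewrite (_ : (fun w => \1_H w * c0) = (fun w => c0 * \1_H w)); last by apply/funext => w; rewrite mulrC.
  rewrite ExZ; last by apply: integ_indic; exact: (natF_meas HB nH).
  by rewrite le_eqVlt; apply/orP; left; apply/eqP; ring.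
- rewrite oner_eq0; have := V_step HB Hth p0 p1 ok (or_introl erefl) (t0 n) (tS n) nH.
  rewrite tD kE; move/(le_trans _); apply.
  rewrite (_ : (fun w => \1_H w * (c1 * _)) = (fun w => c1 / 2 * (\1_H w * (1 - 1 * theta w)))); last first.
    by apply/funext => w; case: (Hth w) => ->; rewrite ?eqxx ?N11 ?P1N/=; field.
  rewrite ExZ; last by apply: (theta_integ HB Hth); exact: (natF_meas HB nH).
  by rewrite le_eqVlt; apply/orP; left; apply/eqP; ring.
- rewrite N10; have := V_step HB Hth p0 p1 ok (or_intror erefl) (t0 n) (tS n) nH.
  rewrite tD kE; move/(le_trans _); apply.
  rewrite (_ : (fun w => \1_H w * (c1 * _)) = (fun w => c1 / 2 * (\1_H w * (1 - -1 * theta w)))); last first.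
    by apply/funext => w; case: (Hth w) => ->; rewrite ?eqxx ?N11 ?P1N/=; field.
  rewrite ExZ; last by apply: (theta_integ HB Hth); exact: (natF_meas HB nH).
  by rewrite le_eqVlt; apply/orP; left; apply/eqP; ring.
Qed.

(** Two moves: the posterior advances while the state is frozen ([Ws_step], on each event of
    constant state), then the state changes at the new posterior ([Ws_le]). *)
Lemma bellman_step n : Ex P (fun w => Ws (st n w) (M (t n) w)) <=
  Ex P (step_cost n) + Ex P (fun w => Ws (st n.+1 w) (M (t n.+1) w)).
Proof.
pose g e w := Ws e (M (t n.+1) w) - Ws e (M (t n) w) + h * run_cost e (theta w).
have ig e : [\/ e = 0, e = 1 | e = -1] -> integ P (fun w => \1_(S n e) w * g e w).
  move=> he; apply: integ_indicM => //; apply: integD; last exact: integZ.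
  by apply: integB; exact: Wse_integ.
have g0 e : [\/ e = 0, e = 1 | e = -1] -> 0 <= Ex P (fun w => \1_(S n e) w * g e w).
  move=> he; have := Ws_step n he.
  rewrite -ExZ; last exact: integ_indicM.
  rewrite -subr_ge0 opprK -ExD; first last.
  - by apply: integZ; exact: integ_indicM.
  - by apply: integ_indicM => //; apply: integB; exact: Wse_integ.
  by under eq_Ex do rewrite mulrCA -mulrDr.
have e0 : [\/ (0 : R) = 0, (0 : R) = 1 | (0 : R) = -1] by constructor 1.
have e1 : [\/ (1 : R) = 0, (1 : R) = 1 | (1 : R) = -1] by constructor 2.
have eN : [\/ (-1 : R) = 0, (-1 : R) = 1 | (-1 : R) = -1] by constructor 3.
pose G w := \1_(S n 0) w * g 0 w + \1_(S n 1) w * g 1 w + \1_(S n (-1)) w * g (-1) w.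
have iG : integ P G by do 2 ?apply: integD; exact: ig.
have G0 : 0 <= Ex P G.
  rewrite ExD; [|by apply: integD; exact: ig|exact: ig].
  rewrite ExD; [|exact: ig..].
  by apply: addr_ge0; [apply: addr_ge0|]; exact: g0.
apply: (@le_trans _ _ (Ex P (fun w => Ws (st n w) (M (t n) w) + G w))).
  rewrite [leRHS]ExD; [by rewrite lerDl|exact: Ws_integ|exact: iG].
rewrite -ExD; [|exact: step_integ|exact: Ws_integ].
apply: Ex_le.
- by apply: integD; [exact: Ws_integ|exact: iG].
- by apply: integD; [exact: step_integ|exact: Ws_integ].
move=> w; rewrite /G -(st_dec n (g^~ w)) /g /step_cost.
have := Ws_le (bnd (t n.+1) w) (st_val n w) (st_val n.+1 w) (@st_stop n w).
move: (Ws _ _) (Ws _ _) (Ws _ _) (jump_cost _ _) (run_cost _ _) => a b c j r.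
lra.
Qed.

Lemma bellman_sum n : Ex P (fun w => Ws (st 0 w) (M h w)) <=
  Ex P (fun w => \sum_(i < n) step_cost i w) + Ex P (fun w => Ws (st n w) (M (t n) w)).
Proof.
elim: n => [|n ih].
  rewrite (_ : (fun w => \sum_(i < 0) step_cost i w) = cst 0).
    by rewrite Ex_cst add0r /t mul1r.
  by apply/funext => w; rewrite big_ord0.
apply: (le_trans ih).
rewrite (_ : (fun w => \sum_(i < n.+1) step_cost i w) =
   (fun w => \sum_(i < n) step_cost i w + step_cost n w)); last first.
  by apply/funext => w; rewrite big_ord_recr.
rewrite ExD; [|by apply: integ_sum => i; exact: step_integ|exact: step_integ].
by rewrite -addrA lerD2l; exact: bellman_step.
Qed.

(** The running cost with unit rates: being undecided counts as an error. *)
Definition errc (e th : R) : R := if e == 0 then 1 else (e != th)%:R.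

Let errc_run e th : Num.min c0 c1 * errc e th <= run_cost e th.
Proof.
rewrite /errc /run_cost; case: ifP => _; first by rewrite mulr1 ge_min lexx.
by rewrite ler_wpM2r// ge_min lexx orbT.
Qed.

Let errc_integ n : integ P (fun w => errc (st n w) (theta w)).
Proof.
have c0' : c0 != 0 by rewrite gt_eqF.
have c1' : c1 != 0 by rewrite gt_eqF.
have -> : (fun w => errc (st n w) (theta w)) = (fun w =>
   \1_(S n 0) w + 2^-1 * (\1_(S n 1) w * (1 - 1 * theta w)) + 2^-1 * (\1_(S n (-1)) w * (1 - -1 * theta w))).
  apply/funext => w; rewrite (st_dec n (fun e => errc e (theta w))) /errc eqxx oner_eq0 N10.
  by case: (Hth w) => ->; rewrite ?eqxx ?N11 ?P1N/=; field.
apply: integD; first (apply: integD; first exact: integ_indic).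
  by apply: integZ; exact: (theta_integ HB Hth).
by apply: integZ; exact: (theta_integ HB Hth).
Qed.

(* The posterior concentrates: Vf (M t) <= K exp (- Lam t / 2), whose mean decays exponentially. *)
Lemma terminal_small : exists2 K, 0 <= K & forall n,
  Ex P (fun w => Ws (st n w) (M (t n) w)) <=
  K * Ex P (fun w => errc (st n w) (theta w)) + K * expR (- (mu ^+ 2 / 2) * t n).
Proof.
have [K K0 HK] := Ws_bnd; have [K' K'0 HK'] := Vf_exp ok.
pose l0 := Lam0 P theta.
exists (K + 2 * K' * expR (`|l0| / 2)).
  by rewrite addr_ge0// mulr_ge0 ?expR_ge0// mulr_ge0.
move=> n; set s := t n; have s0 : 0 < s by rewrite mulr_gt0.
have s0' : 0 < s - 0 by rewrite subr0.
have mB r : measurable_fun setT (Bm r) by case: HB.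
have B0 w : Bm 0 w = 0 by case: HB.
have mg c : integ P (fun w => expR (c * Bm s w)) /\ Ex P (fun w => expR (c * Bm s w)) = expR (c ^+ 2 * s / 2).
  have := gauss_mgf s0' (measurable_funB (mB s) (mB 0)) (bm_law HB (lexx _) s0) c.
  by rewrite (_ : (fun w => expR (c * (Bm s \- Bm 0) w)) = (fun w => expR (c * Bm s w))) ?subr0//;
    apply/funext => w /=; rewrite B0 subr0.
have [i1 e1] := mg mu; have [i2 e2] := mg (- mu).
(* For a correct decision, exp (- theta Lam / 2) is exp (- theta l0 / 2 - mu^2 s - theta mu B_s).
   The sum of two exponentials covers both signs of theta, and each has mean exp (mu^2 s / 2), which
   leaves exp (- mu^2 s / 2). *)
pose C := K' * expR (`|l0| / 2) * expR (- mu ^+ 2 * s).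
have C0 : 0 <= C by rewrite !mulr_ge0 ?expR_ge0.
apply: (@le_trans _ _ (Ex P (fun w => K * errc (st n w) (theta w) +
   C * (expR (mu * Bm s w) + expR (- mu * Bm s w))))).
  apply: Ex_le; first exact: Ws_integ.
    by apply: integD; apply: integZ => //; exact: integD.
  move=> w; have b := bnd s w.
  have [es|es] := eqVneq (st n w) (theta w); last first.
    apply: le_trans (_ : K <= _); first by have /andP[] := HK _ _ (st_val n w) b.
    rewrite /errc es; have -> : (if st n w == 0 then 1 else true%:R) = 1 :> R by case: ifP.
    by rewrite mulr1 lerDl mulr_ge0// addr_ge0 ?expR_ge0.
  have -> : errc (st n w) (theta w) = 0.
    by rewrite /errc es eqxx; case: (Hth w) => ->; rewrite ?oner_eq0 ?N10.
  rewrite mulr0 add0r es /Ws; have -> : (theta w == 0) = false.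
    by case: (Hth w) => ->; rewrite ?oner_eq0 ?N10.
  have hb := sgn_bnd Bm mu p0 p1 s w (Hth w).
  apply: le_trans (HK' _ hb) _.
  have -> : LL (theta w * M s w) = - (theta w * Lam s w).
    case: (Hth w) => ->; first by rewrite !mul1r (LL_Mt Bm mu p0 p1).
    by rewrite !mulN1r (LLN b) (LL_Mt Bm mu p0 p1).
  have -> : C * (expR (mu * Bm s w) + expR (- mu * Bm s w)) =
    K' * (expR (`|l0| / 2) * expR (- mu ^+ 2 * s) * (expR (mu * Bm s w) + expR (- mu * Bm s w))).
    by rewrite /C; ring.
  apply: ler_wpM2l => //.
  apply: (@le_trans _ _ (expR (`|l0| / 2) * expR (- mu ^+ 2 * s) * expR (- theta w * (mu * Bm s w)))).
    rewrite -!expRD ler_expR.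
    have hl : - (theta w * l0) / 2 <= `|l0| / 2.
      rewrite ler_pM2r//; case: (Hth w) => ->; last by rewrite mulN1r opprK ler_norm.
      by rewrite mul1r -normrN ler_norm.
    rewrite !LamE /obs -/l0.
    have h2 : theta w * theta w = 1 by case: (Hth w) => ->; lra.
    rewrite (_ : - (theta w * _) / 2 = - (theta w * l0) / 2 + (- (theta w * theta w) * mu ^+ 2 * s) + - theta w * (mu * Bm s w)); last by field.
    by rewrite h2 lerD2r mulN1r mulNr lerD2r.
  rewrite ler_wpM2l// ?mulr_ge0 ?expR_ge0//.
  case: (Hth w) => ->; first by rewrite mulN1r mulNr lerDr expR_ge0.
  by rewrite opprK mul1r lerDl expR_ge0.
rewrite ExD; [|exact: integZ|by apply: integZ; exact: integD].
rewrite !ExZ//; last exact: integD.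
rewrite ExD// e1 e2 sqrrN.
have ee : 0 <= Ex P (fun w => errc (st n w) (theta w)).
  by apply: Ex_ge0 => w; rewrite /errc; case: ifP.
have L0 : 0 <= K' * expR (`|l0| / 2) by rewrite mulr_ge0// expR_ge0.
apply: lerD.
  by rewrite ler_wpM2r// lerDl -mulrA mulr_ge0.
have -> : C * (expR (mu ^+ 2 * s / 2) + expR (mu ^+ 2 * s / 2)) =
   2 * K' * expR (`|l0| / 2) * expR (- (mu ^+ 2 / 2) * s).
  rewrite /C (_ : - (mu ^+ 2 / 2) * s = - mu ^+ 2 * s + mu ^+ 2 * s / 2); last by field.
  by rewrite expRD; ring.
by rewrite ler_wpM2r ?expR_ge0// lerDr.
Qed.

(** A bounded total cost makes the mean errors summable, hence they tend to 0, and with them both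
    terms of [terminal_small]. *)
Lemma grid_lower_bound (Q : R) :
  (forall n, Ex P (fun w => \sum_(i < n) step_cost i w) <= Q) ->
  Ex P (fun w => Uf (M h w)) <= Q.
Proof.
move=> HQ; have [K K0 HK] := terminal_small.
have mc : 0 < Num.min c0 c1 by rewrite lt_min c00.
pose e n := Ex P (fun w => errc (st n w) (theta w)).
have e0 n : 0 <= e n by apply: Ex_ge0 => w; rewrite /errc; case: ifP.
have sumb n : \sum_(i < n) e i <= Q / (h * Num.min c0 c1).
  rewrite ler_pdivlMr ?mulr_gt0//; apply: le_trans (HQ n).
  rewrite -Ex_sum// mulrC -ExZ; last by apply: integ_sum.
  apply: Ex_le; [by apply: integZ; exact: integ_sum|by apply: integ_sum => i; exact: step_integ|].
  move=> w; rewrite mulr_sumr; apply: ler_sum => i _; rewrite /step_cost.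
  apply: le_trans (_ : h * run_cost (st i w) (theta w) <= _).
    by rewrite -mulrA ler_pM2l.
  by rewrite lerDl /jump_cost mulr_ge0// ltW.
have cvs : cvgn (series e).
  apply: nondecreasing_is_cvgn; first exact: nondecreasing_series.
  by exists (Q / (h * Num.min c0 c1)) => _ [n _ <-]; rewrite seriesEord; exact: sumb.
have e_to0 : e n @[n --> \oo] --> 0 by exact: cvg_series_cvg_0.
have t_to0 : expR (- (mu ^+ 2 / 2) * t n) @[n --> \oo] --> 0.
  pose q := expR (- (mu ^+ 2 / 2 * h)).
  have q1 : `|q| < 1 by rewrite ger0_norm ?expR_ge0// expR_lt1 oppr_lt0 mulr_gt0// divr_gt0// exprn_gt0.
  have := cvg_expr q1; rewrite -(cvg_shiftS (fun n => q ^+ n)) /=.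
  rewrite (_ : (fun n => q ^+ n.+1) = (fun n => expR (- (mu ^+ 2 / 2) * t n)))//.
  by apply/funext => n; rewrite /q -expRM_natl /t; congr expR; ring.
have lim : Q + (K * e n + K * expR (- (mu ^+ 2 / 2) * t n)) @[n --> \oo] --> Q + (K * 0 + K * 0).
  by apply: cvgD; [exact: cvg_cst|apply: cvgD; apply: cvgM => //; exact: cvg_cst].
rewrite !mulr0 !addr0 in lim.
(* The first sampled state may already be a decision; entering it from state 0 costs no jump. *)
apply: le_trans (_ : Ex P (fun w => Ws (st 0 w) (M h w)) <= _).
  apply: Ex_le.
  - have := @Wse_integ 0%N 0 (Or31 _ _ erefl); rewrite /t mul1r.
    by under [X in integ _ X -> _]eq_fun do rewrite /Ws eqxx.
  - by have := @Ws_integ 0%N 0%N; rewrite /t mul1r.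
  - move=> w; have := @Ws_le 0 (st 0 w) (M h w) (bnd h w) (Or31 _ _ erefl) (st_val 0 w).
    by rewrite {1}/Ws /jump_cost eqxx/= mulr0 addr0; apply.
apply: (cvgr_to_ge lim); apply: nearW => n.
by apply: (le_trans (bellman_sum n)); rewrite lerD// HK.
Qed.

End GridBound.

(** * The lower bound for a decision rule *)

Section LowerIntegral.
Local Open Scope ereal_scope.
Context {d : measure_display} {T : measurableType d} {R : realType}.
Variable m : {measure set T -> \bar R}.

(* The integral is a lower integral, so it is monotone without measurability. *)
Lemma ge0_integral_mono (D : set T) (f g : T -> \bar R) :
  (forall x, D x -> 0 <= f x) -> (forall x, D x -> f x <= g x) ->
  \int[m]_(x in D) f x <= \int[m]_(x in D) g x.
Proof.
move=> f0 fg; have g0 x : D x -> 0 <= g x by move=> Dx; exact: le_trans (f0 x Dx) (fg x Dx).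
rewrite !ge0_integralE//; apply: ge_ereal_sup => _ [h hf <-]; apply: ereal_sup_ubound.
exists h => // x; apply: le_trans (hf x) _; rewrite !patchE; case: ifPn => // xD.
by apply: fg; rewrite inE in xD.
Qed.

End LowerIntegral.

Section Counting.
Local Open Scope ereal_scope.
Context {R : realType}.

Lemma esum_subset (S S' : set R) : S `<=` S' -> \esum_(t in S) (1 : \bar R) <= \esum_(t in S') 1.
Proof.
move=> SS; rewrite esum_mkcond [leRHS]esum_mkcond; apply: le_esum => i _.
have [iS|iS] := boolP (i \in S); last by case: ifP.
by rewrite ifT// inE; apply: SS; rewrite inE in iS.
Qed.

(** One point is chosen in each marked cell ]i h, (i + 1) h]; the cells are disjoint, so the choice
    is injective. *)
Lemma count_le_esum (h : R) (S : set R) (J : nat -> bool) n : (0 < h)%R ->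
  (forall i, J i -> exists t : R, S t /\ (i%:R * h < t <= i.+1%:R * h)%R) ->
  ((\sum_(i < n) (J i)%:R)%R : R)%:E <= \esum_(t in S) (1 : \bar R).
Proof.
move=> h0 HJ.
have [x hx] : {x : nat -> R & forall i, J i -> S (x i) /\ (i%:R * h < x i <= i.+1%:R * h)%R}.
  apply: (@choice _ _ (fun i t => J i -> S t /\ (i%:R * h < t <= i.+1%:R * h)%R)) => i.
  case: (boolP (J i)) => [Ji|_]; last by exists 0%R.
  by have [t ht] := HJ i Ji; exists t.
have inj : set_inj [set i | J i] x.
  have key i j : J i -> J j -> (i < j)%N -> (x i < x j)%R.
    move=> Ji Jj ij; have [_ /andP[_ h1]] := hx i Ji; have [_ /andP[h2 _]] := hx j Jj.
    by apply: le_lt_trans h1 (le_lt_trans _ h2); rewrite ler_pM2r// ler_nat.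
  move=> i j; rewrite !inE /= => Ji Jj e.
  have [ij|ji|//] := ltngtP i j.
    by have := key i j Ji Jj ij; rewrite e ltxx.
  by have := key j i Jj Ji ji; rewrite e ltxx.
apply: le_trans (_ : \esum_(t in x @` [set i | J i]) (1 : \bar R) <= _); last first.
  by apply: esum_subset => _ [i Ji <-]; exact: (hx i Ji).1.
rewrite esum_image// -nneseries_esum//.
apply: le_trans (_ : \sum_(0 <= i < n | J i) (1 : \bar R) <= _); last exact: nneseries_lim_ge.
rewrite big_mkord -sumEFin big_mkcond [leRHS]big_mkcond/= le_eqVlt; apply/orP; left; apply/eqP.
by apply: eq_bigr => i _; case: (J i).
Qed.

End Counting.

(** * Paths of the decision process *)

Section Path.
Context {R : realType} {d0 : measure_display} {T : measurableType d0}.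
Variables (tau : nat -> T -> \bar R) (d : T -> R) (w : T).
Hypothesis tau_nd : forall n, (tau n w <= tau n.+1 w)%E.
Hypothesis d_val : d w = 1 \/ d w = -1.
Local Notation D t := (Dproc tau d t w).

Lemma tau_mono m n : (m <= n)%N -> (tau m w <= tau n w)%E.
Proof. by move=> /subnK <-; elim: (n - m)%N => [|i ih] //; apply: (le_trans ih); exact: tau_nd. Qed.

Let dn0 : d w != 0.
Proof. by case: d_val => ->; rewrite ?oppr_eq0 oner_eq0. Qed.

Lemma tau_uniq m n t : (tau m w <= t%:E < tau m.+1 w)%E -> (tau n w <= t%:E < tau n.+1 w)%E -> m = n.
Proof.
move=> /andP[m1 m2] /andP[n1 n2]; have [mn|nm|//] := ltngtP m n.
  by have := lt_le_trans m2 (le_trans (tau_mono mn) n1); rewrite ltxx.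
by have := lt_le_trans n2 (le_trans (tau_mono nm) m1); rewrite ltxx.
Qed.

Lemma DprocE m t : (tau m w <= t%:E < tau m.+1 w)%E -> D t = if odd m then - d w else d w.
Proof.
move=> hm; have em : m = (odd m + 2 * m./2)%N by rewrite mul2n odd_double_half.
rewrite /Dproc; case: asboolP => [[n hn]|h1].
  by rewrite (tau_uniq hm hn) mul2n odd_double.
case: asboolP => [[n hn]|h2].
  by rewrite (tau_uniq hm hn)/= mul2n odd_double.
exfalso; case E : (odd m) em => em.
  by apply: h2; exists m./2; move: hm; rewrite {1 2}em add1n.
by apply: h1; exists m./2; move: hm; rewrite {1 2}em add0n.
Qed.

Lemma Dproc_stage t : D t != 0 -> exists m, (tau m w <= t%:E < tau m.+1 w)%E.
Proof.
rewrite /Dproc; case: asboolP => [[n hn] _|_]; first by exists (2 * n)%N.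
by case: asboolP => [[n hn] _|_]; [exists (2 * n).+1|rewrite eqxx].
Qed.

Lemma Dproc_val t : [\/ D t = 0, D t = 1 | D t = -1].
Proof.
rewrite /Dproc; case: asboolP => _; first by case: d_val => ->; [constructor 2|constructor 3].
case: asboolP => _; last by constructor 1.
by case: d_val => ->; [constructor 3|constructor 2; rewrite opprK].
Qed.

Lemma Dproc_right t : D t != 0 -> exists2 e, 0 < e & forall y, t <= y < t + e -> D y = D t.
Proof.
move=> /Dproc_stage [m hm]; have /andP[m1 m2] := hm.
have [e e0 he] : exists2 e : R, 0 < e & forall y, y < t + e -> (y%:E < tau m.+1 w)%E.
  case: (tau m.+1 w) m2 => [r| |]//.
    rewrite lte_fin => tr; exists (r - t); first by rewrite subr_gt0.
    by move=> y; rewrite addrC subrK lte_fin.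
  by move=> _; exists 1 => // y _; rewrite ltry.
exists e => // y /andP[ty yt]; rewrite (DprocE hm) (@DprocE m)//.
by rewrite he// andbT (le_trans m1)// lee_fin.
Qed.

(** The value 0 after tau 0 means that every tau m is at most t: the switching times have
    accumulated, and no later time falls into a stage. *)
Lemma Dproc_dead t y : (tau 0 w <= t%:E)%E -> D t = 0 -> t <= y -> D y = 0.
Proof.
move=> t0 Dt ty.
have all m : (tau m w <= t%:E)%E.
  elim: m => // m ih; rewrite leNgt; apply/negP => h.
  have := @DprocE m t; rewrite ih h Dt => /(_ isT) e.
  by move: dn0; case: (odd m) e => [/eqP|] e; [rewrite eq_sym oppr_eq0 in e; rewrite e|rewrite -e eqxx].
apply/eqP; apply: contraT => /Dproc_stage [m /andP[_ h]].
have ty' : (t%:E <= y%:E)%E by rewrite lee_fin.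
by have := lt_le_trans h (le_trans (all m.+1) ty'); rewrite ltxx.
Qed.

(** Supremum argument: the absence of a jump gives the value at the supremum as a left limit, and
    [Dproc_right] extends it beyond. When D r = 0, [Dproc_dead] applies instead. *)
Lemma Dproc_const r r' : (tau 0 w <= r%:E)%E ->
  (forall t, r < t <= r' -> ~ Djump tau d t w) ->
  forall y, r <= y <= r' -> D y = D r.
Proof.
move=> tr nj y /andP[ry yr'].
have [Dr|Dr] := eqVneq (D r) 0; first by rewrite Dr; exact: Dproc_dead Dr ry.
apply: contrapT => Dy.
pose E : set R := [set z | r <= z <= y /\ forall u, r <= u <= z -> D u = D r].
have Er : E r.
  split; first by rewrite lexx.
  by move=> u; rewrite -eq_le => /eqP <-.
have Eub : has_ubound E by exists y => z [/andP[]].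
have sE : has_sup E by split; [exists r|].
pose s := sup E.
have rs : r <= s by exact: ub_le_sup.
have sy : s <= y by apply: sup_le_ub; [exists r|move=> z [/andP[]]].
have below u : r <= u -> u < s -> D u = D r.
  move=> ru us; have us0 : 0 < s - u by rewrite subr_gt0.
  have [z [_ hz] uz] := sup_adherent us0 sE.
  apply: hz; rewrite ru/=; rewrite -/s opprB addrC subrK in uz; exact: ltW.
have [e e0 he] := Dproc_right Dr.
have ryl : r < y by rewrite lt_neqAle ry andbT; apply/eqP => e'; apply: Dy; rewrite -e'.
have rs' : r < s.
  pose z := Num.min y (r + e / 2).
  have rz : r < z by rewrite lt_min ryl ltrDl divr_gt0.
  apply: (lt_le_trans rz); apply: ub_le_sup => //; split.
    by rewrite (ltW rz) ge_min lexx.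
  move=> u /andP[ru uz]; apply: he; rewrite ru/=; apply: le_lt_trans uz _.
  by rewrite gt_min; apply/orP; right; rewrite ltrD2l ltr_pdivrMr// ltr_pMr// ltr1n.
have Ds : D s = D r.
  have := nj s; rewrite rs' (le_trans sy yr') => /(_ isT) /contrapT cv.
  have cv' : D u @[u --> s^'-] --> D r.
    apply: cvg_near_cst; near=> u; apply/esym; rewrite (below u)//.
    near: u; exact: nbhs_left_ge.
  by rewrite -(cvg_lim (@Rhausdorff R) cv) (cvg_lim (@Rhausdorff R) cv').
have Ds0 : D s != 0 by rewrite Ds.
have [e' e'0 he'] := Dproc_right Ds0.
have sy' : s < y by rewrite lt_neqAle sy andbT; apply/eqP => e''; apply: Dy; rewrite -e''.
pose z := Num.min y (s + e' / 2).
have sz : s < z by rewrite lt_min sy' ltrDl divr_gt0.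
have : z <= s.
  apply: ub_le_sup => //; split.
    by rewrite (ltW (lt_trans rs' sz)) ge_min lexx.
  move=> u /andP[ru uz]; have [us|us] := ltP u s; first exact: below.
  rewrite he' ?Ds// us/=; apply: le_lt_trans uz _.
  by rewrite gt_min; apply/orP; right; rewrite ltrD2l ltr_pdivrMr// ltr_pMr// ltr1n.
by rewrite leNgt sz.
Unshelve. all: by end_near. Qed.

End Path.

Section LowerBound.
Context {R : realType} {dO : measure_display} {T : measurableType dO}.
Variables (P : probability T R) (Bm : R -> T -> R) (theta : T -> R) (mu : R).
Variables (c0 c1 c2 B A : R).
Hypothesis cP : complete_prob P.
Hypothesis HB : BM_indep P Bm theta.
Hypothesis Hth : forall w, theta w = 1 \/ theta w = -1.
Local Notation X := (obs Bm theta mu).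
Local Notation p := (prior P theta).
Hypotheses (p0 : 0 < p) (p1 : p < 1).
Hypotheses (mu0 : 0 < mu) (c00 : 0 < c0) (c10 : 0 < c1).
Local Notation k := (c1 / (4 * mu ^+ 2)).
Local Notation ke := (c0 / (2 * mu ^+ 2)).
Hypothesis ok : params_ok k ke c2 B A.
Local Notation M := (Mt P Bm theta mu).
Local Notation Uf := (Uf k ke B A).
Local Notation leb := (@lebesgue_measure R).

Variables (tau : nat -> T -> \bar R) (d : T -> R).
Hypothesis Hrule : decision_rule P X tau d.

Let c20 : 0 < c2 := c2_gt0 ok.
Let tau_nd n w : (tau n w <= tau n.+1 w)%E. Proof. by case: Hrule. Qed.
Let d_val w : d w = 1 \/ d w = -1. Proof. by case: Hrule. Qed.
Let tau_ge0 n w : (0 <= tau n w)%E. Proof. by case: Hrule => /(_ n)[]. Qed.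
Let N10 : (-1 : R) == 0 = false. Proof. by apply/negbTE; rewrite oppr_eq0 oner_eq0. Qed.
Let N11 : (-1 : R) == 1 = false. Proof. by apply/negbTE/eqP => e; have : (-1 : R) = 1 := e; lra. Qed.

Definition loss (w : T) : \bar R :=
  (c0%:E * tau 0%N w
      + c1%:E * \int[lebesgue_measure]_(t in [set t : R | (tau 0%N w <= t%:E)%E])
                  ((Dproc tau d t w != theta w)%:R)%:E
      + c2%:E * \esum_(t in [set t : R | (tau 0%N w < t%:E)%E /\ Djump tau d t w])
                  1)%E.

Section Grid.
Variable h : R.
Hypothesis h0 : 0 < h.

Let r (n : nat) : R := n%:R * h.

(** Once the switching times have accumulated D is 0. This is recorded as -1, since state 0 means
    undecided and must not be entered again; D = 0 is always charged as wrong, which covers either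
    sign. *)
Definition grid_state (n : nat) (w : T) : R :=
  if (tau 0%N w <= (r n)%:E)%E then (if Dproc tau d (r n) w == 1 then 1 else -1) else 0.
Local Notation st := grid_state.

Let r0 n : 0 <= r n. Proof. by rewrite mulr_ge0// ltW. Qed.

Lemma grid_state_val n w : [\/ st n w = 0, st n w = 1 | st n w = -1].
Proof. by rewrite /st; case: ifP => _; [case: ifP => _; [constructor 2|constructor 3]|constructor 1]. Qed.

Lemma grid_state_stop n w : st n w != 0 -> st n.+1 w != 0.
Proof.
rewrite /st; case: (boolP (tau 0%N w <= (r n)%:E)%E) => [hn _|]; last by rewrite eqxx.
rewrite ifT; first by case: ifP => _; rewrite ?oner_eq0 ?N10.
by apply: le_trans hn _; rewrite lee_fin ler_pM2r// ler_nat.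
Qed.

Lemma grid_state_adapted n (e : R) :
  completeF P (natF X (n.+1%:R * h)) [set w | st n w = e].
Proof.
set G := natF X (n.+1%:R * h).
have sG : sigma_algebra setT G by exact: smallest_sigma_algebra.
have rn : r n < n.+1%:R * h by rewrite ltr_pM2r// ltr_nat.
have sub E : FX P X (r n) E -> completeF P G E.
  move=> [H GH h']; exists H => //; exact: (GH _ rn).
have Ta m : completeF P G [set w | (tau m w <= (r n)%:E)%E].
  by apply: sub; case: Hrule => /(_ m)[_ H] _ _ _; exact: H.
have TaC m : completeF P G (~` [set w | (tau m w <= (r n)%:E)%E]) by exact: (completeF_C sG).
have Tst m : completeF P G [set w | (tau m w <= (r n)%:E < tau m.+1 w)%E].
  rewrite (_ : [set w | _] = [set w | (tau m w <= (r n)%:E)%E] `&` ~` [set w | (tau m.+1 w <= (r n)%:E)%E]).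
    exact: (completeF_I sG).
  apply/seteqP; split => w /=; first by move=> /andP[-> /lt_geF ->].
  by move=> [-> /negP]; rewrite -ltNge.
have Dd : completeF P G ((d @^-1` [set 1]) `&` [set w | (tau 0%N w <= (r n)%:E)%E]).
  by apply: sub; case: Hrule => _ _ _ /(_ [set 1] (measurable_set1 _))[_ H]; exact: H.
pose Ev := \bigcup_m [set w | (tau (2 * m)%N w <= (r n)%:E < tau (2 * m).+1 w)%E].
pose Od := \bigcup_m [set w | (tau (2 * m).+1 w <= (r n)%:E < tau (2 * m).+2 w)%E].
have cEv : completeF P G Ev by apply: (completeF_bigcup sG) => m; exact: Tst.
have cOd : completeF P G Od by apply: (completeF_bigcup sG) => m; exact: Tst.
pose A0 := [set w | (tau 0%N w <= (r n)%:E)%E].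
pose Dp := (d @^-1` [set 1]) `&` A0.
have c1' : completeF P G [set w | st n w = 1].
  rewrite (_ : [set w | _] = A0 `&` ((Ev `&` Dp) `|` ((~` Ev `&` Od) `&` ~` Dp))).
    apply: (completeF_I sG); first exact: Ta.
    apply: (completeF_U sG); first exact: (completeF_I sG).
    apply: (completeF_I sG); last exact: (completeF_C sG).
    by apply: (completeF_I sG); first exact: (completeF_C sG).
  have Nz : (0 : R) == 1 = false by rewrite eq_sym oner_eq0.
  apply/seteqP; split => w /=.
    rewrite /st; case: ifP => hA; last by move=> /eqP; rewrite Nz.
    case: ifP; last by move=> _ /eqP; rewrite N11.
    rewrite /Dproc; case: asboolP => [[m hm]|hE] /eqP.
      by move=> ed _; split => //; left; split; [exists m|split].
    case: asboolP => [[m hm]|hO]; last by move=> /eqP; rewrite Nz.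
    move=> ed _; split => //; right; split.
      by split; [move=> [m' _ hm']; apply: hE; exists m'|exists m].
    by move=> [e' _]; move: ed; rewrite (e' : d w = 1) => /eqP; rewrite N11.
  move=> [hA H]; rewrite /st (hA : (tau 0%N w <= (r n)%:E)%E); rewrite ifT//.
  rewrite /Dproc; case: H => [[[m _ hm] [ed _]]|[[nE [m _ hm]] ne]].
    by rewrite asboolT; [rewrite (ed : d w = 1)|exists m].
  rewrite asboolF; last by move=> [m' hm']; apply: nE; exists m'.
  rewrite asboolT; last by exists m.
  by case: (d_val w) => ed; [exfalso; apply: ne; split|rewrite ed opprK].
have cA0 : completeF P G A0 by exact: Ta.
have c0' : completeF P G [set w | st n w = 0].
  rewrite (_ : [set w | _] = ~` A0); first exact: (completeF_C sG).
  apply/seteqP; split => w /=; rewrite /st /A0 /=; case: ifP => //.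
  by move=> _; case: ifP => _ /eqP; rewrite ?oner_eq0 ?N10.
have cN' : completeF P G [set w | st n w = -1].
  rewrite (_ : [set w | _] = ~` ([set w | st n w = 0] `|` [set w | st n w = 1])).
    by apply: (completeF_C sG); exact: (completeF_U sG).
  apply/seteqP; split => w /=.
    by move=> -> [/eqP|/eqP]; rewrite ?N10 ?N11.
  by move=> H; case: (grid_state_val n w) => // ed; exfalso; apply: H; [left|right].
have [->|/eqP n0] := eqVneq e 0; first exact: c0'.
have [->|/eqP n1] := eqVneq e 1; first exact: c1'.
have [->|/eqP nN] := eqVneq e (-1); first exact: cN'.
rewrite (_ : [set w | _] = set0); last first.
  apply/seteqP; split => w //= e'; case: (grid_state_val n w) => e''; rewrite e'' in e'.
  - exact: n0.
  - exact: n1.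
  - exact: nN.
by apply: sub_completeF; have [] := sG.
Qed.

Lemma sum_at_most_one n (F : nat -> R) (v : R) : 0 <= v -> (forall i, F i <= v) ->
  (forall i j, F i != 0 -> F j != 0 -> i = j) -> \sum_(i < n) F i <= v.
Proof.
move=> v0 Fv F1; have [[i hi]|hn] := pselect (exists i : 'I_n, F i != 0).
  rewrite (bigD1 i)//= big1 ?addr0// => j ji; apply/eqP; apply: contraT => hj.
  by move/eqP: ji; case; apply/val_inj; exact: F1.
rewrite big1// => i _; apply/eqP; apply: contraT => hi; exfalso; apply: hn; by exists i.
Qed.

(** A decided cell without a switch is charged its exact cost. A cell with a switch may be
    overcharged by c1 h, which is h c1 / c2 times the price of that switch. Rounding tau 0 up to the
    grid adds at most c0 h. *)
Lemma path_cost n w :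
  ((\sum_(i < n) step_cost theta c0 c1 c2 h st i w)%:E <=
   (c0 * h)%:E + (1 + h * c1 / c2)%:E * loss w)%E.
Proof.
pose S := [set t : R | (tau 0%N w < t%:E)%E /\ Djump tau d t w].
(* [a i]: decided at the left end; [J i]: a switch in ]r i, r (i + 1)]; [b i]: decided, without
   switch and wrong, hence wrong on the whole cell. *)
pose a i := (tau 0%N w <= (r i)%:E)%E.
pose J i := `[< exists t : R, S t /\ (r i < t <= r i.+1) >].
pose b i := [&& a i, ~~ J i & Dproc tau d (r i) w != theta w].
have const i y : a i -> ~~ J i -> r i <= y <= r i.+1 -> Dproc tau d y w = Dproc tau d (r i) w.
  move=> ai nJ hy; apply: (Dproc_const (tau_nd^~ w) (d_val w) ai _ hy).
  move=> t ht hJ; move/asboolP: nJ; apply; exists t; split => //; split => //.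
  by apply: le_lt_trans ai _; rewrite lte_fin; case/andP: ht.
have step i : step_cost theta c0 c1 c2 h st i w <=
    c0 * (h * (~~ a i)%:R) + c1 * (h * (b i)%:R) + (h * c1 + c2) * (J i)%:R.
  have pc1 : 0 < h * c1 by exact: mulr_gt0.
  rewrite /step_cost /run_cost /jump_cost /grid_state -/(a i) -/(a i.+1).
  case: (boolP (a i)) => ai /=; last first.
    rewrite eqxx /= mulr0 addr0 mulr1 mulrC -addrA lerDl addr_ge0//.
      by rewrite mulr_ge0 ?(ltW c10)// mulr_ge0 ?(ltW h0).
    by rewrite mulr_ge0// addr_ge0 ?(ltW pc1) ?(ltW c20).
  have ai1 : a i.+1 by apply: le_trans ai _; rewrite lee_fin ler_pM2r// ler_nat.
  rewrite ai1 !mulr0 add0r.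
  set D0 := Dproc tau d (r i) w; set D1 := Dproc tau d (r i.+1) w.
  have -> : ((if D0 == 1 then 1 else -1) == 0 :> R) = false.
    by case: ifP => _; rewrite ?oner_eq0 ?N10.
  rewrite /= /b ai /=.
  have rr : r i <= r i.+1 by rewrite ler_pM2r// ler_nat.
  case: (boolP (J i)) => Ji /=.
    rewrite !mulr0 add0r mulr1; apply: lerD.
      by rewrite ler_pM2l// ler_piMr ?(ltW c10)// lern1; case: (_ != _).
    by rewrite ler_piMr ?(ltW c20)//; case: (_ != _).
  have e : D1 = D0 by apply: const => //; rewrite lexx rr.
  rewrite e eqxx /= !mulr0 !addr0 mulrCA ler_pM2l// ler_pM2l// ler_nat.
  rewrite -/D0; have := Dproc_val tau (d_val w) (r i); rewrite -/D0.
  case=> ->; rewrite ?eqxx ?N11//.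
  rewrite (_ : (0 == theta w) = false) ?leq_b1//.
  by case: (Hth w) => ->; rewrite eq_sym ?oner_eq0 ?N10.
have lossE : loss w = (c0%:E * tau 0%N w
   + c1%:E * \int[lebesgue_measure]_(t in [set t : R | (tau 0%N w <= t%:E)%E])
                  ((Dproc tau d t w != theta w)%:R)%:E
      + c2%:E * \esum_(t in S) 1)%E by [].
set I1 := (\int[_]_(t in _) _)%E in lossE; set I2 := (\esum_(t in S) 1)%E in lossE.
have I10 : (0 <= I1)%E by apply: integral_ge0 => t _; rewrite lee_fin.
have I20 : (0 <= I2)%E by exact: esum_ge0.
have L0 : (0 <= loss w)%E.
  by rewrite lossE !adde_ge0// mule_ge0// ?lee_fin ?ltW.
pose K := 1 + h * c1 / c2.
have K1 : 1 <= K by rewrite lerDl divr_ge0 ?mulr_ge0 ?ltW.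
have K0 : 0 < K by exact: lt_le_trans K1.
have h1 : ((\sum_(i < n) h * (b i)%:R)%:E <= I1)%E.
  have -> : I1 = (\int[lebesgue_measure]_t ((fun t => ((Dproc tau d t w != theta w)%:R)%:E)
       \_ [set t : R | (tau 0%N w <= t%:E)%E]) t)%E by rewrite /I1 integral_mkcond.
  apply: (@le_trans _ _ (\int[lebesgue_measure]_t
      (\sum_(i < n) (b i)%:R * \1_(`[r i, r i.+1[%classic : set R) t)%:E)%E); last first.
    apply: ge0_integral_mono => t _.
      by rewrite lee_fin sumr_ge0// => i _; rewrite mulr_ge0// indicE.
    set v : R := (if (tau 0%N w <= t%:E)%E then (Dproc tau d t w != theta w)%:R else 0).
    have -> : ((fun t => ((Dproc tau d t w != theta w)%:R)%:E)
       \_ [set t : R | (tau 0%N w <= t%:E)%E]) t = v%:E.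
      rewrite patchE /v; case: ifPn; first by rewrite inE /= => ->.
      by rewrite notin_setE /= => /negP/negbTE ->.
    (* The half-open cells are disjoint, so at most one term is nonzero at t, and if [b i] holds
       there the decision at t is wrong. *)
    rewrite lee_fin; apply: (@sum_at_most_one n (fun i => (b i)%:R * \1_(`[r i, r i.+1[%classic : set R) t)).
    - by rewrite /v; case: ifP.
    - move=> i; have [ti|ti] := pselect ((`[r i, r i.+1[%classic : set R) t); last first.
        by rewrite indic_out// mulr0 /v; case: ifP.
      rewrite indic_in// mulr1; case: (boolP (b i)) => [/and3P[ai nJ ne]|_]; last by rewrite /v; case: ifP.
      move: ti; rewrite /= in_itv/= => /andP[t1 t2].
      rewrite /v ifT; last by apply: (le_trans ai); rewrite lee_fin.
      by rewrite (const i t)// ?ne// t1 ltW.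
    - move=> i j; have nz m : (b m)%:R * \1_(`[r m, r m.+1[%classic : set R) t != 0 :> R ->
          (`[r m, r m.+1[%classic : set R) t.
        by move=> hm; apply: contrapT => h'; move: hm; rewrite indic_out// mulr0 eqxx.
      have mono a' b' : (a' < b')%N -> r a'.+1 <= r b' by move=> ab; rewrite ler_pM2r// ler_nat.
      move=> /nz; rewrite /= in_itv/= => /andP[i1 i2] /nz; rewrite /= in_itv/= => /andP[j1 j2].
      have [ij|ji|//] := ltngtP i j.
        by have := lt_le_trans i2 (le_trans (mono _ _ ij) j1); rewrite ltxx.
      by have := lt_le_trans j2 (le_trans (mono _ _ ji) i1); rewrite ltxx.
  under eq_integral do rewrite -sumEFin.
  rewrite ge0_integral_sum//; last first.
    by move=> i; apply/measurable_EFinP/measurable_funM => //; exact: measurable_indic.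
  rewrite -sumEFin; apply: lee_sum => i _.
  under eq_integral do rewrite EFinM.
  rewrite ge0_integralZl//; last by apply/measurable_EFinP/measurable_indic.
  have le : lebesgue_measure (`[r i, r i.+1[%classic : set R) = h%:E.
    rewrite lebesgue_measure_itv/= lte_fin ifT; last by rewrite ltr_pM2r// ltr_nat.
    by rewrite -EFinD /r -mulrBl -natrB// subSnn mul1r.
  by rewrite integral_indic// setIT [X in (_ <= _ * X)%E]le -EFinM lee_fin mulrC.
have h2 : ((\sum_(i < n) (J i)%:R)%:E <= I2)%E.
  rewrite /I2; apply: (@count_le_esum R h S J n h0) => i /asboolP [t [St ht]].
  by exists t; split.
have [t0i|] := eqVneq (tau 0%N w) +oo%E.
  have -> : loss w = +oo%E.
    by rewrite lossE t0i gt0_muley ?lte_fin// !addye// ?gt_eqF// (lt_le_trans (ltNyr 0))// ?adde_ge0// mule_ge0// lee_fin ltW.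
  by rewrite gt0_muley ?lte_fin// addey// leey.
rewrite -ltey => t0lt.
have t0f : tau 0%N w \is a fin_num by rewrite ge0_fin_numE.
pose t0 := fine (tau 0%N w); have t0E : tau 0%N w = t0%:E by rewrite fineK.
have h3 m : \sum_(i < m) h * (~~ a i)%:R <= t0 + h.
  have t00 : 0 <= t0 by rewrite fine_ge0.
  elim: m => [|m ih]; first by rewrite big_ord0 addr_ge0// ltW.
  rewrite big_ord_recr/=; case: (boolP (a m)) => am /=; first by rewrite mulr0 addr0.
  apply: (@le_trans _ _ (\sum_(i < m.+1) h)).
    rewrite big_ord_recr/= mulr1 lerD2r; apply: ler_sum => i _.
    by rewrite ler_piMr ?(ltW h0)//; case: (~~ _).
  rewrite sumr_const card_ord -mulr_natl -natr1 mulrDl mul1r lerD2r.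
  by move: am; rewrite /a t0E lee_fin -ltNge => /ltW.
have fin : (\sum_(i < n) step_cost theta c0 c1 c2 h st i w) <=
   c0 * (t0 + h) + c1 * (\sum_(i < n) h * (b i)%:R) + (h * c1 + c2) * \sum_(i < n) (J i)%:R.
  apply: (@le_trans _ _ (\sum_(i < n) (c0 * (h * (~~ a i)%:R) + c1 * (h * (b i)%:R) + (h * c1 + c2) * (J i)%:R))).
    by apply: ler_sum => i _; exact: step.
  rewrite !big_split/= -!mulr_sumr !lerD2r.
  by rewrite ler_pM2l//; have := h3 n; rewrite -mulr_sumr.
apply: (@le_trans _ _ ((c0 * (t0 + h) + c1 * (\sum_(i < n) h * (b i)%:R) + (h * c1 + c2) * \sum_(i < n) (J i)%:R)%:E)).
  by rewrite lee_fin.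
set Sb := \sum_(i < n) h * (b i)%:R in h1 *; set SJ := \sum_(i < n) (J i)%:R in h2 *.
apply: (@le_trans _ _ ((c0 * h)%:E + K%:E * (c0 * t0 + c1 * Sb + c2 * SJ)%:E)%E).
  rewrite -EFinM -EFinD lee_fin.
  have Sb0 : 0 <= Sb by apply: sumr_ge0 => i _; rewrite mulr_ge0// ltW.
  have t00 : 0 <= t0 by rewrite fine_ge0.
  have e1 : K * (c2 * SJ) = (h * c1 + c2) * SJ by rewrite /K; field; rewrite gt_eqF.
  have e2 : 1 * (c0 * t0 + c1 * Sb) <= K * (c0 * t0 + c1 * Sb).
    by apply: ler_wpM2r => //; rewrite addr_ge0// mulr_ge0// ltW.
  have e3 : K * (c0 * t0 + c1 * Sb + c2 * SJ) = K * (c0 * t0 + c1 * Sb) + (h * c1 + c2) * SJ.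
    by rewrite -e1; ring.
  by rewrite e3; move: (K * _) ((_ + c2) * SJ) e2 => x y; lra.
apply: leeD2l; apply: lee_wpmul2l; first by rewrite lee_fin ltW.
rewrite lossE t0E !EFinD !EFinM; apply: leeD; first apply: leeD2l.
  by apply: lee_wpmul2l => //; rewrite lee_fin ltW.
by apply: lee_wpmul2l => //; rewrite lee_fin ltW.
Qed.

End Grid.

Lemma risk_lower_bound : ((Uf (2 * p - 1))%:E <= risk P theta c0 c1 c2 tau d)%E.
Proof.
have riskE : risk P theta c0 c1 c2 tau d = (\int[P]_w loss w)%E by [].
have L0 w : (0 <= loss w)%E.
  rewrite /loss !adde_ge0// mule_ge0// ?lee_fin ?(ltW c00) ?(ltW c10) ?(ltW c20)//.
    by apply: integral_ge0 => t _; rewrite lee_fin.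
  exact: esum_ge0.
have R0 : (0 <= risk P theta c0 c1 c2 tau d)%E by rewrite riskE; exact: integral_ge0.
have [->|] := eqVneq (risk P theta c0 c1 c2 tau d) +oo%E; first exact: leey.
rewrite -ltey => Rlt.
pose Rr := fine (risk P theta c0 c1 c2 tau d).
have RE : risk P theta c0 c1 c2 tau d = Rr%:E by rewrite fineK// ge0_fin_numE.
have Rr0 : 0 <= Rr by rewrite fine_ge0.
rewrite RE lee_fin.
have key h : 0 < h -> Uf (2 * p - 1) <= 2 * c0 * h + (1 + h * c1 / c2) * Rr.
  move=> h0; pose K := 1 + h * c1 / c2.
  have K1 : 1 <= K by rewrite lerDl divr_ge0 ?mulr_ge0 ?ltW.
  have K0 : 0 < K by exact: lt_le_trans K1.
  have HQ n : Ex P (fun w => \sum_(i < n) step_cost theta c0 c1 c2 h (grid_state h) i w) <= c0 * h + K * Rr.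
    have iS : integ P (fun w => \sum_(i < n) step_cost theta c0 c1 c2 h (grid_state h) i w).
      apply: integ_sum => i; apply: (step_integ cP HB Hth ok).
      - exact: grid_state_val.
      - exact: grid_state_adapted.
    (* A measurable minorant of [loss], by [path_cost]; it is integrable because the risk is
       finite. *)
    pose g w := Num.max ((\sum_(i < n) step_cost theta c0 c1 c2 h (grid_state h) i w - c0 * h) / K) 0.
    have mg : measurable_fun setT g.
      apply: measurable_funrpos; apply: measurable_funM => //; apply: measurable_funB => //.
      exact: integ_meas iS.
    have g0 w : 0 <= g w by rewrite le_max lexx orbT.
    have gL w : ((g w)%:E <= loss w)%E.
      have [x0|x0] := leP ((\sum_(i < n) step_cost theta c0 c1 c2 h (grid_state h) i w - c0 * h) / K) 0.
        by rewrite /g max_r.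
      rewrite /g max_l ?(ltW x0)//; have := path_cost h0 n w; rewrite -/K.
      have := L0 w; case: (loss w) => [l| |] l0; last 2 first.
      - by move=> _; rewrite leey.
      - by rewrite leeNy_eq in l0.
      by move=> ll; rewrite lee_fin ler_pdivrMr// lerBlDl (mulrC l) -lee_fin EFinD EFinM.
    have ig : integ P g.
      apply/integrableP; split; first exact/measurable_EFinP.
      apply: le_lt_trans Rlt; rewrite riskE; apply: ge0_integral_mono => w _.
        exact: abse_ge0.
      by rewrite gee0_abs ?lee_fin//; exact: gL.
    have eg : Ex P g <= Rr.
      by rewrite -lee_fin EFin_Ex// -RE riskE; apply: ge0_integral_mono => w _; [rewrite lee_fin|exact: gL].
    apply: (@le_trans _ _ (Ex P (fun w => c0 * h + K * g w))).
      apply: Ex_le => //; first by apply: integD; [exact: integ_cst|exact: integZ].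
      move=> w; rewrite -lerBlDl -ler_pdivrMl// mulrC.
      by rewrite le_max lexx.
    rewrite ExD; [|exact: integ_cst|exact: integZ].
    by rewrite Ex_cst ExZ// lerD2l ler_pM2l.
  have low := grid_lower_bound cP HB Hth p0 p1 mu0 c00 c10 ok h0 (@grid_state_val h)
     (@grid_state_adapted h h0) (@grid_state_stop h h0) HQ.
  have T0 : natF X 0 setT by exact: (@measurableT _ (g_sigma_algebraType _)).
  (* The grid bound concerns M h; one further step from 0 to h costs another c0 h, which explains 2
     c0 h in [key]. *)
  have := U_step HB Hth p0 p1 ok (lexx 0) h0 T0.
  have keE : 2 * ke * mu ^+ 2 = c0 by field; rewrite gt_eqF.
  have iU : integ P (fun w => Uf (M h w)).
    have [K2 K20 HK2] := Vf_bounded ok.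
    apply: (@integ_bounded _ _ _ _ K2).
      by apply: (measurableT_comp (measurable_Uf k ke B A)); apply: measurable_Mt => //; exact: ltW.
    move=> w; have b := Mt_bnd Bm mu p0 p1 h w.
    rewrite ger0_norm; last exact: (Uf_ge0 ok).
    by apply: le_trans (HK2 _ b); exact: (Uf_le_Vf ok).
  rewrite subr0 keE Ex_indic// probability_setT mulr1.
  rewrite (_ : (fun w => \1_setT w * _) = (fun w => Uf (M h w) - cst (Uf (2 * p - 1)) w)); last first.
    by apply/funext => w; rewrite indicT mul1r (Mt_start mu HB).
  rewrite ExB//; last exact: integ_cst.
  rewrite Ex_cst => up; move: low up.
  move: (Ex P _) (Uf _) => x y; rewrite -/K; move: (K * Rr) => z; lra.
apply/ler_addgt0Pr => e e0.
(* [key] is used at h = e / C, where C - 1 is the coefficient of h in its bound. *)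
pose C := 2 * c0 + c1 / c2 * Rr + 1.
have C0 : 0 < C.
  rewrite ltr_wpDl// addr_ge0//; first by rewrite mulr_ge0 ?(ltW c00).
  by rewrite mulr_ge0// divr_ge0 ?(ltW c10) ?(ltW c20).
have eC : 0 < e / C by rewrite divr_gt0.
apply: le_trans (key _ eC) _.
have -> : 2 * c0 * (e / C) + (1 + e / C * c1 / c2) * Rr = Rr + e / C * (C - 1).
  by move: (e / C) => x; rewrite /C; field; rewrite gt_eqF.
rewrite lerD2l -[leRHS](divfK (lt0r_neq0 C0)) ler_pM2l//; lra.
Qed.

End LowerBound.

(** * Hitting times *)

Section Hitting.
Context {R : realType}.

Definition hit (sg : \bar R) (h : R -> R) : \bar R :=
  ereal_inf [set t%:E | t in [set t : R | (sg <= t%:E)%E /\ 0 <= h t]].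

Lemma hit_ge sg h : (sg <= hit sg h)%E.
Proof. by apply/ereal_infP => _ [t [st _] <-]. Qed.

Lemma hit_le sg h t : (sg <= t%:E)%E -> 0 <= h t -> (hit sg h <= t%:E)%E.
Proof. by move=> st ht; apply: ereal_inf_lbound; exists t. Qed.

Lemma hit_before sg h t : (sg <= t%:E)%E -> (t%:E < hit sg h)%E -> h t < 0.
Proof. by move=> st; rewrite ltNge => th; rewrite ltNge; apply: contra th; exact: hit_le. Qed.

(** If h were negative at the infimum, it would stay negative for a while, against the choice of the
    infimum. *)
Lemma hit_attained sg h : continuous h -> (0 <= sg)%E -> (hit sg h < +oo)%E ->
  exists t, hit sg h = t%:E /\ 0 <= h t.
Proof.
move=> hc s0 hlt; have h0 : (0 <= hit sg h)%E by exact: le_trans (hit_ge sg h).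
have hf : hit sg h \is a fin_num by rewrite ge0_fin_numE.
pose t0 := fine (hit sg h); have hE : hit sg h = t0%:E by rewrite fineK.
exists t0; split => //; rewrite leNgt; apply/negP => ht0.
have /cvgrPdist_lt/(_ (- h t0)) := hc t0.
rewrite oppr_gt0 => /(_ ht0) [e /= e0 He].
have : (hit sg h < (t0 + e)%:E)%E by rewrite hE lte_fin ltrDl.
move=> /ereal_inf_lt [_ [t [st ht] <-]]; rewrite lte_fin => te.
have t0t : t0 <= t by rewrite -lee_fin -hE; exact: hit_le.
have := He t; rewrite /ball /= => /(_ _)/wrap[].
  by rewrite distrC ger0_norm ?subr_ge0// ltrBlDl.
by move=> /ltr_normlP[+ _]; lra.
Qed.

(** A positive value at t would by continuity occur shortly before t, still after sg. *)
Lemma hit_value sg h t : continuous h -> (0 <= sg)%E -> (sg < t%:E)%E ->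
  hit sg h = t%:E -> h t = 0.
Proof.
move=> hc s0 st tE; have [t' []] := hit_attained hc s0 ltac:(by rewrite tE ltry).
rewrite tE => -[<-] ht; apply/eqP; rewrite eq_le ht andbT leNgt; apply/negP => ht0.
have sf : sg \is a fin_num by rewrite ge0_fin_numE//; apply: (lt_trans st); rewrite ltry.
move: st; rewrite -(fineK sf) lte_fin => st.
have /cvgrPdist_lt/(_ _ ht0) := hc t; move=> [e /= e0 He].
have m1 : Num.max (fine sg) (t - e) < t by rewrite gt_max st gtrDl oppr_lt0.
pose u := (Num.max (fine sg) (t - e) + t) / 2.
have [u1 u2] : Num.max (fine sg) (t - e) < u /\ u < t.
  by rewrite /u; move: (Num.max _ _) m1 => m m1; split; lra.
move: u1; rewrite gt_max => /andP[u1 u3].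
have := He u; rewrite /ball /= => /(_ _)/wrap[].
  by rewrite gtr0_norm ?subr_gt0// ltrBlDr -ltrBlDl.
have : h u < 0 by apply: (@hit_before sg); rewrite ?tE ?lte_fin// -(fineK sf) lee_fin ltW.
by move=> hu /ltr_normlP[_]; lra.
Qed.

(** A countable description of hitting before t: h attains its maximum on [sg, t], so it reaches 0
    there as soon as it exceeds each - 1 / (n + 1). The end point t is listed apart because the
    rationals are taken strictly before it. *)
Lemma hit_leP sg h t : continuous h -> (0 <= sg)%E ->
  (hit sg h <= t%:E)%E <-> forall n : nat,
    (exists q : rat, [/\ ratr q < t, (sg <= (ratr q)%:E)%E & - n.+1%:R^-1 < h (ratr q)]) \/
    ((sg <= t%:E)%E /\ - n.+1%:R^-1 < h t).
Proof.
move=> hc s0; split=> [ht n|H].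
  have [t0 [t0E ht0]] : exists t0, hit sg h = t0%:E /\ 0 <= h t0.
    by apply: hit_attained => //; apply: le_lt_trans ht _; rewrite ltry.
  have n0 : (0 : R) < n.+1%:R^-1 by rewrite invr_gt0.
  have st0 : (sg <= t0%:E)%E by rewrite -t0E; exact: hit_ge.
  move: ht; rewrite t0E lee_fin le_eqVlt => /orP[/eqP<-|t0t].
    by right; split => //; move: n0 ht0; move: (_^-1) (h t0) => x y; lra.
  left; have /cvgrPdist_lt/(_ _ n0) := hc t0.
  move=> [e /= e0 He].
  have [q] := @rat_in_itvoo R t0 (Num.min t (t0 + e)) ltac:(by rewrite lt_min t0t ltrDl).
  rewrite in_itv/= lt_min => /and3P[q1 q2 q3]; exists q; split => //.
    by apply: (le_trans st0); rewrite lee_fin ltW.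
  have := He (ratr q); rewrite /ball /= => /(_ _)/wrap[].
    by rewrite distrC gtr0_norm ?subr_gt0// ltrBlDl.
  move=> /ltr_normlP[_]; move: n0 ht0; move: (_^-1) (h t0) (h (ratr q)) => x y z; lra.
have {}H n : exists s, [/\ s <= t, (sg <= s%:E)%E & - n.+1%:R^-1 < h s].
  case: (H n) => [[q [qt sq hq]]|[st hq]]; first by exists (ratr q); split => //; exact: ltW.
  by exists t.
have sf : sg \is a fin_num.
  by have [s [_ ss _]] := H 0%N; rewrite ge0_fin_numE//; apply: le_lt_trans ss _; rewrite ltry.
pose s1 := fine sg; have sE : sg = s1%:E by rewrite fineK.
have st : s1 <= t.
  by have [s [s2 + _]] := H 0%N; rewrite sE lee_fin => /le_trans; apply.
have [c cI hmax] := EVT_max st (continuous_subspaceT hc).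
move: cI; rewrite in_itv/= => /andP[c1 c2].
apply: le_trans (_ : (c%:E <= _)%E); last by rewrite lee_fin.
apply: hit_le; first by rewrite sE lee_fin.
rewrite leNgt; apply/negP => hc0.
have hc1 : 0 < - h c by rewrite oppr_gt0.
have [n hn] := @ltr_add_invr R 0 (- h c) hc1.
have [s [s2 s3 s4]] := H n; have := hmax s.
rewrite in_itv/= s2 -lee_fin -sE s3 => /(_ erefl).
by move: hn s4; rewrite add0r; move: (_^-1) (h s) (h c) => x y z; lra.
Qed.

End Hitting.

Section Adapted.
Context {R : realType} {d : measure_display} {T : measurableType d}.
Variables (Bm : R -> T -> R) (theta : T -> R) (mu : R).
Local Notation X := (obs Bm theta mu).
Local Notation natG t := [set E | exists s, 0 <= s <= t /\
         exists2 A, measurable A & E = X s @^-1` A].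
Local Notation natT t := (g_sigma_algebraType (natG t)).

(** [hit_leP] looks only at countably many times up to t, so the event lies in the raw past. *)
Lemma hit_adapted (sg : T -> \bar R) (h : R -> T -> R) :
  (forall w, continuous (h^~ w)) -> (forall w, 0 <= sg w)%E ->
  (forall t, 0 <= t -> natF X t [set w | (sg w <= t%:E)%E]) ->
  (forall t a, 0 <= t -> natF X t [set w | a < h t w]) ->
  forall t, 0 <= t -> natF X t [set w | (hit (sg w) (h^~ w) <= t%:E)%E].
Proof.
move=> hc s0 sA hA t t0.
pose Q (n : nat) (q : rat) : set T := if 0 <= (ratr q : R) < t then
   [set w | (sg w <= (ratr q)%:E)%E] `&` [set w | - n.+1%:R^-1 < h (ratr q) w] else set0.
rewrite (_ : [set w | _] = \bigcap_(n : nat) ((\bigcup_(q : rat) Q n q) `|`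
   ([set w | (sg w <= t%:E)%E] `&` [set w | - n.+1%:R^-1 < h t w]))); last first.
  apply/seteqP; split => w /=.
    move=> /(hit_leP _ (hc w) (s0 w)) H n _; case: (H n) => [[q [q1 q2 q3]]|]; last by right.
    left; exists q => //; rewrite /Q ifT//; rewrite q1 andbT -lee_fin.
    exact: le_trans (s0 w) q2.
  move=> H; apply/(hit_leP _ (hc w) (s0 w)) => n; case: (H n I) => [[q _]|]; last by right.
  by rewrite /Q; case: ifPn => // /andP[_ qt] [h1 h2]; left; exists q.
apply: (@bigcapT_measurable _ (natT t)) => n; apply: (@measurableU _ (natT t)).
  apply: (@bigcupT_measurable_rat _ (natT t)) => q; rewrite /Q; case: ifPn => [/andP[q0 qt]|_]; last first.
    exact: (@measurable0 _ (natT t)).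
  apply: (@measurableI _ (natT t)).
    by apply: (natF_mono (ltW qt)); exact: sA.
  by apply: (natF_mono (ltW qt)); exact: hA.
by apply: (@measurableI _ (natT t)); [exact: sA|exact: hA].
Qed.

End Adapted.

(** * The candidate rule in terms of hitting times *)

Section Star.
Context {R : realType} {dd : measure_display} {T : measurableType dd}.
Variables (P : probability T R) (Bm : R -> T -> R) (theta : T -> R) (mu : R).
Variables (B A : R).
Hypothesis HB : BM_indep P Bm theta.
Hypothesis Hth : forall w, theta w = 1 \/ theta w = -1.
Local Notation X := (obs Bm theta mu).
Local Notation p := (prior P theta).
Local Notation M := (Mt P Bm theta mu).
Hypotheses (B0 : 0 < B) (A0 : 0 < A).
Local Notation natG t := [set E | exists s, 0 <= s <= t /\
         exists2 A, measurable A & E = X s @^-1` A].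
Local Notation natT t := (g_sigma_algebraType (natG t)).
Local Notation tau := (tau_star M A B).
Local Notation d := (d_star M A).

(* Frozen on negative times, so that the paths are continuous on the whole line. *)
Definition Mx (t : R) (w : T) : R := M (Num.max t 0) w.

Lemma MxE t w : 0 <= t -> Mx t w = M t w.
Proof. by move=> t0; rewrite /Mx max_l. Qed.

Lemma Mx_cont w : continuous (Mx^~ w).
Proof.
have p0 := prior_ge0 P theta; have p1 := prior_le1 HB Hth.
move=> t; have -> : Mx^~ w = (fun t => 1 - 2 * (1 - p) * (p * expR (2 * mu * (mu * theta w * Num.max t 0 + Bm (Num.max t 0) w)) + 1 - p)^-1).
  by [].
have cm : Num.max s 0 @[s --> t] --> Num.max t 0.
  apply: (@continuous_max R R (@idfun R) (cst 0) t); first exact: cvg_id.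
  exact: cvg_cst.
have cB : Bm (Num.max s 0) w @[s --> t] --> Bm (Num.max t 0) w.
  have [_ h _ _ _] := HB; have /subspace_continuousP h' := h w.
  have m0 : (0 : R) <= Num.max t 0 by rewrite le_max lexx orbT.
  move=> Q /(h' _ m0) hQ; have hq : nbhs t (fun s => 0 <= Num.max s 0 -> Q (Bm (Num.max s 0) w)).
    exact: (cm _ hQ).
  change (nbhs t (fun s => Q (Bm (Num.max s 0) w))); apply: filterS hq => s; apply.
  by rewrite le_max lexx orbT.
apply: cvgB; first exact: cvg_cst.
apply: cvgM; first exact: cvg_cst.
apply: cvgV.
  have e0 : 0 < expR (2 * mu * (mu * theta w * Num.max t 0 + Bm (Num.max t 0) w)) by exact: expR_gt0.
  (* A deterministic theta is allowed here. The denominator is an exponential if p = 1, and at least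
     1 - p > 0 otherwise. *)
  rewrite -addrA; have [->|p1'] := eqVneq p 1; first by rewrite subrr addr0 mul1r gt_eqF.
  rewrite gt_eqF// ltr_wpDl ?mulr_ge0 ?(ltW e0)// subr_gt0 lt_neqAle p1'.
  exact: p1.
apply: cvgB; last exact: cvg_cst.
apply: cvgD; last exact: cvg_cst.
apply: cvgM; first exact: cvg_cst.
apply: continuous_cvg; first exact: continuous_expR.
apply: cvgM; first exact: cvg_cst.
apply: cvgD; last exact: cB.
by apply: cvgM; [exact: cvg_cst|exact: cm].
Qed.

Lemma Mx_natF t (U : set R) : 0 <= t -> measurable U -> natF X t [set w | U (Mx t w)].
Proof.
move=> t0 mU; apply: ((g_sigma_measurable_preimage _ (Mx t)).2 _ U mU).
have -> : Mx t = M t by apply/funext => w; exact: MxE.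
by apply: measurable_Mt_nat; rewrite t0 lexx.
Qed.

Lemma tau0E w : tau 0%N w = hit 0 (fun t => `|Mx t w| - A).
Proof.
rewrite /= /tau0_star /hit; congr ereal_inf; apply/seteqP; split => _ [t ht <-]; exists t => //.
  by move: ht => /= [t0 hA]; rewrite lee_fin MxE// subr_ge0.
by move: ht => /= []; rewrite lee_fin => t0; rewrite MxE// subr_ge0.
Qed.

Let cA w : continuous (fun t => `|Mx t w| - A).
Proof.
move=> t; apply: cvgB; last exact: cvg_cst.
by apply: cvg_norm; exact: Mx_cont.
Qed.

Lemma tau0_ge0 w : (0 <= tau 0%N w)%E.
Proof. by rewrite tau0E; exact: hit_ge. Qed.

Lemma tau0_attained w : (tau 0%N w < +oo)%E ->
  exists t, [/\ tau 0%N w = t%:E, 0 <= t & A <= `|M t w|].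
Proof.
move=> h; have h' := h; rewrite tau0E in h'.
have [t []] := hit_attained (cA (w := w)) (lexx 0%E) h'.
rewrite -tau0E => tE ht; exists t; have t0 : 0 <= t by rewrite -lee_fin -tE tau0_ge0.
by split => //; rewrite -subr_ge0 -MxE.
Qed.

Lemma d_val w : d w = 1 \/ d w = -1.
Proof.
rewrite /d_star; case E : (tau0_star M A w) => [r| |]; [|by left..].
have [|t [tE t0 ht]] := @tau0_attained w; first by rewrite /= E ltry.
move: tE; rewrite /= E => -[re]; subst r.
have : M t w != 0 by rewrite -normr_gt0 (lt_le_trans A0).
by rewrite neq_lt => /orP[/ltr0_sg|/gtr0_sg]; [right|left].
Qed.

(** The decision in force between tau m and tau (m + 1). *)
Definition dsg (m : nat) (w : T) : R := if odd m then - d w else d w.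

Lemma dsgE m w : dsg m w = if odd m then - d w else d w. Proof. by []. Qed.

Lemma dsgS m w : dsg m.+1 w = - dsg m w.
Proof. by rewrite /dsg /=; case: (odd m); rewrite ?opprK. Qed.

Lemma dsg_val m w : dsg m w = 1 \/ dsg m w = -1.
Proof. by rewrite /dsg; case: (odd m); case: (d_val w) => ->; rewrite ?opprK; auto. Qed.

Let N11 : (-1 : R) == 1 = false. Proof. by apply/negbTE/eqP => e; have : (-1 : R) = 1 := e; lra. Qed.

(** Turns the four cases of the rule into one: the posterior, signed by the new decision, reaches
    B. *)
Lemma star_condE m w t : star_cond M A B m w t = (B <= dsg m w * M t w).
Proof.
rewrite /star_cond /dsg; case: (d_val w) => ->; rewrite ?eqxx ?N11; case: (odd m);
  by rewrite ?opprK ?mulN1r ?mul1r// lerNr.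
Qed.

Lemma tauSE m w : (0 <= tau m w)%E -> tau m.+1 w = hit (tau m w) (fun t => dsg m.+1 w * Mx t w - B).
Proof.
move=> h0; rewrite /= /hit; congr ereal_inf; apply/seteqP; split => _ [t ht <-]; exists t => //;
  move: ht => /= [t1]; rewrite star_condE MxE ?subr_ge0//; by rewrite -lee_fin (le_trans h0).
Qed.

Lemma tau_ge0 m w : (0 <= tau m w)%E.
Proof.
by elim: m => [|m ih]; [exact: tau0_ge0|rewrite tauSE//; apply: (le_trans ih); exact: hit_ge].
Qed.

Lemma tau_nd m w : (tau m w <= tau m.+1 w)%E.
Proof. by rewrite tauSE ?tau_ge0//; exact: hit_ge. Qed.

Let cB m w : continuous (fun t => dsg m w * Mx t w - B).
Proof.
by move=> t; apply: cvgB; [apply: cvgM; [exact: cvg_cst|exact: Mx_cont]|exact: cvg_cst].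
Qed.

Lemma tauS_attained m w : (tau m.+1 w < +oo)%E ->
  exists t, [/\ tau m.+1 w = t%:E, 0 <= t & B <= dsg m.+1 w * M t w].
Proof.
move=> h; have h' := h; rewrite tauSE ?tau_ge0// in h'.
have [t []] := hit_attained (@cB m.+1 w) (tau_ge0 m w) h'.
rewrite -tauSE ?tau_ge0// => tE ht; exists t.
have t0 : 0 <= t by rewrite -lee_fin -tE tau_ge0.
by split => //; rewrite -subr_ge0 -MxE.
Qed.

Lemma tau0_before w t : 0 <= t -> (t%:E < tau 0%N w)%E -> `|M t w| < A.
Proof.
rewrite tau0E => t0 h; have := @hit_before _ 0 (fun t => `|Mx t w| - A) t.
by rewrite lee_fin => /(_ t0 h); rewrite MxE// subr_lt0.
Qed.

Lemma tauS_before m w t : (tau m w <= t%:E)%E -> (t%:E < tau m.+1 w)%E -> - B < dsg m w * M t w.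
Proof.
rewrite tauSE ?tau_ge0// => h1 h2.
have t0 : 0 <= t by rewrite -lee_fin (le_trans _ h1)// tau_ge0.
by have := hit_before h1 h2; rewrite MxE// dsgS mulNr; move: (_ * _) => x; lra.
Qed.

Definition dpos : set T := [set w | d w = 1].

(** The first decision is 1 when M reaches A before -A. The comparison of the two hitting times is
    made countable by a rational q between them, unless the lower level has not been hit by t. *)
Lemma dpos_tau0 t : 0 <= t -> natF X t (dpos `&` [set w | (tau 0%N w <= t%:E)%E]).
Proof.
move=> t0.
pose up w := hit 0 (fun t => Mx t w - A).
pose dn w := hit 0 (fun t => - Mx t w - A).
have cu w : continuous (fun t => Mx t w - A).
  by move=> s; apply: cvgB; [exact: Mx_cont|exact: cvg_cst].
have cd w : continuous (fun t => - Mx t w - A).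
  by move=> s; apply: cvgB; [apply: cvgN; exact: Mx_cont|exact: cvg_cst].
have s0 u : 0 <= u -> natF X u [set w : T | (0%:E <= u%:E :> \bar R)%E].
  move=> u0; rewrite (_ : [set w | _] = setT); first exact: (@measurableT _ (natT u)).
  by apply/seteqP; split => w //= _; rewrite lee_fin.
have mup u : 0 <= u -> natF X u [set w | (up w <= u%:E)%E].
  apply: (@hit_adapted _ _ _ _ _ _ (cst 0%E) (fun t w => Mx t w - A)) => //.
  move=> r a r0; rewrite (_ : [set w | _] = [set w | `]a + A, +oo[%classic (Mx r w)]).
    by apply: Mx_natF => //; exact: measurable_itv.
  by apply/seteqP; split => w /=; rewrite in_itv/=; move: (Mx r w) => x; lra.
have mdn u : 0 <= u -> natF X u [set w | (dn w <= u%:E)%E].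
  apply: (@hit_adapted _ _ _ _ _ _ (cst 0%E) (fun t w => - Mx t w - A)) => //.
  move=> r a r0; rewrite (_ : [set w | _] = [set w | `]-oo, - (a + A)[%classic (Mx r w)]).
    by apply: Mx_natF => //; exact: measurable_itv.
  by apply/seteqP; split => w /=; rewrite in_itv/=; move: (Mx r w) => x; lra.
have mdn' s' : 0 <= s' -> natF X s' [set w | (s'%:E < dn w)%E].
  move=> s0'; rewrite (_ : [set w | _] = ~` [set w | (dn w <= s'%:E)%E]).
    by apply: (@measurableC _ (natT s')); exact: mdn.
  by apply/seteqP; split => w /=; rewrite ltNge => /negP.
pose Q (q : rat) : set T := if 0 <= (ratr q : R) <= t then
  [set w | (up w <= (ratr q)%:E)%E] `&` [set w | ((ratr q)%:E < dn w)%E] else set0.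
rewrite (_ : _ `&` _ = [set w | (up w <= t%:E)%E] `&`
   ([set w | (t%:E < dn w)%E] `|` \bigcup_(q : rat) Q q)).
  apply: (@measurableI _ (natT t)); first exact: mup.
  apply: (@measurableU _ (natT t)); first exact: mdn'.
  apply: (@bigcupT_measurable_rat _ (natT t)) => q; rewrite /Q.
  case: ifPn => [/andP[q0 qt]|_]; last exact: (@measurable0 _ (natT t)).
  by apply: (@measurableI _ (natT t)); apply: (natF_mono qt); [exact: mup|exact: mdn'].
have ge w s : A <= `|M s w| -> 0 <= s -> (tau 0%N w <= s%:E)%E.
  by move=> hs s0'; rewrite tau0E; apply: hit_le; rewrite ?lee_fin// MxE// subr_ge0.
apply/seteqP; split => w /=.
  move=> [dw tw].
  have [|s [sE s0' sA]] := @tau0_attained w; first by apply: (le_lt_trans tw); rewrite ltry.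
  move: dw; rewrite /dpos /= /d_star -/(tau 0%N w) sE => dw.
  have Ms : 0 < M s w.
    by rewrite ltNge; apply/negP; rewrite le_eqVlt => /orP[/eqP h|/ltr0_sg h];
      move: dw; rewrite h ?sgr0 => h'; lra.
  rewrite gtr0_norm// in sA.
  have us : (up w <= s%:E)%E by apply: hit_le; rewrite ?lee_fin// MxE// subr_ge0.
  move: tw; rewrite -[tau0_star M A w]/(tau 0%N w) sE lee_fin => st.
  have sd : (s%:E < dn w)%E.
    have [->|] := eqVneq (dn w) +oo%E; first by rewrite ltry.
    rewrite -ltey => dlt.
    have [r [rE]] := hit_attained (cd w) (lexx 0%E) dlt; rewrite -/(dn w) in rE.
    have r0 : 0 <= r by rewrite -lee_fin -rE; exact: hit_ge.
    rewrite MxE// rE lte_fin => hr; rewrite lt_neqAle; apply/andP; split.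
      apply/eqP => e; move: hr; rewrite -e; have := A0; move: sA; move: (M s w) => x; lra.
    rewrite -lee_fin -sE; apply: ge => //.
    by rewrite ler_normr; apply/orP; right; move: hr; move: (M r w) => x; lra.
  split; first by apply: (le_trans us); rewrite lee_fin.
  have [td|] := ltP t%:E (dn w); first by left.
  move=> dt; right.
  have [r rE] : exists r, dn w = r%:E.
    exists (fine (dn w)); rewrite fineK// ge0_fin_numE; last exact: hit_ge.
    by apply: (le_lt_trans dt); rewrite ltry.
  move: sd dt; rewrite rE lte_fin lee_fin => sr rt.
  have [q] := rat_in_itvoo sr; rewrite in_itv/= => /andP[q1 q2].
  exists q => //; rewrite /Q ifT; last by apply/andP; split; apply/ltW; [exact: le_lt_trans q1|exact: lt_le_trans q2 rt].
  split => /=; last by rewrite rE lte_fin.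
  by apply: (le_trans us); rewrite lee_fin ltW.
move=> [ut H].
have ud : (up w < dn w)%E.
  case: H => [|[q _]]; first exact: le_lt_trans.
  by rewrite /Q; case: ifP => // _ [] /=; exact: le_lt_trans.
have ult : (up w < +oo)%E by apply: le_lt_trans ut _; rewrite ltry.
have [s [sE]] := hit_attained (cu w) (lexx 0%E) ult; rewrite -/(up w) in sE.
have s0' : 0 <= s by rewrite -lee_fin -sE; exact: hit_ge.
rewrite MxE// subr_ge0 => sA.
have ts : (tau 0%N w <= s%:E)%E by apply: ge => //; rewrite ler_normr sA.
rewrite -sE in ts; split; last exact: le_trans ts ut.
have [|r [rE r0 rA]] := @tau0_attained w; first by apply: (le_lt_trans ts).
rewrite /dpos /= /d_star -/(tau 0%N w) rE; apply: gtr0_sg.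
move: rA; rewrite ler_normr => /orP[|h]; first exact: lt_le_trans.
exfalso; have : (dn w <= r%:E)%E by apply: hit_le; rewrite ?lee_fin// MxE// subr_ge0.
by rewrite -rE => /le_lt_trans/(_ (le_lt_trans ts ud)); rewrite ltxx.
Qed.

End Star.

Section StarRule.
Context {R : realType} {dd : measure_display} {T : measurableType dd}.
Variables (P : probability T R) (Bm : R -> T -> R) (theta : T -> R) (mu : R).
Variables (B A : R).
Hypothesis HB : BM_indep P Bm theta.
Hypothesis Hth : forall w, theta w = 1 \/ theta w = -1.
Local Notation X := (obs Bm theta mu).
Local Notation M := (Mt P Bm theta mu).
Local Notation Mx := (Mx P Bm theta mu).
Hypotheses (B0 : 0 < B) (A0 : 0 < A).
Local Notation natG t := [set E | exists s, 0 <= s <= t /\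
         exists2 A, measurable A & E = X s @^-1` A].
Local Notation natT t := (g_sigma_algebraType (natG t)).
Local Notation infT := (g_sigma_algebraType [set E | exists s, 0 <= s /\
         exists2 A, measurable A & E = X s @^-1` A]).
Local Notation tau := (tau_star M A B).
Local Notation d := (d_star M A).
Local Notation dsg := (dsg P Bm theta mu A).
Let d_val w : d w = 1 \/ d w = -1. Proof. exact: (d_val mu B HB Hth A0). Qed.
Let tau_ge0 m w : (0 <= tau m w)%E. Proof. exact: (tau_ge0 mu B HB Hth A0). Qed.
Let tau_le m n w : (m <= n)%N -> (tau m w <= tau n w)%E.
Proof. exact: (tau_mono (tau_nd mu B HB Hth A0 ^~ w)). Qed.
Let N11 : (-1 : R) = 1 -> False. Proof. by move=> e; have : (-1 : R) = 1 := e; lra. Qed.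

Lemma tau0_adapted t : 0 <= t -> natF X t [set w | (tau 0%N w <= t%:E)%E].
Proof.
rewrite (_ : [set w | _] = [set w | (hit 0 (fun t => `|Mx t w| - A)%R <= t%:E)%E]); last first.
  by apply/seteqP; split => w; rewrite /mkset tau0E.
apply: (@hit_adapted _ _ _ _ _ _ (cst 0%E) (fun t w => `|Mx t w| - A)) => //.
- move=> w u; apply: cvgB; last exact: cvg_cst.
  by apply: cvg_norm; exact: (Mx_cont HB Hth).
- move=> u u0; rewrite (_ : [set w | _] = setT); first exact: (@measurableT _ (natT u)).
  by apply/seteqP; split => w //= _; rewrite lee_fin.
- move=> u a u0.
  apply: (@Mx_natF _ _ _ P Bm theta mu u [set x | a < `|x| - A] u0).
  rewrite (_ : [set x | _] = (fun x => `|x| - A) @^-1` `]a, +oo[); last first.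
    by apply/seteqP; split => x /=; rewrite in_itv/= andbT.
  have m : measurable_fun setT (fun x : R => `|x| - A) by exact: measurable_funB.
  by rewrite -[X in measurable X]setTI; apply: m => //; exact: measurable_itv.
Qed.

Lemma dset_tau0 e t : e = 1 \/ e = -1 -> 0 <= t ->
  natF X t ([set w | d w = e] `&` [set w | (tau 0%N w <= t%:E)%E]).
Proof.
move=> he t0; have h1 := dpos_tau0 B HB Hth A0 t0.
case: he => ->; first exact: h1.
rewrite (_ : _ `&` _ = [set w | (tau 0%N w <= t%:E)%E] `\`
   (dpos P Bm theta mu A `&` [set w | (tau 0%N w <= t%:E)%E])).
  rewrite setDE; apply: (@measurableI _ (natT t)); first exact: tau0_adapted.
  by apply: (@measurableC _ (natT t)); exact: h1.
apply/seteqP; split => w /=.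
  by move=> [dw tw]; split => // -[dw' _]; apply: N11; rewrite -dw -dw'.
move=> [tw h]; split => //; case: (d_val w) => // dw; exfalso; by apply: h; split.
Qed.

(** The level awaited in stage m depends on the random sign [d]. With the sign frozen it is a
    hitting time, and the event of each sign is known at tau 0, hence by t. *)
Lemma tau_adapted m t : 0 <= t -> natF X t [set w | (tau m w <= t%:E)%E].
Proof.
elim: m t => [|m ih] t t0; first exact: tau0_adapted.
pose H e := [set w | (hit (tau m w) (fun t => (if odd m.+1 then - e else e) * Mx t w - B)%R <= t%:E)%E].
have mH e : natF X t (H e).
  apply: (@hit_adapted _ _ _ _ _ _ (tau m) (fun t w => (if odd m.+1 then - e else e) * Mx t w - B)) => //.
    by move=> w u; apply: cvgB; [apply: cvgM; [exact: cvg_cst|exact: (Mx_cont HB Hth)]|exact: cvg_cst].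
  move=> u a u0.
  apply: (@Mx_natF _ _ _ P Bm theta mu u [set x | a < (if odd m.+1 then - e else e) * x - B] u0).
  rewrite (_ : [set x | _] = (fun x => (if odd m.+1 then - e else e) * x - B) @^-1` `]a, +oo[); last first.
    by apply/seteqP; split => x /=; rewrite in_itv/= andbT.
  have mf : measurable_fun setT (fun x : R => (if odd m.+1 then - e else e) * x - B).
    by apply: measurable_funB => //; exact: measurable_funM.
  by rewrite -[X in measurable X]setTI; apply: mf => //; exact: measurable_itv.
rewrite (_ : [set w | _] =
  ([set w | d w = 1] `&` [set w | (tau 0%N w <= t%:E)%E] `&` H 1) `|`
  ([set w | d w = -1] `&` [set w | (tau 0%N w <= t%:E)%E] `&` H (-1))).
  apply: (@measurableU _ (natT t)).
    by apply: (@measurableI _ (natT t)); [apply: dset_tau0 => //; left|exact: mH].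
  by apply: (@measurableI _ (natT t)); [apply: dset_tau0 => //; right|exact: mH].
have He w : (tau m.+1 w <= t%:E)%E <-> H (d w) w by rewrite /H /mkset tauSE.
have h0 w : (tau m.+1 w <= t%:E)%E -> (tau 0%N w <= t%:E)%E.
  exact: le_trans (tau_le w (leq0n m.+1)).
apply/seteqP; split => w.
  move=> h; have h' := (He w).1 h; have h'' := h0 _ h.
  by case: (d_val w) => dw; rewrite dw in h'; [left|right].
by case=> -[[dw _]]; rewrite -dw => h; apply/He.
Qed.

Lemma stage_adapted e m t : e = 1 \/ e = -1 -> 0 <= t ->
  natF X t ([set w | d w = e] `&` [set w | (tau m w <= t%:E)%E]).
Proof.
move=> he t0.
rewrite (_ : _ `&` _ = ([set w | d w = e] `&` [set w | (tau 0%N w <= t%:E)%E]) `&`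
  [set w | (tau m w <= t%:E)%E]).
  by apply: (@measurableI _ (natT t)); [exact: dset_tau0|exact: tau_adapted].
apply/seteqP; split => w /=; last by move=> [[]].
move=> [dw tw]; split => //; split => //; apply: le_trans tw.
exact: (tau_le w (leq0n m)).
Qed.

Let natF_FX t E : natF X t E -> FX P X t E.
Proof.
by move=> nE; apply: sub_completeF => u tu; apply: (natF_mono (ltW tu)).
Qed.

Let natF_inf t E : natF X t E -> measurable (E : set infT).
Proof.
apply: sub_sigma; apply: subset_trans (@sub_gen_smallest _ _ _).
by move=> F [s [/andP[s0 _] h]]; exists s.
Qed.

(** The second part comes from the default value: [d_star] is 1 when tau 0 is infinite. *)
Lemma dposE : [set w | d w = 1] =
  (\bigcup_(n : nat) ([set w | d w = 1] `&` [set w | (tau 0%N w <= n%:R%:E)%E])) `|`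
  \bigcap_(n : nat) ~` [set w | (tau 0%N w <= n%:R%:E)%E].
Proof.
apply/seteqP; split => w /=.
  move=> dw; have [[n hn]|h] := pselect (exists n, (tau 0%N w <= n%:R%:E)%E).
    by left; exists n.
  by right => n _ hn; apply: h; exists n.
case=> [[n _ [] //]|h].
rewrite /d_star; case E : (tau0_star M A w) => [r| |//]; last first.
  by have := tau_ge0 0%N w; rewrite /= E.
exfalso; apply: (h (Num.trunc r).+1) => //=; rewrite E lee_fin.
by have := Num.Theory.truncnS_gt r; exact: ltW.
Qed.

Lemma measurable_dpos : measurable [set w | d w = 1].
Proof.
rewrite dposE; apply: measurableU.
  apply: bigcup_measurable => n _; apply: (natF_meas HB (mu := mu) (t := n%:R)).
  by apply: dset_tau0; [left|].
apply: bigcap_measurable => // n _; apply: measurableC.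
by apply: (natF_meas HB (mu := mu) (t := n%:R)); exact: tau0_adapted.
Qed.

Lemma star_decision_rule : decision_rule P X tau d.
Proof.
split.
- by move=> n; split => // t t0; apply: natF_FX; exact: tau_adapted.
- by move=> n w; exact: (tau_nd mu B HB Hth A0).
- exact: d_val.
move=> U mU.
have E1 : d @^-1` U = (if `[< U 1 >] then [set w | d w = 1] else set0) `|`
    (if `[< U (-1) >] then [set w | d w = -1] else set0).
  apply/seteqP; split => w /=.
    by case: (d_val w) => dw; rewrite dw => h; [left|right]; rewrite asboolT.
  by case; case: asboolP => //= h ->.
have i1 : measurable ([set w | d w = 1] : set infT).
  rewrite dposE; apply: (@measurableU _ infT).
    apply: bigcup_measurable => n _; apply: (@natF_inf n%:R).
    by apply: dset_tau0; [left|].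
  apply: bigcap_measurable => // n _; apply: (@measurableC _ infT); apply: (@natF_inf n%:R).
  exact: tau0_adapted.
have iN : measurable ([set w | d w = -1] : set infT).
  rewrite (_ : [set w | _] = ~` [set w | d w = 1]); first exact: (@measurableC _ infT).
  apply/seteqP; split => w /=; first by move=> -> /N11.
  by case: (d_val w).
split.
  apply: sub_completeF; rewrite E1; apply: (@measurableU _ infT); case: ifP => // _;
    exact: (@measurable0 _ infT).
move=> t t0; apply: natF_FX; rewrite E1 setIUl; apply: (@measurableU _ (natT t)); case: ifP => _.
- by apply: dset_tau0; [left|].
- by rewrite set0I; exact: (@measurable0 _ (natT t)).
- by apply: dset_tau0; [right|].
- by rewrite set0I; exact: (@measurable0 _ (natT t)).
Qed.

(** At bounded switching times M would take values at least B and at most -B in turn, whereas its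
    path is continuous at their limit. *)
Lemma tau_unbounded w (s : R) : exists m, (s%:E < tau m w)%E.
Proof.
apply: contrapT => H.
have Ht m : (tau m w <= s%:E)%E.
  by rewrite leNgt; apply/negP => h; apply: H; exists m.
pose t m := fine (tau m w).
have tf m : tau m w = (t m)%:E.
  by rewrite /t fineK// ge0_fin_numE//; apply: le_lt_trans (Ht m) _; rewrite ltry.
have tnd : {homo t : m n / (m <= n)%N >-> m <= n}.
  by move=> m n mn; rewrite -lee_fin -!tf; exact: tau_le.
have tc : cvgn t.
  apply: nondecreasing_is_cvgn => //; exists s => _ [m _ <-].
  by rewrite -lee_fin -tf.
have c1 : Mx (t m) w @[m --> \oo] --> Mx (limn t) w.
  by apply: (@continuous_cvg _ _ _ _ _ t (Mx^~ w)); [exact: (Mx_cont HB Hth)|exact: tc].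
have c2 : Mx (t m.+1) w @[m --> \oo] --> Mx (limn t) w.
  by rewrite (cvg_shiftS (fun m => Mx (t m) w)).
have c3 : `|Mx (t m.+1) w - Mx (t m) w| @[m --> \oo] --> (0 : R).
  have := cvg_norm (cvgB c2 c1); rewrite subrr normr0; exact.
have hB m : B <= dsg m.+1 w * Mx (t m.+1) w.
  have [|r [rE r0 hr]] := @tauS_attained _ _ _ P Bm theta mu B A HB Hth A0 m w.
    by rewrite tf ltry.
  have <- : r = t m.+1 by apply/eqP; rewrite -eqe -rE tf.
  by rewrite MxE.
move/cvgrPdist_lt/(_ _ B0) : c3 => [n _ Hn].
have := Hn n.+1 (leqnSn n) => /=; rewrite sub0r normrN normr_id.
have := hB n; have := hB n.+1; rewrite (dsgS P Bm theta mu A n.+1).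
have B0' := B0.
move: (Mx _ w) (Mx _ w) => x y.
by case: (dsg_val mu B HB Hth A0 n.+1 w) => -> h1 h2; rewrite ltNge => /negP; apply;
  rewrite ler_normr; apply/orP; [right|left]; lra.
Qed.

End StarRule.

(** * The upper bound *)

Section GridCount.
Context {R : realType}.

(** For x >= 0, the minimum of x and s as a real number, also when x is infinite. *)
Definition cutoff (x : \bar R) (s : R) : R := if (s%:E <= x)%E then s else fine x.

Lemma cutoff_ge0 x s : (0 <= x)%E -> 0 <= s -> 0 <= cutoff x s.
Proof. by move=> x0 s0; rewrite /cutoff; case: ifP => // _; exact: fine_ge0. Qed.

Lemma cutoff_le x s : (0 <= x)%E -> cutoff x s <= s.
Proof.
rewrite /cutoff; case: (boolP (s%:E <= x)%E) => //; rewrite -ltNge.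
by case: x => [r| |] //=; rewrite lte_fin => /ltW.
Qed.

Lemma cutoff_fin (r s : R) : r <= s -> cutoff r%:E s = r.
Proof. by rewrite /cutoff lee_fin; case: ifP => //= h1 h2; apply/eqP; rewrite eq_le h1 h2. Qed.

Lemma cutoff_big x s : (s%:E <= x)%E -> cutoff x s = s.
Proof. by rewrite /cutoff => ->. Qed.

Lemma cutoff_lee x s : (0 <= x)%E -> ((cutoff x s)%:E <= x)%E.
Proof.
rewrite /cutoff; case: (boolP (s%:E <= x)%E) => //; rewrite -ltNge.
by case: x => [r| |].
Qed.

Lemma cutoff_mono x y s : (0 <= x)%E -> (x <= y)%E -> cutoff x s <= cutoff y s.
Proof.
move=> x0 xy; have y0 : (0 <= y)%E by exact: le_trans xy.
rewrite {2}/cutoff; case: (boolP (s%:E <= y)%E) => [_|]; first exact: cutoff_le.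
rewrite -ltNge => ys.
have yf : y \is a fin_num by rewrite ge0_fin_numE//; apply: (lt_trans ys); rewrite ltry.
by rewrite -lee_fin fineK//; apply: le_trans xy; exact: cutoff_lee.
Qed.

Lemma cutoff_le2 x s t : (0 <= x)%E -> 0 <= s -> s <= t -> cutoff x s <= cutoff x t.
Proof.
move=> x0 s0 st; rewrite {2}/cutoff; case: (boolP (t%:E <= x)%E) => [_|].
  by apply: le_trans (cutoff_le _ _) st.
rewrite -ltNge => xt.
have xf : x \is a fin_num by rewrite ge0_fin_numE//; apply: (lt_trans xt); rewrite ltry.
by rewrite -lee_fin fineK//; exact: cutoff_lee.
Qed.

(** Times h, this is x cut at n h and rounded up to the grid; see [gcount_cut]. *)
Definition gcount (h : R) (x : \bar R) (n : nat) : nat := \sum_(i < n) ((i%:R * h)%:E < x)%E.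

Variable h : R.
Hypothesis h0 : 0 < h.
Local Notation c := (gcount h).

Lemma gcount_le x n : (c x n <= n)%N.
Proof. by rewrite -[leqRHS]card_ord -sum1_card; apply: leq_sum => i _; case: (_ < _)%E. Qed.

Let gcountS x n : c x n.+1 = (c x n + ((n%:R * h)%:E < x)%E)%N.
Proof. by rewrite /gcount big_ord_recr. Qed.

Let gcount_full x n : ((n%:R * h)%:E < x)%E -> c x n = n.
Proof.
move=> hx; rewrite /gcount -[RHS]card_ord -sum1_card; apply: eq_bigr => i _.
rewrite (lt_trans _ hx)// lte_fin ltr_pM2r// ltr_nat; exact: ltn_ord.
Qed.

(** The grid points in [sg, rh[ have consecutive indices, from the count of sg to the count of rh,
    so the increments telescope. *)
Lemma gcount_telescope (sg rh : \bar R) (y : nat -> R) (v : R) n : (sg <= rh)%E ->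
  \sum_(i < n) (((sg <= (i%:R * h)%:E)%E && ((i%:R * h)%:E < rh)%E)%:R * (y i.+1 - y i + h * v)) =
  y (c rh n) - y (c sg n) + ((c rh n)%:R * h - (c sg n)%:R * h) * v.
Proof.
move=> sr; elim: n => [|n ih]; first by rewrite /gcount !big_ord0 subrr subrr mul0r addr0.
rewrite big_ord_recr/= ih !gcountS.
have [sn|ns] := leP sg (n%:R * h)%:E; have [nr|rn] := ltP (n%:R * h)%:E rh; rewrite /= ?mul0r ?addn0 ?addr0 ?mul1r//.
- by rewrite addn1 gcount_full// -natr1; ring.
- by rewrite gcount_full// gcount_full//; ring.
- by have := le_lt_trans rn (lt_le_trans ns sr); rewrite ltxx.
Qed.

Lemma gcount_cut x n : (0 <= x)%E -> cutoff x (n%:R * h) <= (c x n)%:R * h <= cutoff x (n%:R * h) + h.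
Proof.
move=> x0; elim: n => [|n ih].
  by rewrite /gcount big_ord0 !mul0r /cutoff ifT// lexx add0r ltW.
rewrite gcountS; have [nx|xn] := ltP (n%:R * h)%:E x.
  rewrite gcount_full// addn1 /=; apply/andP; split; first exact: cutoff_le.
  rewrite -[in leLHS]natr1 mulrDl mul1r lerD2r /cutoff; case: ifPn => [_|hx].
    by rewrite ler_pM2r// ler_nat.
  move: nx hx; case: (x) x0 => [r| |] //= _; last by rewrite leey.
  by rewrite lte_fin => /ltW.
rewrite addn0; suff -> : cutoff x (n.+1%:R * h) = cutoff x (n%:R * h) by [].
have [r xE] : exists r, x = r%:E.
  by exists (fine x); rewrite fineK// ge0_fin_numE//; apply: (le_lt_trans xn); rewrite ltry.
move: xn; rewrite xE lee_fin => rn; rewrite !cutoff_fin//.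
by apply: (le_trans rn); rewrite ler_pM2r// ler_nat.
Qed.

End GridCount.

(** * Optional stopping between two random times *)

Section Stage.
Context {R : realType} {dd : measure_display} {T : measurableType dd}.
Variables (P : probability T R).
Variables (sg rh : T -> \bar R) (G : set T) (Y : R -> T -> R) (v : T -> R) (K1 C K S : R).
Hypothesis sg0 : forall w, (0 <= sg w)%E.
Hypothesis sgrh : forall w, (sg w <= rh w)%E.
Hypothesis mY : forall t, 0 <= t -> measurable_fun setT (Y t).
Hypothesis Y_bnd : forall t w, 0 <= t -> `|Y t w| <= K1.
Hypothesis mv : measurable_fun setT v.
Hypothesis v_bnd : forall w, `|v w| <= C.
Hypothesis S0 : 0 < S.
Local Notation alive t := (G `&` [set w | (sg w <= t%:E)%E && (t%:E < rh w)%E]).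
Hypothesis mF : forall t, 0 <= t -> measurable (alive t).
Hypothesis step : forall t s, 0 <= t -> t < s -> s <= t + 1 ->
  Ex P (fun w => \1_(alive t) w * (Y s w - Y t w)) <=
  - ((s - t) * Ex P (fun w => \1_(alive t) w * v w)) + K * (s - t) ^+ 2.
Hypothesis Yc : forall w t, G w -> 0 <= t -> (sg w <= t%:E)%E -> (t%:E <= rh w)%E ->
  forall u : nat -> R, (forall n, 0 <= u n) -> u n @[n --> \oo] --> t -> Y (u n) w @[n --> \oo] --> Y t w.

Definition stage_gain (w : T) : R :=
  \1_G w * (Y (cutoff (rh w) S) w - Y (cutoff (sg w) S) w + (cutoff (rh w) S - cutoff (sg w) S) * v w).

Let rh0 w : (0 <= rh w)%E. Proof. exact: le_trans (sgrh w). Qed.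

Let N0 := Num.trunc S.
(** More steps than S, so that the mesh S / n_ is at most 1, as [step] requires. *)
Let n_ (N : nat) : nat := (N + N0.+1)%N.
Let h_ N : R := S / (n_ N)%:R.

Let n_pos N : (0 : R) < (n_ N)%:R. Proof. by rewrite ltr0n /n_ addnS. Qed.
Let h_pos N : 0 < h_ N. Proof. by rewrite divr_gt0. Qed.
Let nh N : (n_ N)%:R * h_ N = S. Proof. by rewrite /h_ mulrC divfK// gt_eqF. Qed.
Let h_le1 N : h_ N <= 1.
Proof.
rewrite ler_pdivrMr// mul1r; apply: le_trans (ltW (Num.Theory.truncnS_gt S)) _.
by rewrite ler_nat leq_addl.
Qed.

Let Z N w := \sum_(i < n_ N) (\1_(alive (i%:R * h_ N)) w *
   (Y (i.+1%:R * h_ N) w - Y (i%:R * h_ N) w) + h_ N * (\1_(alive (i%:R * h_ N)) w * v w)).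

Let ih N i : 0 <= i%:R * h_ N. Proof. by rewrite mulr_ge0// ltW. Qed.

Let Y_integ t : 0 <= t -> integ P (Y t).
Proof. by move=> t0; apply: (@integ_bounded _ _ _ _ K1); [exact: mY|move=> w; exact: Y_bnd]. Qed.

Let v_integ : integ P v. Proof. exact: (@integ_bounded _ _ _ _ C). Qed.

Let i1 N i : integ P (fun w => \1_(alive (i%:R * h_ N)) w * (Y (i.+1%:R * h_ N) w - Y (i%:R * h_ N) w)).
Proof. by apply: integ_indicM; [exact: mF|apply: integB; exact: Y_integ]. Qed.

Let i2 N i : integ P (fun w => \1_(alive (i%:R * h_ N)) w * v w).
Proof. by apply: integ_indicM; [exact: mF|exact: v_integ]. Qed.

Let i3 N i : integ P (fun w => h_ N * (\1_(alive (i%:R * h_ N)) w * v w)).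
Proof. by apply: integZ; exact: i2. Qed.

Let ExZ_le N : Ex P (Z N) <= K * S ^+ 2 / (n_ N)%:R.
Proof.
rewrite /Z Ex_sum; last by move=> i; apply: integD; [exact: i1|exact: i3].
apply: (@le_trans _ _ (\sum_(i < n_ N) K * h_ N ^+ 2)).
  apply: ler_sum => i _; rewrite ExD; [|exact: i1|exact: i3].
  rewrite ExZ; last exact: i2.
  have e : i.+1%:R * h_ N - i%:R * h_ N = h_ N by rewrite -natr1; ring.
  have := @step (i%:R * h_ N) (i.+1%:R * h_ N) (ih N i).
  rewrite e ltr_pM2r// ltr_nat ltnSn => /(_ erefl).
  have -> : i.+1%:R * h_ N <= i%:R * h_ N + 1 by rewrite -lerBlDl e.
  by move=> /(_ erefl); rewrite -lerBrDr [leRHS]addrC.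
rewrite sumr_const card_ord -mulr_natl le_eqVlt; apply/orP; left; apply/eqP.
by rewrite /h_; field; rewrite gt_eqF.
Qed.

Let ZE N w : Z N w = \1_G w * (Y ((gcount (h_ N) (rh w) (n_ N))%:R * h_ N) w
   - Y ((gcount (h_ N) (sg w) (n_ N))%:R * h_ N) w +
   ((gcount (h_ N) (rh w) (n_ N))%:R * h_ N - (gcount (h_ N) (sg w) (n_ N))%:R * h_ N) * v w).
Proof.
rewrite -(gcount_telescope (h_pos N) (fun i => Y (i%:R * h_ N) w) (v w) (n_ N) (sgrh w)).
rewrite /Z mulr_sumr; apply: eq_bigr => i _.
have -> : \1_(alive (i%:R * h_ N)) w = \1_G w *
   ((sg w <= (i%:R * h_ N)%:E)%E && ((i%:R * h_ N)%:E < rh w)%E)%:R :> R.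
  rewrite indicI /=; congr (_ * _); rewrite indicE; congr (_%:R).
  by rewrite [X in nat_of_bool X]asboolb.
by rewrite -!mulrA; move: (_%:R) (\1_G w) => a b; ring.
Qed.

Let n_cvg : (n_ N)%:R^-1 @[N --> \oo] --> (0 : R).
Proof.
have -> : (fun N => (n_ N)%:R^-1) = [sequence (@harmonic R) (n + N0)%N]_n.
  by apply/funext => N; rewrite /harmonic /n_ /= addnS.
by rewrite cvg_shiftn; exact: cvg_harmonic.
Qed.

Let gc_bnd N x : (0 <= x)%E -> 0 <= (gcount (h_ N) x (n_ N))%:R * h_ N <= S.
Proof.
move=> x0; rewrite ih /= -[leRHS](nh N) ler_pM2r// ler_nat; exact: gcount_le.
Qed.

Let gc_cvg x : (0 <= x)%E -> (gcount (h_ N) x (n_ N))%:R * h_ N @[N --> \oo] --> cutoff x S.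
Proof.
move=> x0; apply/cvgrPdist_le => e e0.
have hc : h_ N @[N --> \oo] --> (0 : R).
  rewrite -(mulr0 S); apply: cvgM; first exact: cvg_cst.
  exact: n_cvg.
move/cvgrPdist_le/(_ _ e0) : hc => [n _ Hn]; exists n => // N /Hn /=.
rewrite sub0r normrN gtr0_norm// => he; apply: le_trans he.
have := gcount_cut (h_pos N) (n_ N) x0; rewrite nh => /andP[g1 g2].
by rewrite distrC ger0_norm ?subr_ge0// lerBlDl.
Qed.

(** The n_ errors of size K (S / n_)^2 add up to order 1 / n_. Pathwise, the rounded times converge
    to the cut ones, where [Yc] gives continuity; it is asked only inside the stage, because a
    truncated value function jumps elsewhere. *)
Lemma stage_gain_le0 : integ P stage_gain /\ Ex P stage_gain <= 0.
Proof.
have mG0 N : measurable_fun setT (Z N).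
  by apply: (@integ_meas _ _ _ P); apply: integ_sum => i; apply: integD; [exact: i1|exact: i3].
have Zb N w : `|Z N w| <= K1 + K1 + S * C.
  have K10 : 0 <= K1 := le_trans (normr_ge0 _) (Y_bnd w (lexx 0)).
  have C0 : 0 <= C := le_trans (normr_ge0 _) (v_bnd w).
  have [Gw|Gw] := pselect (G w); rewrite ZE; last first.
    by rewrite indic_out// mul0r normr0 !addr_ge0// mulr_ge0// ltW.
  rewrite indic_in// mul1r; apply: (le_trans (ler_normD _ _)); apply: lerD.
    have /andP[a1 _] := gc_bnd N (rh0 w); have /andP[a2 _] := gc_bnd N (sg0 w).
    apply: (le_trans (ler_normB _ _)); apply: lerD; exact: Y_bnd.
  rewrite normrM; apply: ler_pM => //.
  have /andP[] := gc_bnd N (rh0 w); have /andP[] := gc_bnd N (sg0 w).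
  move: (_ * h_ N) (_ * h_ N) => a b a1 a2 b1 b2.
  by rewrite ler_norml; apply/andP; split; lra.
have Zc w : Z N w @[N --> \oo] --> stage_gain w.
  rewrite (_ : Z^~ w = fun N => \1_G w * (Y ((gcount (h_ N) (rh w) (n_ N))%:R * h_ N) w
   - Y ((gcount (h_ N) (sg w) (n_ N))%:R * h_ N) w +
   ((gcount (h_ N) (rh w) (n_ N))%:R * h_ N - (gcount (h_ N) (sg w) (n_ N))%:R * h_ N) * v w)); last first.
    by apply/funext => N; exact: ZE.
  rewrite /stage_gain; have [Gw|Gw] := pselect (G w); last first.
    by rewrite indic_out// mul0r; under eq_fun do rewrite mul0r; exact: cvg_cst.
  rewrite indic_in// mul1r; under eq_fun do rewrite mul1r.
  have cc := gc_cvg; have [sS|Ss] := leP (sg w) S%:E.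
    have S0' := ltW S0.
    have cs0 := cutoff_ge0 (sg0 w) S0'; have cr0 := cutoff_ge0 (rh0 w) S0'.
    have sgf : sg w = (cutoff (sg w) S)%:E.
      rewrite /cutoff; case: ifPn => [h|_]; first by apply/eqP; rewrite eq_le sS h.
      by rewrite fineK// ge0_fin_numE//; apply: (le_lt_trans sS); rewrite ltry.
    have sr := cutoff_mono S (sg0 w) (sgrh w).
    have gz N x : (0 <= x)%E -> 0 <= (gcount (h_ N) x (n_ N))%:R * h_ N.
      by move=> x0; case/andP: (gc_bnd N x0).
    apply: cvgD; last by apply: cvgM; [apply: cvgB; exact: cc|exact: cvg_cst].
    apply: cvgB.
      apply: (@Yc w _ Gw cr0 _ (cutoff_lee _ (rh0 w)) (fun N => (gcount (h_ N) (rh w) (n_ N))%:R * h_ N)).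
      - by rewrite [leLHS]sgf lee_fin.
      - by move=> N; exact: gz.
      - exact: cc.
    apply: (@Yc w _ Gw cs0 _ _ (fun N => (gcount (h_ N) (sg w) (n_ N))%:R * h_ N)).
    - by rewrite [leLHS]sgf.
    - by rewrite -sgf.
    - by move=> N; exact: gz.
    - exact: cc.
  (* A stage that starts after the horizon: both counts are full, and the gain is 0 on every
     grid. *)
  have rS : (S%:E <= rh w)%E by apply: le_trans (sgrh w); exact: ltW.
  rewrite (cutoff_big rS) (cutoff_big (ltW Ss)) !subrr mul0r addr0.
  rewrite (_ : (fun N => _) = cst 0); first exact: cvg_cst.
  apply/funext => N /=; have full x : (S%:E <= x)%E -> (gcount (h_ N) x (n_ N))%:R * h_ N = S.
    move=> Sx; have x0 : (0 <= x)%E by apply: le_trans Sx; rewrite lee_fin ltW.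
    have := gcount_cut (h_pos N) (n_ N) x0; rewrite nh (cutoff_big Sx) => /andP[g _].
    by apply/eqP; rewrite eq_le g andbT; case/andP: (gc_bnd N x0).
  by rewrite (full _ rS) (full _ (ltW Ss)) !subrr mul0r addr0.
have [i e] := Ex_cvg mG0 (integ_cst P (K1 + K1 + S * C)) Zb Zc.
split => //; apply: (ler_cvg_to e (l' := 0) (g := fun N => K * S ^+ 2 / (n_ N)%:R)); last first.
  by apply: nearW => N; exact: ExZ_le.
rewrite -(mulr0 (K * S ^+ 2)); apply: cvgM; first exact: cvg_cst.
exact: n_cvg.
Qed.

End Stage.

Section ValueContinuity.
Context {R : realType}.
Variables (k ke c2 B A : R).
Hypothesis ok : params_ok k ke c2 B A.
Local Notation vf := (vf k B).
Local Notation uf := (uf k ke B A).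
Local Notation vt := (vt k B).
Local Notation ut := (ut k ke B A).

Lemma LL_cont (x : R) : -1 < x < 1 -> {for x, continuous (@LL R)}.
Proof.
by move=> hx; apply/differentiable_continuous/derivable1_diffP; have [] := LL_deriv hx.
Qed.

Let vf_cont x : -1 < x < 1 -> {for x, continuous vf}.
Proof.
move=> hx; apply: cvgM; apply: cvgB; try exact: cvg_cst; first exact: cvg_id.
by apply: cvgM; [exact: cvg_cst|exact: LL_cont].
Qed.

Let uf_cont x : -1 < x < 1 -> {for x, continuous uf}.
Proof.
move=> hx; apply: cvgD; first exact: cvg_cst.
by apply: cvgM; [apply: cvgM; [exact: cvg_cst|exact: cvg_id]|exact: LL_cont].
Qed.

Lemma vt_cont x : - B <= x -> x < 1 -> {for x, continuous vt}.
Proof.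
move=> xB x1; have hx : -1 < x < 1 by have B1 := B_lt1 ok; apply/andP; split; lra.
change (vt y @[y --> x] --> vt x); rewrite (vt_vf ok xB x1).
have lx : LL x < LL (- B) + 1.
  have B1 := B_lt1 ok; have := @LL_decr R (- B) x ltac:(lra) xB x1.
  by move: (LL x) (LL (- B)) => a b; lra.
apply: cvg_trans (vf_cont hx); apply: near_eq_cvg.
near=> y; rewrite !vtE ifT//; near: y.
exact: (cvgr_lt _ (LL_cont hx) _ lx).
Unshelve. all: end_near. Qed.

Lemma ut_cont x : `|x| <= A -> {for x, continuous ut}.
Proof.
move=> xA; have A1 := A_lt1 ok; have hx : -1 < x < 1 by move: xA; rewrite ler_norml => /andP[]; lra.
change (ut y @[y --> x] --> ut x); rewrite (ut_uf ok xA).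
have lx : `|LL x| < LL (- A) + 1.
  have hA : -1 < A < 1 by have A0 := A_gt0 ok; apply/andP; split; lra.
  move: xA; rewrite ler_norml => /andP[x1 x2].
  have := @LL_decr R (- A) x ltac:(lra) x1 ltac:(lra).
  have := @LL_decr R x A ltac:(lra) x2 A1.
  rewrite LLN// ltr_norml; move: (LL x) (LL A) => a b h1 h2; apply/andP; split; lra.
apply: cvg_trans (uf_cont hx); apply: near_eq_cvg.
near=> y; rewrite !utE ifT//; near: y.
exact: (cvgr_lt _ (cvg_norm (LL_cont hx)) _ lx).
Unshelve. all: end_near. Qed.

(** The equation for [B] once more: a stage ends with the price of the switch plus the value at the
    start of the next one. *)
Lemma vf_switch : vf (- B) = vf B + c2.
Proof.
have hB : -1 < B < 1 by have h1 := B_gt0 ok; have h2 := B_lt1 ok; apply/andP; split; lra.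
have s0 : 1 - B ^+ 2 != 0 by rewrite gt_eqF// sq_gt0.
rewrite !vfE LLN// -(boundaryB ok) /aa; move: (LL B) => l; field.
by [].
Qed.

Lemma uf_A x : `|x| = A -> uf x = vf A.
Proof.
have hA : -1 < A < 1 by have h1 := A_gt0 ok; have h2 := A_lt1 ok; apply/andP; split; lra.
have e : uf A = vf A by rewrite !ufE /Cu; ring.
move=> xA; have [x0|x0] := leP 0 x; first by rewrite ger0_norm// in xA; rewrite xA.
rewrite ltr0_norm// in xA; have -> : x = - A by rewrite -xA opprK.
rewrite -e !ufE LLN//; ring.
Qed.

End ValueContinuity.

(** * The stages of the candidate rule up to a finite horizon *)

Section Upper.
Context {R : realType} {dd : measure_display} {T : measurableType dd}.
Variables (P : probability T R) (Bm : R -> T -> R) (theta : T -> R) (mu : R).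
Variables (c0 c1 c2 B A : R).
Hypothesis HB : BM_indep P Bm theta.
Hypothesis Hth : forall w, theta w = 1 \/ theta w = -1.
Local Notation X := (obs Bm theta mu).
Local Notation p := (prior P theta).
Hypotheses (p0 : 0 < p) (p1 : p < 1).
Hypotheses (mu0 : 0 < mu) (c00 : 0 < c0) (c10 : 0 < c1).
Local Notation k := (c1 / (4 * mu ^+ 2)).
Local Notation ke := (c0 / (2 * mu ^+ 2)).
Hypothesis ok : params_ok k ke c2 B A.
Local Notation M := (Mt P Bm theta mu).
Local Notation Mx := (Mx P Bm theta mu).
Local Notation tau := (tau_star M A B).
Local Notation d := (d_star M A).
Local Notation dsg := (dsg P Bm theta mu A).
Local Notation vf := (vf k B).
Local Notation uf := (uf k ke B A).
Local Notation vt := (vt k B).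
Local Notation ut := (ut k ke B A).
Local Notation Uf := (Uf k ke B A).
Local Notation natG t := [set E | exists s, 0 <= s <= t /\
         exists2 A, measurable A & E = X s @^-1` A].
Local Notation natT t := (g_sigma_algebraType (natG t)).
Local Notation pv := (2 * p - 1).

Let A0 : 0 < A := A_gt0 ok. Let A1 : A < 1 := A_lt1 ok.
Let B0 : 0 < B := B_gt0 ok. Let B1 : B < 1 := B_lt1 ok.
Let c20 : 0 < c2 := c2_gt0 ok.
Let tau_ge0 m w : (0 <= tau m w)%E. Proof. exact: (tau_ge0 mu B HB Hth A0). Qed.
Let tau_nd m w : (tau m w <= tau m.+1 w)%E. Proof. exact: (tau_nd mu B HB Hth A0). Qed.
Let d_val w : d w = 1 \/ d w = -1. Proof. exact: (d_val mu B HB Hth A0). Qed.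
Let dsg_val m w : dsg m w = 1 \/ dsg m w = -1. Proof. exact: (dsg_val mu B HB Hth A0). Qed.
Let N11 : (-1 : R) == 1 = false. Proof. by apply/negbTE/eqP => e; have : (-1 : R) = 1 := e; lra. Qed.
Let P1N : (1 : R) == -1 = false. Proof. by rewrite eq_sym N11. Qed.
Let kE : 2 * k * mu ^+ 2 = c1 / 2. Proof. by field; rewrite gt_eqF. Qed.
Let keE : 2 * ke * mu ^+ 2 = c0. Proof. by field; rewrite gt_eqF. Qed.

Let Mx_bnd t w : -1 < Mx t w < 1.
Proof. exact: (Mt_bnd Bm mu p0 p1). Qed.

Let sgn_Mx e t w : e = 1 \/ e = -1 -> -1 < e * Mx t w < 1.
Proof. by move=> he; have := Mx_bnd t w; move: (Mx t w) => x; case: he => ->; lra. Qed.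

Let MxF t : 0 <= t -> Mx t = M t.
Proof. by move=> t0; apply/funext => w; exact: MxE. Qed.

Let mMx t : 0 <= t -> measurable_fun setT (Mx t).
Proof. by move=> t0; rewrite (MxF t0); exact: (measurable_Mt mu HB t0). Qed.

Let tau_meas m t : 0 <= t -> measurable [set w | (tau m w <= t%:E)%E].
Proof.
by move=> t0; apply: (natF_meas HB (mu := mu) (t := t)); exact: (tau_adapted B HB Hth A0).
Qed.

Lemma dsg0_tau0 w t : tau 0%N w = t%:E -> dsg 0 w * M t w = `|M t w|.
Proof. by move=> tE; rewrite !dsgE /= /d_star -/(tau 0%N w) tE normrEsg. Qed.

(** If the prior mean already lies at or beyond A in modulus, then tau 0 = 0 and M keeps its initial
    value; otherwise continuity gives exactly A. *)
Lemma tau0_value w t : tau 0%N w = t%:E -> `|M t w| = Num.max A `|pv|.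
Proof.
move=> tE; have t0 : 0 <= t by rewrite -lee_fin -tE.
have [|t' [+ _ hA]] := @tau0_attained _ _ _ P Bm theta mu B A HB Hth w; first by rewrite tE ltry.
rewrite tE => -[tt]; subst t'.
have [t00|tpos] := eqVneq t 0; first by move: hA; rewrite t00 (Mt_start mu HB) => hA; rewrite max_r.
have {}tpos : 0 < t by rewrite lt_neqAle eq_sym tpos.
have pA : `|pv| < A.
  by rewrite -(Mt_start mu HB w); apply: (tau0_before (mu := mu) (B := B)); rewrite ?lexx// tE lte_fin.
rewrite max_l; last exact: ltW.
have := @hit_value R 0%E (fun t => `|Mx t w| - A) t; rewrite -(tau0E P Bm theta mu B A w) lte_fin => /(_ _ (lexx 0%E) tpos tE).
rewrite MxE// => /(_ _)/wrap[]; last by move: (`|M t w|) => x; lra.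
move=> s; apply: cvgB; last exact: cvg_cst.
by apply: cvg_norm; exact: (Mx_cont HB Hth).
Qed.

(** At tau m the posterior signed by the decision then in force is positive, so the opposite level
    is reached strictly later, and by continuity exactly. *)
Lemma tauS_value m w t : tau m.+1 w = t%:E -> dsg m.+1 w * M t w = B.
Proof.
move=> tE; have t0 : 0 <= t by rewrite -lee_fin -tE.
have [|t' [+ _ hB]] := @tauS_attained _ _ _ P Bm theta mu B A HB Hth A0 m w; first by rewrite tE ltry.
rewrite tE => -[tt]; subst t'.
have mt : (tau m w < t%:E)%E.
  rewrite lt_neqAle -[X in _ && (_ <= X)%E]tE tau_nd andbT; apply/eqP => mE.
  have : 0 < dsg m w * M t w.
    case: m mE tE hB => [|m] mE _ _.
      by rewrite dsg0_tau0// (tau0_value mE) lt_max A0.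
    have [|t' [+ _]] := @tauS_attained _ _ _ P Bm theta mu B A HB Hth A0 m w; first by rewrite mE ltry.
    by rewrite mE => -[<-]; exact: lt_le_trans.
  by move: hB; rewrite dsgS mulNr; have := B0; move: (_ * _) => x; lra.
have := @hit_value R (tau m w) (fun t => dsg m.+1 w * Mx t w - B) t.
rewrite -(tauSE HB Hth A0)// => /(_ _ (tau_ge0 m w) mt tE); rewrite MxE// => /(_ _)/wrap[].
  move=> s; apply: cvgB; last exact: cvg_cst.
  by apply: cvgM; [exact: cvg_cst|exact: (Mx_cont HB Hth)].
by move: (_ * _) => x; lra.
Qed.

Lemma dsg_region m w t : (tau m w <= t%:E)%E -> (t%:E <= tau m.+1 w)%E -> - B <= dsg m w * M t w.
Proof.
move=> h1; rewrite le_eqVlt => /orP[/eqP tE|h2].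
  by have := tauS_value (esym tE); rewrite dsgS mulNr; move: (_ * _) => x; lra.
exact/ltW/(tauS_before HB Hth A0 h1 h2).
Qed.

(** The value at the start of stage j. Only the first stage depends on the prior, which may lie
    beyond A. *)
Definition bval (j : nat) : R := if j is 0 then vf (Num.max A `|pv|) else vf B.

Let pv_bnd : -1 < pv < 1. Proof. have h := p0; have h' := p1; apply/andP; split; lra. Qed.

Let vt_start j w t : tau j w = t%:E -> vt (dsg j w * M t w) = bval j.
Proof.
case: j => [|j] tE.
  have m1 : Num.max A `|pv| < 1 by rewrite gt_max A1 ltr_norml pv_bnd.
  have m0 : - B <= Num.max A `|pv|.
    by rewrite le_max; apply/orP; left; have := A0; have := B0; lra.
  by rewrite dsg0_tau0// (tau0_value tE) (vt_vf ok m0 m1).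
have hB : - B <= B by have := B0; lra.
by rewrite (tauS_value tE) (vt_vf ok hB B1).
Qed.

(** Signed by the decision of stage j, the posterior stands at -B when the stage ends, and
    [vf_switch] applies. *)
Let vt_end j w t : tau j.+1 w = t%:E -> vt (dsg j w * M t w) = vf B + c2.
Proof.
move=> tE; have hB : - B < 1 by have := B0; lra.
have -> : dsg j w * M t w = - B.
  by have := tauS_value tE; rewrite dsgS mulNr; move: (_ * _) => x; lra.
by rewrite (vt_vf ok (lexx _) hB) (vf_switch ok).
Qed.

Section Horizon.
Variable S : R.
Hypothesis S0 : 0 < S.

Definition hits (j : nat) : set T := [set w | (tau j w <= S%:E)%E].
Definition dur (j : nat) (w : T) : R :=
  c1 * (dsg j w != theta w)%:R * (cutoff (tau j.+1 w) S - cutoff (tau j w) S).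

Let fin_cut (x : \bar R) : (0 <= x)%E -> (x <= S%:E)%E -> x = (cutoff x S)%:E.
Proof.
move=> x0 xS; have xf : x \is a fin_num by rewrite ge0_fin_numE//; apply: (le_lt_trans xS); rewrite ltry.
by rewrite -(fineK xf) cutoff_fin// -lee_fin fineK.
Qed.

Let mcut j : measurable_fun setT (fun w => cutoff (tau j w) S).
Proof.
apply: (measurability _ (RGenOInfty.measurableE R)) => _ [_ [a ->] <-].
rewrite setTI; have S0' := ltW S0.
have [a0|a0] := ltP a 0.
  rewrite (_ : _ @^-1` _ = setT)//; apply/seteqP; split => w //= _.
  by rewrite in_itv/= andbT; apply: (lt_le_trans a0); exact: cutoff_ge0.
have [aS|Sa] := ltP a S; last first.
  rewrite (_ : _ @^-1` _ = set0)//; apply/seteqP; split => w //=.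
  by rewrite in_itv/= andbT => /(le_lt_trans Sa)/lt_le_trans/(_ (cutoff_le S (tau_ge0 j w))); rewrite ltxx.
rewrite (_ : _ @^-1` _ = ~` [set w | (tau j w <= a%:E)%E]); first exact/measurableC/tau_meas.
apply/seteqP; split => w /=; rewrite in_itv/= andbT.
  move=> h h'; move: h; rewrite ltNge => /negP; apply.
  by rewrite -lee_fin; apply: le_trans h'; exact: cutoff_lee (tau_ge0 j w).
move=> /negP; rewrite -ltNge /cutoff; case: ifPn => // hS.
rewrite -lte_fin fineK// ge0_fin_numE//.
by move: hS; rewrite -ltNge => /lt_trans; apply; rewrite ltry.
Qed.

Let hits_meas j : measurable (hits j). Proof. exact: (tau_meas j (ltW S0)). Qed.

(** [dsg] with the random [d] frozen to e: a stage is treated separately on the two events d = e,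
    where the sign is deterministic. *)
Let ej (e : R) (j : nat) : R := if odd j then - e else e.
Let ej_dsg e j w : d w = e -> dsg j w = ej e j. Proof. by rewrite !dsgE /ej => ->. Qed.
Let ej_val e j : e = 1 \/ e = -1 -> ej e j = 1 \/ ej e j = -1.
Proof. by rewrite /ej; case: (odd j) => -[->|->]; rewrite ?opprK; auto. Qed.
Let vv e j w := c1 / 2 * (1 - ej e j * theta w).
Let gainJ e j := stage_gain (tau j) (tau j.+1) [set w | d w = e]
  (fun t w => vt (ej e j * Mx t w)) (vv e j) S.

Let alive_nat e j t : e = 1 \/ e = -1 -> 0 <= t ->
  natF X t ([set w | d w = e] `&` [set w | (tau j w <= t%:E)%E && (t%:E < tau j.+1 w)%E]).
Proof.
move=> he t0; rewrite (_ : _ `&` _ = ([set w | d w = e] `&` [set w | (tau j w <= t%:E)%E]) `&`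
   ~` [set w | (tau j.+1 w <= t%:E)%E]).
  apply: (@measurableI _ (natT t)); first exact: (stage_adapted B HB Hth A0).
  by apply: (@measurableC _ (natT t)); exact: (tau_adapted B HB Hth A0).
apply/seteqP; split => w.
  by move=> [dw /andP[h1 h2]]; split; [split|rewrite /setC /mkset => /(lt_le_trans h2); rewrite ltxx].
by move=> [[dw h1]]; rewrite /setC /mkset => /negP; rewrite -ltNge => h2; split => //; apply/andP.
Qed.

Let mtheta : measurable_fun setT theta. Proof. by case: HB. Qed.

Let stageJ e j : e = 1 \/ e = -1 -> integ P (gainJ e j) /\ Ex P (gainJ e j) <= 0.
Proof.
move=> he; have hj := ej_val j he; have [K1 HK1] := vt_bounded ok.
have [K K0 HK] := vt_step mu HB Hth p0 p1 ok.
have mv : measurable_fun setT (vv e j).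
  by apply: measurable_funM => //; apply: measurable_funB => //; exact: measurable_funM.
apply: (@stage_gain_le0 _ _ _ P (tau j) (tau j.+1) _ _ _ K1 c1 K) => //.
- move=> t t0; apply: (measurableT_comp (measurable_vt k B)).
  by apply: measurable_funM => //; exact: mMx.
- by move=> t w t0; apply: HK1; exact: sgn_Mx.
- move=> w; rewrite /vv; have := c10; case: hj => ->; case: (Hth w) => ->; move=> c10';
    by rewrite ler_norml; apply/andP; split; lra.
- by move=> t t0; apply: (natF_meas HB (mu := mu) (t := t)); exact: alive_nat.
- move=> t s t0 ts st; have nF := alive_nat j he t0.
  have := HK (ej e j) t s _ hj t0 ts st nF => /(_ _)/wrap[].
    move=> w [dw /andP[h1 h2]]; rewrite -(ej_dsg j dw).
    by apply: dsg_region => //; exact: ltW.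
  have s0 : 0 <= s by rewrite (le_trans t0)// ltW.
  cbv beta; rewrite (MxF t0) (MxF s0); move/le_trans; apply; rewrite lerD2r mulNr lerN2 kE.
  have mal := natF_meas HB nF; move: (_ `&` _) mal => al mal.
  have -> : Ex P (fun w => \1_al w * vv e j w) = c1 / 2 * Ex P (fun w => \1_al w * (1 - ej e j * theta w)).
    rewrite -ExZ; last exact: (theta_integ HB Hth).
    by apply: eq_Ex => w; rewrite /vv mulrCA.
  by rewrite mulrCA mulrA.
move=> w t /= dw t0 h1 h2 u u0 uc.
have Mc : ej e j * Mx (u n) w @[n --> \oo] --> ej e j * Mx t w.
  apply: cvgM; first exact: cvg_cst.
  by apply: (@continuous_cvg _ _ _ _ _ u (Mx^~ w)); [exact: (Mx_cont HB Hth)|exact: uc].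
apply: (@continuous_cvg _ _ _ _ _ (fun n => ej e j * Mx (u n) w) vt); last exact: Mc.
apply: (vt_cont ok); last by have /andP[] := sgn_Mx t w hj.
by rewrite MxE// -(ej_dsg j dw); exact: dsg_region.
Qed.

Let vvE e j w : d w = e -> vv e j w = c1 * (dsg j w != theta w)%:R.
Proof.
move=> dw; rewrite /vv -(ej_dsg j dw).
by case: (dsg_val j w) => ->; case: (Hth w) => ->; rewrite ?eqxx ?N11 ?P1N/=; field.
Qed.

(** The balance of stage j: its cost up to the horizon, plus the value on completion, minus the
    value on entry. *)
Let Hj j w := dur j w + (vf B + c2) * \1_(hits j.+1) w - bval j * \1_(hits j) w.

(** A completed stage gives equality. A stage still running at the horizon leaves a value [vf] > 0,
    which is dropped. *)
Let Hj_gain e j w : d w = e -> Hj j w <= gainJ e j w.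
Proof.
move=> dw; rewrite /gainJ /stage_gain indic_in// mul1r /Hj /dur (vvE j dw).
have S0' := ltW S0.
have YE t : 0 <= t -> vt (ej e j * Mx t w) = vt (dsg j w * M t w).
  by move=> t0; rewrite MxE// (ej_dsg j dw).
rewrite !YE; [|exact: cutoff_ge0..].
have [aS|Sa] := leP (tau j w) S%:E; last first.
  have Sb : (S%:E < tau j.+1 w)%E by exact: lt_le_trans (tau_nd j w).
  have no i : (S%:E < tau i w)%E -> \1_(hits i) w = 0 :> R.
    by move=> h; apply: indic_out; rewrite /hits /mkset; apply/negP; rewrite -ltNge.
  by rewrite (cutoff_big (ltW Sb)) (cutoff_big (ltW Sa)) !no// !subrr !mulr0 mul0r !addr0 subrr.
have aE := fin_cut (tau_ge0 j w) aS.
rewrite (vt_start aE) (indic_in (A := hits j))// mulr1.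
have [bS|Sb] := leP (tau j.+1 w) S%:E.
  rewrite (vt_end (fin_cut (tau_ge0 j.+1 w) bS)) (indic_in (A := hits j.+1))// mulr1.
  by rewrite [_ * (c1 * _)]mulrC; move: (c1 * _ * _) => x; lra.
rewrite (indic_out (A := hits j.+1)); last by rewrite /hits /=; apply/negP; rewrite -ltNge.
rewrite (cutoff_big (ltW Sb)).
have r1 : - B <= dsg j w * M S w by apply: dsg_region => //; exact: ltW.
have r2 : dsg j w * M S w < 1.
  by have := sgn_Mx S w (dsg_val j w); rewrite MxE// => /andP[].
have := vf_gt0 ok r1 r2; rewrite (vt_vf ok r1 r2).
rewrite [_ * (c1 * _)]mulrC; move: (c1 * _ * _) (vf (_ * _)) => x y; lra.
Qed.

Let gain_out e j w : d w <> e -> gainJ e j w = 0.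
Proof. by move=> dw; rewrite /gainJ /stage_gain indic_out// mul0r. Qed.

Let mdsg j : measurable_fun setT (dsg j).
Proof.
have md : measurable_fun setT d.
  have m := measurable_dpos mu B HB Hth A0.
  rewrite (_ : d = fun w => 2 * \1_[set w | d w = 1] w - 1).
    by apply: measurable_funB => //; apply: measurable_funM => //; exact: measurable_indic.
  apply/funext => w; case: (d_val w) => dw.
    by rewrite indic_in// dw; lra.
  by rewrite indic_out ?dw; [lra|move=> h; have /eqP := etrans (esym dw) h; rewrite N11].
have -> : dsg j = fun w => if odd j then - d w else d w by [].
by case: (odd j) => //; exact: measurableT_comp.
Qed.

Lemma dur_ge0 j w : 0 <= dur j w.
Proof.
rewrite /dur mulr_ge0//; first by rewrite mulr_ge0// ltW.
by rewrite subr_ge0; exact: cutoff_mono.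
Qed.

Lemma dur_integ j : integ P (dur j).
Proof.
apply: (@integ_bounded _ _ _ _ (c1 * S)).
  apply: measurable_funM; last exact: measurable_funB.
  rewrite (_ : (fun w => _) = (fun w => c1 / 2 * (1 - dsg j w * theta w))).
    by apply: measurable_funM => //; apply: measurable_funB => //; exact: measurable_funM.
  apply/funext => w.
  by case: (dsg_val j w) => ->; case: (Hth w) => ->; rewrite ?eqxx ?N11 ?P1N/=; field.
move=> w; rewrite ger0_norm ?dur_ge0// /dur; have S0' := ltW S0.
have h1 := cutoff_le S (tau_ge0 j.+1 w); have h2 := cutoff_ge0 (tau_ge0 j w) S0'.
apply: ler_pM; rewrite ?subr_ge0 ?cutoff_mono//; first by rewrite mulr_ge0// ltW.
  by rewrite ler_piMr ?(ltW c10)// lern1; case: (_ != _).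
by move: (cutoff _ _) (cutoff _ _) h1 h2 => x y; lra.
Qed.

Let hits_integ (c : R) j : integ P (fun w => c * \1_(hits j) w).
Proof. by apply: integZ; exact: integ_indic. Qed.

Let stage_sum j : Ex P (dur j) + (vf B + c2) * Ex P \1_(hits j.+1) <= bval j * Ex P \1_(hits j).
Proof.
have i1 : integ P (fun w => dur j w + (vf B + c2) * \1_(hits j.+1) w).
  by apply: integD; [exact: dur_integ|exact: hits_integ].
have H : Ex P (Hj j) <= 0.
  have [g1 e1] := stageJ j (or_introl (erefl (1 : R))).
  have [g2 e2] := stageJ j (or_intror (erefl (-1 : R))).
  apply: (@le_trans _ _ (Ex P (fun w => gainJ 1 j w + gainJ (-1) j w))); last first.
    by rewrite ExD//; move: (Ex P _) (Ex P _) e1 e2 => x y; lra.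
  apply: Ex_le; [by apply: integB; [exact: i1|exact: hits_integ]|exact: integD|].
  move=> w; case: (d_val w) => dw.
    rewrite [gainJ (-1) j w]gain_out ?addr0; first exact: Hj_gain.
    by rewrite dw => h; move: N11; rewrite -h eqxx.
  rewrite [gainJ 1 j w]gain_out ?add0r; first exact: Hj_gain.
  by rewrite dw => h; move: N11; rewrite h eqxx.
move: H; rewrite /Hj ExB; [|exact: i1|exact: hits_integ].
rewrite ExD; [|exact: dur_integ|exact: hits_integ].
by rewrite !ExZ ?subr_le0//; exact: integ_indic.
Qed.

(** The completion value vf B + c2 is the price of the switch plus [bval] of the next stage, so
    [stage_sum] telescopes. *)
Let sum_bound N : Ex P (fun w => \sum_(j < N) (dur j w + c2 * \1_(hits j.+1) w)) +
  bval N * Ex P \1_(hits N) <= bval 0 * Ex P \1_(hits 0).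
Proof.
have iS j : integ P (fun w => dur j w + c2 * \1_(hits j.+1) w).
  by apply: integD; [exact: dur_integ|exact: hits_integ].
rewrite Ex_sum//; elim: N => [|N ih]; first by rewrite big_ord0 add0r.
rewrite big_ord_recr/=; apply: le_trans ih; rewrite -addrA lerD2l.
apply: le_trans (stage_sum N).
rewrite ExD; [|exact: dur_integ|exact: hits_integ].
rewrite ExZ; last exact: integ_indic.
by rewrite -addrA lerD2l /= [leRHS]mulrDl addrC.
Qed.

Let cut_integ j : integ P (fun w => cutoff (tau j w) S).
Proof.
apply: (@integ_bounded _ _ _ _ S); first exact: mcut.
by move=> w; rewrite ger0_norm; [exact: cutoff_le|apply: cutoff_ge0 => //; exact: ltW].
Qed.

(** The stage argument for the observation phase: running cost c0 and value [uf], which equals vf A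
    on exit. If the prior mean lies beyond A, the phase is empty. *)
Let initial_bound : c0 * Ex P (fun w => cutoff (tau 0%N w) S) + bval 0 * Ex P \1_(hits 0) <= Uf pv.
Proof.
have [Ap|pA] := leP A `|pv|.
  have t0 w : tau 0%N w = 0%E.
    apply/eqP; rewrite eq_le tau_ge0 andbT tau0E; apply: hit_le => //.
    by rewrite MxE// (Mt_start mu HB) subr_ge0.
  rewrite (_ : (fun w => _) = cst 0); last first.
    by apply/funext => w; rewrite t0 cutoff_fin// ltW.
  rewrite Ex_cst mulr0 add0r (_ : hits 0 = setT); last first.
    by apply/seteqP; split => w //= _; rewrite /hits /mkset t0 lee_fin ltW.
  rewrite Ex_indic// probability_setT mulr1 /bval max_r// !UfE.
  case: ifPn => // pA; rewrite le_eqVlt; apply/orP; left; apply/eqP.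
  have e : `|pv| = A by apply/eqP; rewrite eq_le pA Ap.
  by rewrite (uf_A ok e) e.
have pA' := ltW pA.
have UE : Uf pv = ut pv by rewrite !UfE pA' (ut_uf ok pA').
have [K1 HK1] := ut_bounded ok; have [K K0 HK] := ut_step mu HB Hth p0 p1 ok.
have reg w t : 0 <= t -> (t%:E <= tau 0%N w)%E -> `|M t w| <= A.
  move=> t0; rewrite le_eqVlt => /orP[/eqP h|h].
    by rewrite (tau0_value (esym h)) max_l.
  by apply/ltW/(tau0_before t0 h).
(* Put in the shape of the events of [Stage], with starting time 0 and the whole space for [G]. *)
pose al (t : R) : set T := setT `&` [set w | ((cst 0%E : T -> \bar R) w <= t%:E)%E && (t%:E < tau 0%N w)%E].
have alE t : 0 <= t -> natF X t (al t).
  move=> t0; rewrite /al (_ : _ `&` _ = ~` [set w | (tau 0%N w <= t%:E)%E]).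
    by apply: (@measurableC _ (natT t)); exact: (tau_adapted B HB Hth A0).
  apply/seteqP; split => w.
    by move=> [_ /andP[_ h]]; rewrite /setC /mkset => /(lt_le_trans h); rewrite ltxx.
  rewrite /setC /mkset => /negP; rewrite -ltNge => h; split => //; apply/andP; split => //.
have [||||||||||i e] := @stage_gain_le0 _ _ _ P (cst 0%E) (tau 0%N) setT
   (fun t w => ut (Mx t w)) (cst c0) K1 c0 K S => //.
- by move=> t t0; apply: (measurableT_comp (measurable_ut k ke B A)); exact: mMx.
- by move=> t w t0; apply: HK1; exact: Mx_bnd.
- by move=> w; rewrite gtr0_norm.
- by move=> t t0; apply: (natF_meas HB (mu := mu) (t := t)); exact: alE.
- move=> t s t0 ts st; have nF := alE t t0; have s0 : 0 <= s by rewrite (le_trans t0)// ltW.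
  have := HK t s _ t0 ts st nF => /(_ _)/wrap[].
    by move=> w [_ /andP[_ h]]; apply: reg => //; exact: ltW.
  cbv beta; rewrite (MxF t0) (MxF s0); move/le_trans; apply; rewrite lerD2r mulNr lerN2 keE.
  have mal := natF_meas HB nF; rewrite -/(al t); move: (al t) mal => al' mal.
  have -> : Ex P (fun w => \1_al' w * cst c0 w) = c0 * Ex P \1_al'.
    by rewrite -ExZ; [apply: eq_Ex => w; rewrite mulrC|exact: integ_indic].
  by rewrite mulrCA mulrA.
- move=> w t _ t0 _ h2 u u0 uc.
  have Mc : Mx (u n) w @[n --> \oo] --> Mx t w.
    by apply: (@continuous_cvg _ _ _ _ _ u (Mx^~ w)); [exact: (Mx_cont HB Hth)|exact: uc].
  apply: (@continuous_cvg _ _ _ _ _ (fun n => Mx (u n) w) ut); last exact: Mc.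
  by apply: (ut_cont ok); rewrite MxE//; exact: reg.
set gn := stage_gain _ _ _ _ _ _ in i e.
have iL : integ P (fun w => c0 * cutoff (tau 0%N w) S + bval 0 * \1_(hits 0) w).
  by apply: integD; [apply: integZ; exact: cut_integ|exact: hits_integ].
have main w : c0 * cutoff (tau 0%N w) S + bval 0 * \1_(hits 0) w <= Uf pv + gn w.
  rewrite /gn /stage_gain indicT mul1r cutoff_fin ?(ltW S0)// subr0 UE.
  rewrite [X in _ - X + _](_ : _ = ut pv); last by rewrite MxE// (Mt_start mu HB).
  rewrite mulrC; have cz := cutoff_ge0 (tau_ge0 0 w) (ltW S0).
  suff : bval 0 * \1_(hits 0) w <= ut (Mx (cutoff (tau 0%N w) S) w).
    rewrite /cst /=; move: (_ * \1_ _ _) (ut _) (ut _) (_ * c0) => a b c d'; lra.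
  rewrite MxE//.
  have [aS|Sa] := leP (tau 0%N w) S%:E.
    have aE := fin_cut (tau_ge0 0 w) aS; have vE := tau0_value aE.
    rewrite indic_in// mulr1 /bval -vE.
    have hA : `|M (cutoff (tau 0%N w) S) w| = A by rewrite vE max_l.
    by rewrite hA (ut_uf ok) ?hA// (uf_A ok hA).
  rewrite indic_out ?mulr0; last by rewrite /hits /mkset; apply/negP; rewrite -ltNge.
  rewrite (cutoff_big (ltW Sa)); have r := reg w S (ltW S0) (ltW Sa).
  rewrite (ut_uf ok r); have := Uf_ge0 ok (Mx_bnd S w); rewrite MxE ?(ltW S0)// !UfE r.
  by [].
have iC : integ P (fun w => c0 * cutoff (tau 0%N w) S) by apply: integZ; exact: cut_integ.
have <- : Ex P (fun w => c0 * cutoff (tau 0%N w) S + bval 0 * \1_(hits 0) w) =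
    c0 * Ex P (fun w => cutoff (tau 0%N w) S) + bval 0 * Ex P \1_(hits 0).
  by rewrite (ExD iC (hits_integ _ 0)) !ExZ//; exact: integ_indic.
apply: le_trans (Ex_le iL (integD (integ_cst P (Uf pv)) i) main) _.
by rewrite (ExD (integ_cst P (Uf pv)) i) Ex_cst gerDl.
Qed.

Definition partial_cost (N : nat) (w : T) : R :=
  c0 * cutoff (tau 0%N w) S + \sum_(j < N) (dur j w + c2 * \1_(hits j.+1) w).

Lemma partial_cost_bound N : integ P (partial_cost N) /\ Ex P (partial_cost N) <= Uf pv.
Proof.
have iC : integ P (fun w => c0 * cutoff (tau 0%N w) S) by apply: integZ; exact: cut_integ.
have iS : integ P (fun w => \sum_(j < N) (dur j w + c2 * \1_(hits j.+1) w)).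
  by apply: integ_sum => j; apply: integD; [exact: dur_integ|exact: hits_integ].
split; first exact: integD.
rewrite /partial_cost ExD// ExZ; last exact: cut_integ.
apply: le_trans initial_bound; rewrite lerD2l; apply: le_trans (sum_bound N).
rewrite lerDl; apply: mulr_ge0.
  have hB : - B <= B by have := B0; lra.
  have m1 : Num.max A `|pv| < 1 by rewrite gt_max A1 ltr_norml pv_bnd.
  have m0 : - B <= Num.max A `|pv|.
    by rewrite le_max; apply/orP; left; have := A0; have := B0; lra.
  by case: (N) => [|n] /=; apply: ltW; apply: (vf_gt0 ok).
by apply: Ex_ge0 => w; rewrite indicE.
Qed.

End Horizon.

End Upper.

(** * The cost of a path as a monotone limit *)

Section PathCost.
Context {R : realType} {d0 : measure_display} {T : measurableType d0}.
Variables (tau : nat -> T -> \bar R) (d : T -> R) (w : T) (th c0 c1 c2 : R).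
Hypothesis tau_nd : forall n, (tau n w <= tau n.+1 w)%E.
Hypothesis tau0_ge0 : (0 <= tau 0%N w)%E.
Hypothesis unb : forall s : R, exists m, (s%:E < tau m w)%E.
Hypothesis strict : forall m t, tau m.+1 w = t%:E -> tau m.+2 w <> t%:E.
Hypotheses (c00 : 0 <= c0) (c10 : 0 <= c1) (c20 : 0 <= c2).
Local Notation D t := (Dproc tau d t w).

Let tau_le m n : (m <= n)%N -> (tau m w <= tau n w)%E. Proof. exact: tau_mono. Qed.
Let tau_ge0 m : (0 <= tau m w)%E. Proof. exact: le_trans (tau_le (leq0n m)). Qed.

Lemma locate t : (tau 0%N w <= t%:E)%E -> exists j, (tau j w <= t%:E < tau j.+1 w)%E.
Proof.
move=> t0; have [m hm mmin] := ex_minnP (unb t).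
case: m hm mmin => [|m] hm mmin; first by have := lt_le_trans hm t0; rewrite ltxx.
exists m; rewrite hm andbT leNgt; apply/negP => h.
by have := mmin m h; rewrite ltnn.
Qed.

Lemma Djump_hit t : (tau 0%N w < t%:E)%E -> Djump tau d t w -> exists j, tau j.+1 w = t%:E.
Proof.
move=> t0 dj; have [j hj] := locate (ltW t0); have /andP[j1 j2] := hj.
have [e|ne] := eqVneq (tau j w) t%:E.
  by case: j e {hj j1 j2} => [|j] e; [rewrite e ltxx in t0|exists j].
have jt : (tau j w < t%:E)%E by rewrite lt_neqAle ne.
exfalso; apply: dj; rewrite (DprocE d tau_nd hj).
have jf : tau j w \is a fin_num by rewrite ge0_fin_numE//; apply: (lt_trans jt); rewrite ltry.
have jt' : fine (tau j w) < t by rewrite -lte_fin fineK.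
apply: cvg_near_cst; near=> u; rewrite (DprocE d tau_nd (m := j))//; apply/andP; split.
  by rewrite -(fineK jf) lee_fin; near: u; exact: nbhs_left_ge.
apply: le_lt_trans j2; rewrite lee_fin; near: u; exact: nbhs_left_le.
Unshelve. all: by end_near. Qed.

Let e (j : nat) : R := if odd j then - d w else d w.
Let Sn (n : nat) : R := n.+1%:R.
Let b (j : nat) : R := (e j != th)%:R.
Let Sn0 n : 0 <= Sn n. Proof. exact: ler0n. Qed.
Let Sn_le n m : (n <= m)%N -> Sn n <= Sn m. Proof. by move=> nm; rewrite ler_nat. Qed.
Let Sn_big s : exists n, s <= Sn n.
Proof. by exists (Num.trunc s); exact/ltW/Num.Theory.truncnS_gt. Qed.

(** One index n governs both the horizon n + 1 and the number n of stages, so that a single monotone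
    limit exhausts the three costs. *)
Let a n : R := cutoff (tau 0%N w) (Sn n).
Let bb n : R := \sum_(j < n) b j * (cutoff (tau j.+1 w) (Sn n) - cutoff (tau j w) (Sn n)).
Let g n : R := \sum_(j < n) ((tau j.+1 w <= (Sn n)%:E)%E)%:R.

Lemma cutoff_diff_le (x y : \bar R) s t : (0 <= x)%E -> (x <= y)%E -> 0 <= s -> s <= t ->
  cutoff y s - cutoff x s <= cutoff y t - cutoff x t.
Proof.
move=> x0 xy s0 st; have y0 : (0 <= y)%E by exact: le_trans xy.
have key z : (0 <= z)%E -> cutoff z s = Num.min (cutoff z t) s.
  move=> z0; rewrite {1}/cutoff; case: ifPn => [sz|].
    rewrite min_r// -[leLHS](cutoff_big sz); exact: cutoff_le2.
  rewrite -ltNge => zs; have zf : z \is a fin_num.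
    by rewrite ge0_fin_numE//; apply: (lt_trans zs); rewrite ltry.
  have zs' : fine z <= s by rewrite -lee_fin fineK// ltW.
  by rewrite -[in RHS](fineK zf) cutoff_fin ?(le_trans zs')// min_l.
rewrite !key//; have := cutoff_mono t x0 xy.
move: (cutoff x t) (cutoff y t) => u v uv.
by have [?|?] := leP u s; have [?|?] := leP v s; lra.
Qed.

Lemma lt_cutoff (t : R) (x : \bar R) (s : R) : (0 <= x)%E -> (t < cutoff x s) = (t%:E < x)%E && (t < s).
Proof.
move=> x0; rewrite /cutoff; case: ifPn => [sx|].
  by case: (boolP (t < s)) => ts; rewrite ?andbF// andbT (lt_le_trans _ sx)// lte_fin.
rewrite -ltNge => xs; have xf : x \is a fin_num.
  by rewrite ge0_fin_numE//; apply: (lt_trans xs); rewrite ltry.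
rewrite -lte_fin fineK//; case: (boolP (t%:E < x)%E) => //= tx.
by rewrite -lte_fin (lt_trans tx xs).
Qed.

Lemma cutoff_leE (t : R) (x : \bar R) (s : R) : (0 <= x)%E -> t < s -> (cutoff x s <= t) = (x <= t%:E)%E.
Proof. by move=> x0 ts; rewrite leNgt lt_cutoff// ts andbT -leNgt. Qed.

Let sum_mono (F : nat -> nat -> R) n m : (forall i j, 0 <= F i j) ->
  (forall j, F n j <= F m j) -> (n <= m)%N -> \sum_(j < n) F n j <= \sum_(j < m) F m j.
Proof.
move=> F0 Fle nm; rewrite -(subnKC nm) big_split_ord/=.
by rewrite ler_wpDr//; [exact: sumr_ge0|rewrite subnKC//; exact: ler_sum].
Qed.

Let a_mono : {homo a : n m / (n <= m)%N >-> n <= m}.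
Proof. by move=> n m nm; apply: cutoff_le2 => //; exact: Sn_le. Qed.

Let bb_mono : {homo bb : n m / (n <= m)%N >-> n <= m}.
Proof.
move=> n m nm; apply: (sum_mono (F := fun n j => b j * (cutoff (tau j.+1 w) (Sn n) - cutoff (tau j w) (Sn n)))) => //.
  by move=> i j; rewrite mulr_ge0// subr_ge0 cutoff_mono.
by move=> j; rewrite ler_wpM2l//; apply: cutoff_diff_le => //; exact: Sn_le.
Qed.

Let g_mono : {homo g : n m / (n <= m)%N >-> n <= m}.
Proof.
move=> n m nm; apply: (sum_mono (F := fun n j => ((tau j.+1 w <= (Sn n)%:E)%E)%:R)) => //.
move=> j; rewrite ler_nat; case: (boolP (tau j.+1 w <= _)%E) => // h.
by rewrite (le_trans h)// lee_fin Sn_le.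
Qed.

Let a0 n : 0 <= a n. Proof. exact: cutoff_ge0. Qed.
Let bb0 n : 0 <= bb n.
Proof. by apply: sumr_ge0 => j _; rewrite mulr_ge0// subr_ge0 cutoff_mono. Qed.
Let g0 n : 0 <= g n. Proof. exact: sumr_ge0. Qed.

Let E_mono (u : nat -> R) : {homo u : n m / (n <= m)%N >-> n <= m} ->
  {homo (EFin \o u) : n m / (n <= m)%N >-> (n <= m)%E}.
Proof. by move=> h n m nm; rewrite lee_fin h. Qed.

Let le_limn (u : nat -> R) n : {homo u : n m / (n <= m)%N >-> n <= m} ->
  ((u n)%:E <= limn (EFin \o u))%E.
Proof.
move=> h; have /cvg_lim := ereal_nondecreasing_cvgn (E_mono h).
by move=> /(_ (@ereal_hausdorff R)) ->; apply: ereal_sup_ubound; exists n.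
Qed.

Lemma tau0_le_lim : (tau 0%N w <= limn (EFin \o a))%E.
Proof.
have [e0|] := eqVneq (tau 0%N w) +oo%E; last first.
  rewrite -ltey => lt; have f : tau 0%N w \is a fin_num by rewrite ge0_fin_numE.
  have [n hn] := Sn_big (fine (tau 0%N w)).
  by have := le_limn n a_mono; rewrite {1}/a -{1}(fineK f) cutoff_fin// fineK.
rewrite e0 leye_eq; apply/eqP/eq_infty => r; have [n hn] := Sn_big r.
apply: le_trans (le_limn n a_mono); rewrite /a e0 cutoff_big ?leey//.
Qed.

Lemma wrong_time_le_lim :
  (\int[lebesgue_measure]_(t in [set t : R | (tau 0%N w <= t%:E)%E])
     ((D t != th)%:R)%:E <= limn (EFin \o bb))%E.
Proof.
(* The indicator of a wrong decision, restricted to the first n stages and to times before the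
   horizon; monotone convergence applies to it. *)
pose q n t : R := \sum_(j < n) b j *
  ([&& (tau j w <= t%:E)%E, (t%:E < tau j.+1 w)%E & t < Sn n])%:R.
pose I n j : set R := `[cutoff (tau j w) (Sn n), cutoff (tau j.+1 w) (Sn n)[%classic.
have qE n t : q n t = \sum_(j < n) b j * \1_(I n j) t.
  apply: eq_bigr => j _; congr (_ * _); rewrite indicE /I mem_setE in_itv/=; congr (_%:R).
  rewrite lt_cutoff//; case: (boolP (t < Sn n)) => h; last by rewrite !andbF.
  by rewrite cutoff_leE// !andbT.
have q0 n t : 0 <= q n t by apply: sumr_ge0 => j _; rewrite mulr_ge0.
have q_mono t : {homo q^~ t : n m / (n <= m)%N >-> n <= m}.
  move=> n m nm; apply: (sum_mono (F := fun n j => b j *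
    ([&& (tau j w <= t%:E)%E, (t%:E < tau j.+1 w)%E & t < Sn n])%:R)) => //.
    by move=> i j; rewrite mulr_ge0.
  move=> j; rewrite ler_wpM2l// ler_nat; case: (boolP [&& _, _ & _]) => // /and3P[-> -> h].
  by rewrite (lt_le_trans h)// Sn_le.
have mI n j : measurable_fun setT (\1_(I n j) : R -> R) by apply: measurable_indic; exact: measurable_itv.
have mq n : measurable_fun setT (fun t => (q n t)%:E).
  apply/measurable_EFinP; rewrite (_ : q n = fun t => \sum_(j < n) b j * \1_(I n j) t); last first.
    by apply/funext => t; exact: qE.
  by apply: measurable_sum => j; apply: measurable_funM.
have bE n : (\int[lebesgue_measure]_t (q n t)%:E = (bb n)%:E)%E.
  under eq_integral do rewrite qE -sumEFin.
  rewrite ge0_integral_sum//; last 2 first.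
  - by move=> j; apply/measurable_EFinP; apply: measurable_funM => //; exact: mI.
  - by move=> j t _; rewrite lee_fin; apply: mulr_ge0; [exact: ler0n|rewrite indicE ler0n].
  rewrite /bb -sumEFin; apply: eq_bigr => j _.
  under eq_integral do rewrite EFinM.
  rewrite ge0_integralZl//; last 2 first.
  - by apply/measurable_EFinP; exact: mI.
  - by rewrite lee_fin ler0n.
  have cm := cutoff_mono (Sn n) (tau_ge0 j) (tau_nd j).
  have le : lebesgue_measure (I n j : set R) = (cutoff (tau j.+1 w) (Sn n) - cutoff (tau j w) (Sn n))%:E.
    rewrite /I lebesgue_measure_itv/= lte_fin; case: ifPn => [_|]; first by rewrite -EFinD.
    by rewrite -leNgt => h; congr EFin; apply/esym/eqP; rewrite subr_eq0 eq_le h cm.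
  by rewrite integral_indic ?setIT; [rewrite [X in (_ * X)%E]le -EFinM|exact: measurableT|exact: measurable_itv].
have <- : (\int[lebesgue_measure]_t limn (fun n => (q n t)%:E) = limn (EFin \o bb))%E.
  rewrite monotone_convergence//.
  - by congr (limn _); apply/funext => n /=; exact: bE.
  - by move=> n t _; rewrite lee_fin.
  - by move=> t _ n m nm; rewrite lee_fin q_mono.
rewrite integral_mkcond; apply: ge0_integral_mono => t _.
  by rewrite patchE; case: ifP => // _; rewrite lee_fin.
rewrite patchE; case: ifPn => [|_]; last first.
  by apply: le_trans (le_limn 0 (q_mono t)); rewrite lee_fin.
rewrite inE /= => t0; have [j hj] := locate t0; have [s hs] := Sn_big (t + 1).
pose n := maxn j.+1 s.
have tn : t < Sn n.
  apply: lt_le_trans (Sn_le (leq_maxr j.+1 s)); apply: lt_le_trans hs; by rewrite ltrDl.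
apply: le_trans (le_limn n (q_mono t)); rewrite lee_fin /q.
have jn : (j < n)%N by rewrite leq_maxl.
rewrite (bigD1 (Ordinal jn))//= tn andbT hj mulr1 (DprocE d tau_nd hj).
by rewrite lerDl; apply: sumr_ge0 => i _; rewrite mulr_ge0.
Qed.

(** Jumps occur only at finite times tau (j + 1), which are distinct by [strict]; finitely many of
    them lie before a common horizon. *)
Lemma jumps_le_lim :
  (\esum_(t in [set t : R | (tau 0%N w < t%:E)%E /\ Djump tau d t w]) 1 <= limn (EFin \o g))%E.
Proof.
pose K := [set j | (tau j.+1 w < +oo)%E]; pose f j := fine (tau j.+1 w).
have fE j : K j -> tau j.+1 w = (f j)%:E by move=> Kj; rewrite fineK// ge0_fin_numE.
have finj : set_inj K f.
  have key i j : K i -> K j -> (i < j)%N -> f i != f j.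
    move=> Ki Kj ij; rewrite lt_eqF// -lte_fin -!fE//.
    apply: lt_le_trans (tau_le (_ : (i.+2 <= j.+1)%N)); last by [].
    rewrite lt_neqAle tau_nd andbT eq_sym; apply/eqP => h.
    by apply: (strict (fE _ Ki)); rewrite h; exact: fE.
  move=> i j; rewrite !inE => Ki Kj ee; have [ij|ji|//] := ltngtP i j.
    by have := key i j Ki Kj ij; rewrite ee eqxx.
  by have := key j i Kj Ki ji; rewrite ee eqxx.
apply: le_trans (_ : (\esum_(t in f @` K) (1 : \bar R) <= _)%E).
  apply: esum_subset => t [t0 dj]; have [j hj] := Djump_hit t0 dj; exists j.
    by rewrite /K /= hj ltry.
  by rewrite /f hj.
rewrite esum_image// /K -(@nneseries_esum R (fun=> 1%E) (fun j => (tau j.+1 w < +oo)%E))//.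
apply: lime_le; first exact: is_cvg_nneseries.
apply: nearW => N.
(* A horizon beyond all finite times among the first N; the maximum with N then provides enough
   stages as well. *)
have [m hm] : exists m, forall j, (j < N)%N -> (tau j.+1 w < +oo)%E -> (tau j.+1 w <= (Sn m)%:E)%E.
  elim: N => [|N [m hm]]; first by exists 0%N.
  have [s hs] := Sn_big (f N); exists (maxn m s) => j; rewrite ltnS leq_eqVlt => /orP[/eqP->|jN] lt.
    by rewrite fE// lee_fin; apply: (le_trans hs); apply: Sn_le; exact: leq_maxr.
  by apply: (le_trans (hm j jN lt)); rewrite lee_fin; apply: Sn_le; exact: leq_maxl.
apply: le_trans (le_limn (maxn N m) g_mono).
apply: (@le_trans _ _ (\sum_(j < N) ((tau j.+1 w <= (Sn (maxn N m))%:E)%E)%:R)%:E); last first.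
  rewrite lee_fin /g; have := leq_maxl N m; move: (maxn N m) => M NM.
  rewrite -(subnKC NM) big_split_ord/=; by rewrite lerDl; exact: sumr_ge0.
rewrite big_mkord -sumEFin big_mkcond/=; apply: lee_sum => j _; case: ifP => lt; last by rewrite lee_fin.
rewrite (le_trans (hm j (ltn_ord j) lt))//; rewrite lee_fin; apply: Sn_le; exact: leq_maxr.
Qed.

Definition path_partial (n : nat) : R := c0 * cutoff (tau 0%N w) n.+1%:R +
  \sum_(j < n) (c1 * ((if odd j then - d w else d w) != th)%:R *
     (cutoff (tau j.+1 w) n.+1%:R - cutoff (tau j w) n.+1%:R)
     + c2 * ((tau j.+1 w <= n.+1%:R%:E)%E)%:R).

Let partialE n : path_partial n = c0 * a n + c1 * bb n + c2 * g n.
Proof.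
rewrite /path_partial big_split/= addrA; congr (_ + _ + _); rewrite mulr_sumr//.
by apply: eq_bigr => j _; rewrite mulrA.
Qed.

Lemma path_partial_ge0 n : 0 <= path_partial n.
Proof. by rewrite partialE !addr_ge0// mulr_ge0. Qed.

Lemma path_partial_mono : {homo path_partial : n m / (n <= m)%N >-> n <= m}.
Proof.
move=> n m nm; rewrite !partialE; apply: lerD; first apply: lerD; apply: ler_wpM2l => //.
- exact: a_mono.
- exact: bb_mono.
- exact: g_mono.
Qed.

Lemma loss_le_lim :
  ((c0%:E * tau 0%N w
      + c1%:E * \int[lebesgue_measure]_(t in [set t : R | (tau 0%N w <= t%:E)%E])
                  ((D t != th)%:R)%:E
      + c2%:E * \esum_(t in [set t : R | (tau 0%N w < t%:E)%E /\ Djump tau d t w])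
                  1)%E <= limn (EFin \o path_partial))%E.
Proof.
have cv (c : R) (u : nat -> R) : 0 <= c -> {homo u : n m / (n <= m)%N >-> n <= m} ->
    cvgn (EFin \o (fun n => c * u n)) /\ (c%:E * limn (EFin \o u) = limn (EFin \o (fun n => c * u n)%R))%E.
  move=> cc um; have h1 : cvgn (EFin \o (fun n => c * u n)).
    by apply: ereal_nondecreasing_is_cvgn => n m nm; rewrite lee_fin ler_wpM2l// um.
  split => //; rewrite -limeMl//; last by apply: ereal_nondecreasing_is_cvgn; exact: E_mono.
have [ca ea] := cv _ _ c00 a_mono; have [cb eb] := cv _ _ c10 bb_mono; have [cg eg] := cv _ _ c20 g_mono.
have l0 (c : R) (u : nat -> R) : 0 <= c -> (forall n, 0 <= u n) -> cvgn (EFin \o (fun n => c * u n)) ->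
    (0 <= limn (EFin \o (fun n => c * u n)%R))%E.
  by move=> cc u0 cu; apply: lime_ge => //; apply: nearW => n; rewrite lee_fin mulr_ge0.
have la := l0 _ _ c00 a0 ca; have lb := l0 _ _ c10 bb0 cb; have lg := l0 _ _ c20 g0 cg.
have -> : limn (EFin \o path_partial) = (limn (EFin \o (fun n => c0 * a n)%R) +
    limn (EFin \o (fun n => c1 * bb n)%R) + limn (EFin \o (fun n => c2 * g n)%R))%E.
  rewrite -limeD//; last exact: ge0_adde_def.
  rewrite -limeD//; last 2 first.
  - by apply: is_cvgeD => //; exact: ge0_adde_def.
  - rewrite limeD//; last exact: ge0_adde_def.
    by apply: ge0_adde_def; rewrite inE// adde_ge0.
  by congr (limn _); apply/funext => n /=; rewrite partialE !EFinD.
rewrite -ea -eb -eg; apply: leeD; first apply: leeD; apply: lee_wpmul2l; rewrite ?lee_fin//.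
- exact: tau0_le_lim.
- exact: wrong_time_le_lim.
- exact: jumps_le_lim.
Qed.

End PathCost.

(** * Optimality of the candidate rule *)

Section Optimal.
Context {R : realType} {dd : measure_display} {T : measurableType dd}.
Variables (P : probability T R) (Bm : R -> T -> R) (theta : T -> R) (mu : R).
Variables (c0 c1 c2 B A : R).
Hypothesis HB : BM_indep P Bm theta.
Hypothesis Hth : forall w, theta w = 1 \/ theta w = -1.
Local Notation X := (obs Bm theta mu).
Local Notation p := (prior P theta).
Hypotheses (mu0 : 0 < mu) (c00 : 0 < c0) (c10 : 0 < c1).
Local Notation k := (c1 / (4 * mu ^+ 2)).
Local Notation ke := (c0 / (2 * mu ^+ 2)).
Hypothesis ok : params_ok k ke c2 B A.
Local Notation M := (Mt P Bm theta mu).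
Local Notation tau := (tau_star M A B).
Local Notation d := (d_star M A).
Let A0 : 0 < A := A_gt0 ok. Let A1 : A < 1 := A_lt1 ok.
Let B0 : 0 < B := B_gt0 ok.
Let c20 : 0 < c2 := c2_gt0 ok.
Let nd w n : (tau n w <= tau n.+1 w)%E. Proof. exact: (tau_nd mu B HB Hth A0). Qed.

Lemma risk_upper_bound : 0 < p -> p < 1 ->
  (risk P theta c0 c1 c2 tau d <= (Uf k ke B A (2 * p - 1))%:E)%E.
Proof.
move=> p0 p1; pose pc n w := path_partial tau d w (theta w) c0 c1 c2 n.
have pcE n : pc n = partial_cost P Bm theta mu c0 c1 c2 B A n.+1%:R n.
  apply/funext => w; rewrite /pc /path_partial /partial_cost; congr (_ + _).
  apply: eq_bigr => j _; congr (_ + _ * _); rewrite indicE /hits; congr (_%:R).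
  by rewrite [X in _ = nat_of_bool X]asboolb.
have S0 n : 0 < n.+1%:R :> R by rewrite ltr0n.
have pb n : integ P (pc n) /\ Ex P (pc n) <= Uf k ke B A (2 * p - 1).
  by rewrite pcE; exact: (partial_cost_bound HB Hth p0 p1 mu0 c00 c10 ok (S0 n) n).
have pc0 n w : 0 <= pc n w.
  apply: (path_partial_ge0 d (theta w) (nd w)) => //; try exact: ltW.
  exact: (tau0_ge0 P Bm theta mu B A w).
have pcm w : {homo pc^~ w : n m / (n <= m)%N >-> n <= m}.
  move=> n m nm; apply: (path_partial_mono d (theta w) (nd w)) => //; try exact: ltW.
  exact: (tau0_ge0 P Bm theta mu B A w).
apply: (@le_trans _ _ (\int[P]_w limn (fun n => (pc n w)%:E))%E).
  apply: ge0_integral_mono => w _.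
    rewrite !adde_ge0// mule_ge0// ?lee_fin ?(ltW c00) ?(ltW c10) ?(ltW c20)//.
    - exact: (tau0_ge0 P Bm theta mu B A w).
    - by apply: integral_ge0 => t _; rewrite lee_fin.
    - exact: esum_ge0.
  apply: (loss_le_lim d (theta w) (nd w)) => //; try exact: ltW.
  - exact: (tau0_ge0 P Bm theta mu B A w).
  - exact: (tau_unbounded mu HB Hth B0 A0 w).
  (* Two successive switches at the same time would make both M and - M, up to a common sign, equal
     to B > 0. *)
  - move=> m t h1 h2; have := tauS_value HB Hth ok h1; have := tauS_value HB Hth ok h2.
    rewrite (dsgS _ _ _ _ _ m.+1) mulNr; have := B0; move: (_ * _) => x; lra.
rewrite monotone_convergence//; last 3 first.
- by move=> n; apply/measurable_EFinP; exact: (integ_meas (pb n).1).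
- by move=> n w _; rewrite lee_fin.
- by move=> w _ n m nm; rewrite lee_fin pcm.
apply: lime_le.
  apply: ereal_nondecreasing_is_cvgn => n m nm; apply: ge0_integral_mono => w _.
    by rewrite lee_fin.
  by rewrite lee_fin pcm.
by apply: nearW => n; rewrite -(EFin_Ex (pb n).1) lee_fin; exact: (pb n).2.
Qed.

Lemma risk_degenerate (e : R) : e = 1 \/ e = -1 -> (forall t w, M t w = e) ->
  P [set w | theta w = - e] = 0%E -> (risk P theta c0 c1 c2 tau d <= 0)%E.
Proof.
move=> he Me Pe; have ne : `|e| = 1 by case: he => ->; rewrite ?normrN normr1.
have t0 w : tau 0%N w = 0%E.
  apply/eqP; rewrite eq_le (tau0_ge0 P Bm theta mu B A w) andbT tau0E; apply: hit_le => //.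
  by rewrite /Mx Me ne subr_ge0 ltW.
have dE w : d w = e.
  rewrite /d_star -/(tau 0%N w) t0; change (Num.sg (M 0 w) = e); rewrite Me; case: he => ->; first exact: sgr1.
  by rewrite sgrN sgr1.
have t1 w : tau 1%N w = +oo%E.
  have [//|] := eqVneq (tau 1%N w) +oo%E; rewrite -ltey => lt.
  have [t [_ _]] := tauS_attained HB Hth A0 lt; rewrite /dsg /= dE Me => h.
  by exfalso; move: h; have := B0; case: he => ->; lra.
have unb w s : exists m, (s%:E < tau m w)%E by exists 1%N; rewrite t1 ltry.
have DE w t : 0 <= t -> Dproc tau d t w = e.
  by move=> t0'; rewrite (@DprocE _ _ _ tau d w (nd w) 0%N) ?t0 ?t1 ?ltry ?lee_fin ?t0'//= dE.
pose N := [set w | theta w = - e].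
have mN : measurable N.
  have mth : measurable_fun setT theta by case: HB.
  by rewrite -[N]setTI; apply: (mth measurableT [set - e]).
have th w : ~ N w -> theta w = e.
  by rewrite /N /mkset => Nw; case: he Nw => ->; case: (Hth w) => // ->; rewrite ?opprK => /(_ erefl).
(* The loss is bounded by +oo on the null event of a wrong decision and vanishes elsewhere. *)
apply: (@le_trans _ _ (\int[P]_w ((cst +oo%E) \_ N) w)%E); last first.
  by rewrite -integral_mkcond null_set_integral.
apply: ge0_integral_mono => w _.
  rewrite !adde_ge0// mule_ge0// ?lee_fin ?(ltW c00) ?(ltW c10) ?(ltW c20)//.
  - exact: (tau0_ge0 P Bm theta mu B A w).
  - by apply: integral_ge0 => t _; rewrite lee_fin.
  - exact: esum_ge0.
rewrite patchE; case: ifPn => [_|]; first by rewrite leey.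
rewrite notin_setE => /th thw.
rewrite (_ : [set t : R | (tau 0%N w < t%:E)%E /\ Djump tau d t w] = set0); last first.
  apply/seteqP; split => t //= [tt dj].
  have [j hj] := Djump_hit (nd w) (tau0_ge0 P Bm theta mu B A w) (unb w) tt dj.
  have : (tau 1%N w <= tau j.+1 w)%E by exact: (tau_mono (nd w)).
  by rewrite t1 hj.
rewrite esum_set0 mule0 adde0 integral0_eq ?mule0 ?adde0.
  by rewrite t0 mule0.
move=> t; rewrite /mkset t0 lee_fin => tt.
by rewrite DE// thw eqxx.
Qed.

Lemma risk_star_le (cP : complete_prob P) tau' d' : decision_rule P X tau' d' ->
  (risk P theta c0 c1 c2 tau d <= risk P theta c0 c1 c2 tau' d')%E.
Proof.
move=> rule; have p0 := prior_ge0 P theta; have p1 := prior_le1 HB Hth.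
have R0 : (0 <= risk P theta c0 c1 c2 tau' d')%E.
  apply: integral_ge0 => w _.
  rewrite !adde_ge0// mule_ge0// ?lee_fin ?(ltW c00) ?(ltW c10) ?(ltW c20)//.
  - by case: rule => /(_ 0%N)[].
  - by apply: integral_ge0 => t _; rewrite lee_fin.
  - exact: esum_ge0.
have [e0|pn0] := eqVneq p 0.
  apply: le_trans R0; apply: (@risk_degenerate (-1)); first by right.
    by move=> t w; rewrite MtE /den e0 mul0r add0r !subr0 divff ?oner_eq0//; lra.
  rewrite opprK -[LHS]fineK; first by rewrite -/(prior P theta) e0.
  by apply: fin_num_measure; exact: (measurable_Tp HB).
have [e1|pn1] := eqVneq p 1.
  apply: le_trans R0; apply: (@risk_degenerate 1); first by left.
    by move=> t w; rewrite MtE e1 subrr mul0r mulr0 subr0.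
  rewrite -[LHS]fineK; first by rewrite (prior_Tm HB Hth) e1 subrr.
  by apply: fin_num_measure; exact: (measurable_Tm HB).
have p0' : 0 < p by rewrite lt_neqAle eq_sym pn0.
have p1' : p < 1 by rewrite lt_neqAle pn1.
apply: (le_trans (risk_upper_bound p0' p1')).
exact: (risk_lower_bound cP HB Hth p0' p1' mu0 c00 c10 ok rule).
Qed.

End Optimal.

Unset Implicit Arguments.

Theorem theorem1 (R : realType) (dO : measure_display) (Omega : measurableType dO)
    (P : probability Omega R) (Bm : R -> Omega -> R) (theta : Omega -> R)
    (mu c0 c1 c2 B A : R) :
  complete_prob P ->
  BM_indep P Bm theta ->
  (forall w, theta w = 1 \/ theta w = -1) ->
  0 < mu -> 0 < c0 -> 0 < c1 -> 0 < c2 ->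
  0 < B < 1 ->
  ln ((1 - B) / (1 + B)) + 2 * B / (1 - B ^+ 2) = 2 * mu ^+ 2 * c2 / c1 ->
  0 < A < 1 ->
  (c1 / (2 * c0) - 1) * ln ((1 - A) / (1 + A))
    + 2 / (1 + A) * (c1 / (2 * c0) + A / (1 - A)) = c1 / (c0 * (1 - B ^+ 2)) ->
  let p := fine (P [set w | theta w = 1]) in
  let X := fun t w => mu * theta w * t + Bm t w in
  let M := postM p mu X in
  decision_rule P X (tau_star M A B) (d_star M A) /\
  risk P theta c0 c1 c2 (tau_star M A B) (d_star M A)
  = ereal_inf [set r | exists tau d, decision_rule P X tau d /\
                                     r = risk P theta c0 c1 c2 tau d].
Proof.
move=> cP HB Hth mu0 c00 c10 c20 /andP[B0 B1] eB /andP[A0 A1] eA p X M.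
have [mn cn0 cn1] : [/\ mu != 0, c0 != 0 & c1 != 0] by split; rewrite gt_eqF.
have B2 : 1 - B ^+ 2 != 0 by rewrite gt_eqF// sq_gt0//; apply/andP; split; lra.
(* The equation for [B] is multiplied by 2 k = c1 / (2 mu^2), the one for [A] by ke = c0 / (2
   mu^2). *)
have ok : params_ok (c1 / (4 * mu ^+ 2)) (c0 / (2 * mu ^+ 2)) c2 B A.
  split => //.
  - by rewrite divr_gt0// mulr_gt0// exprn_gt0.
  - by rewrite divr_gt0// mulr_gt0// exprn_gt0.
  - by rewrite /LL eB; field; rewrite ?mn ?cn1.
  rewrite (_ : 2 * _ / _ = c0 / (2 * mu ^+ 2) * (c1 / (c0 * (1 - B ^+ 2)))); last first.
    by field; rewrite ?mn ?B2 ?cn0.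
  rewrite -eA /LL; move: (ln _) => l.
  have h1 : 1 - A != 0 by rewrite gt_eqF// subr_gt0.
  have h2 : 1 + A != 0 by rewrite gt_eqF// addr_gt0.
  field.
  by rewrite ?h1 ?h2 ?mn ?cn0.
have rule := star_decision_rule mu B HB Hth A0.
split; first exact: rule.
apply/eqP; rewrite eq_le; apply/andP; split.
  apply/ereal_infP => _ [tau [d [h ->]]].
  exact: (risk_star_le HB Hth mu0 c00 c10 ok cP h).
by apply: ereal_inf_lbound; exists (tau_star M A B), (d_star M A).
Qed.
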